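(* The context-free subset membership problem for black box groups is in $\mathbf{PSPACE}$. Here the problem is: given a finite group $G$ (accessed via a black box) and a context-free grammar $\mathcal{G}$ with terminal alphabet $G$, does $1\in L(\mathcal{G})$ hold?
   Context: A black box is a tuple $B=(b,c,\mathsf{valid},\mathsf{inv},\mathsf{prod},\mathsf{id},G,f)$ where $G$ is a finite group, $b,c\in\mathbb{N}$, and: - $f:\{0,1\}^b\to G\uplus\{\ast\}$ is a mapping with $G\subseteq f(\{0,1\}^b)$ (the strings in $f^{-1}(g)$ are the names of $g\in G$); - $\mathsf{valid}:\{0,1\}^b\to\{\mathsf{yes},\mathsf{no}\}$ with $\mathsf{valid}(x)=\mathsf{yes}$ iff $f(x)\in G$; - $\mathsf{inv}:\{0,1\}^b\to\{0,1\}^b$ with $f(\mathsf{inv}(x))=f(x)^{-1}$ for all $x\in f^{-1}(G)$; - $\mathsf{prod}:\{0,1\}^b\times\{0,1\}^b\to\{0,1\}^b$ with $f(\mathsf{prod}(x,y))=f(x)f(y)$ for all $x,y\in f^{-1}(G)$; - $\mathsf{id}:\{0,1\}^b\times\{0,1\}^c\to\{\mathsf{yes},\mathsf{no}\}$ such that for all $x\in f^{-1}(G)$: $f(x)=1$ iff there is $y\in\{0,1\}^c$ with $\mathsf{id}(x,y)=\mathsf{yes}$. A black box Turing machine $T$ is a (deterministic or nondeterministic) oracle Turing machine with an oracle tape and four query states, one for each of $\mathsf{valid},\mathsf{inv},\mathsf{prod},\mathsf{id}$. When coupled with a black box $B$ (written $T_B$), entering a query state replaces, in one step, the content of the oracle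 tape by the value of the corresponding function on the first $b$ (for $\mathsf{valid},\mathsf{inv}$), $2b$ (for $\mathsf{prod}$), resp. $b+c$ (for $\mathsf{id}$) bits of the oracle tape. The input of $T$ consists of the unary encoded numbers $b$ and $c$ and additional input $X$; the black box itself is not part of the input. A problem $\mathcal{P}$ whose instances are pairs $(G,X)$ of a finite group $G$ and additional data $X$ (possibly containing elements of $G$) belongs to $\mathbf{PSPACE}$ for black box groups if there is a black box Turing machine $T$ such that for every black box $B=(b,c,\mathsf{valid},\mathsf{inv},\mathsf{prod},\mathsf{id},G,f)$, $T_B$ accepts input $b,c,X$ (group elements in $X$ being represented by names from $f^{-1}(G)$) if and only if $(G,X)\in\mathcal{P}$, and $T_B$ uses space polynomial in $b+c+|X|$. Here $X$ is the grammar $\mathcal{G}$, in Chomsky normal form (productions $A\to BC$ or $A\to g$ with $A,B,C$ nonterminals, $g\in G$). Words over the alphabet $G$ are identified with the group elements they evaluate to, so $1\in L(\mathcal{G})$ means that $\mathcal{G}$ generates a word evaluating to the identity of $G$. *)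

(* Defs.v *)
From mathcomp Require Import all_boot ssralg poly fingroup.
From Stdlib Require Import Relation_Operators.

Set Implicit Arguments.
Unset Strict Implicit.
Unset Printing Implicit Defensive.

Definition word (n : nat) := n.-tuple bool.

(* [None] plays the role of the extra element [*] that [f] takes on strings
   naming no group element; the finite group [G] is all of [bb_group]. *)
Record black_box := BlackBox {
  bb_b : nat;
  bb_c : nat;
  bb_valid : word bb_b -> bool;
  bb_inv : word bb_b -> word bb_b;
  bb_prod : word bb_b -> word bb_b -> word bb_b;
  bb_id : word bb_b -> word bb_c -> bool;
  bb_group : finGroupType;
  bb_f : word bb_b -> option bb_group;
  bb_f_onto : forall g : bb_group, exists x, bb_f x = Some g;
  bb_validP : forall x, bb_valid x = isSome (bb_f x);
  bb_invP : forall x g, bb_f x = Some g -> bb_f (bb_inv x) = Some (g^-1)%g;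
  bb_prodP : forall x y g h,
    bb_f x = Some g -> bb_f y = Some h -> bb_f (bb_prod x y) = Some (g * h)%g;
  bb_idP : forall x g,
    bb_f x = Some g -> (g = 1%g <-> exists y, bb_id x y)
}.

(* Input alphabet {0, 1, #}: [Some] of a bit, or the separator [None]. *)
Definition letter := option bool.

Definition separator : letter := None.

(* Tape symbols: [None] is the blank; a nonblank symbol is an input letter or
   one of finitely many further symbols, which depend on the machine. *)
Definition cell (aux : finType) := option (letter + aux).

Inductive move := MoveLeft | Stay | MoveRight.

(* The tapes are numbered by ['I_(tm_work.+2)]: [ord0] initially holds the
   input, [ord_max] is the oracle tape, and the others are work tapes. An
   action consists of the new state and of the symbol written and the head move
   on every tape. *)
Record machine := Machine {
  tm_work : nat;
  tm_aux : finType;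
  tm_state : finType;
  tm_start : tm_state;
  tm_accept : tm_state;
  tm_qvalid : tm_state;
  tm_qinv : tm_state;
  tm_qprod : tm_state;
  tm_qid : tm_state;
  tm_query_uniq : uniq [:: tm_qvalid; tm_qinv; tm_qprod; tm_qid];
  tm_trans : tm_state -> {ffun 'I_(tm_work.+2) -> cell tm_aux} ->
             tm_state * {ffun 'I_(tm_work.+2) -> cell tm_aux * move} -> bool
}.

Definition deterministic (T : machine) : Prop :=
  forall q r a a', tm_trans (m := T) q r a -> tm_trans q r a' -> a = a'.

(* A tape is infinite to the right only: the list of its cells written so far,
   followed by blanks, together with the position of the head. *)
Definition tape (aux : finType) := (seq (cell aux) * nat)%type.

Definition scan aux (t : tape aux) : cell aux := nth None t.1 t.2.

(* Moving left from the leftmost cell leaves the head in place. *)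
Definition shift (m : move) (p : nat) : nat :=
  match m with MoveLeft => p.-1 | Stay => p | MoveRight => p.+1 end.

Definition write aux (t : tape aux) (a : cell aux * move) : tape aux :=
  (set_nth None t.1 t.2 a.1, shift a.2 t.2).

Definition tape_of aux (w : seq letter) : tape aux :=
  ([seq Some (inl x) | x <- w], 0).

Definition tape_space aux (t : tape aux) : nat := maxn (size t.1) t.2.+1.

Definition tapes (T : machine) :=
  {ffun 'I_((tm_work T).+2) -> tape (tm_aux T)}.

Definition config (T : machine) := (tm_state T * tapes T)%type.

Definition space (T : machine) (c : config T) : nat :=
  \sum_i tape_space (c.2 i).

(* The [n] bits on a tape from cell [m] on; every symbol other than 0 and 1,
   in particular the blank, is read as 0. *)
Definition bits aux (m n : nat) (t : tape aux) : word n :=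
  [tuple nth None t.1 (m + i) == Some (inl (Some true)) | i < n].

Definition answer (T : machine) (B : black_box) (q : tm_state T)
    (t : tape (tm_aux T)) : tape (tm_aux T) :=
  let b := bb_b B in
  let c := bb_c B in
  let result (s : seq bool) := tape_of (tm_aux T) [seq Some e | e <- s] in
  if q == tm_qvalid T then result [:: bb_valid (bits 0 b t)]
  else if q == tm_qinv T then result (bb_inv (bits 0 b t))
  else if q == tm_qprod T then result (bb_prod (bits 0 b t) (bits b b t))
  else if q == tm_qid T then result [:: bb_id (bits 0 b t) (bits b c t)]
  else t.

(* A step writes and moves on every tape and, if it enters a query state, then
   replaces the content of the oracle tape. The computation continues from the
   query state by an ordinary transition. *)
Definition step (T : machine) (B : black_box) (c c' : config T) : Prop :=
  exists2 a, tm_trans c.1 [ffun i => scan (c.2 i)] a &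
    c' = (a.1, [ffun i => let t := write (c.2 i) (a.2 i) in
                          if i == ord_max then answer B a.1 t else t]).

Definition initial (T : machine) (w : seq letter) : config T :=
  (tm_start T, [ffun i => tape_of (tm_aux T) (if i == ord0 then w else [::])]).

Definition reaches (T : machine) (B : black_box) : config T -> config T -> Prop :=
  clos_refl_trans (config T) (@step T B).

Definition accepts (T : machine) (B : black_box) (w : seq letter) : Prop :=
  exists2 c, reaches B (initial T w) c & c.1 = tm_accept T.

(* The input 1^b # 1^c # X. *)
Definition bb_input (B : black_box) (w : seq letter) : seq letter :=
  nseq (bb_b B) (Some true) ++ separator ::
  nseq (bb_c B) (Some true) ++ separator :: w.

(* [pb_codes B X w]: the string [w] represents the additional data [X], group
   elements in [X] being represented by names with respect to [B]. *)
Record problem := Problem {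
  pb_data : finGroupType -> Type;
  pb_holds : forall gT : finGroupType, pb_data gT -> Prop;
  pb_codes : forall B : black_box, pb_data (bb_group B) -> seq letter -> Prop
}.

Definition in_PSPACE (P : problem) : Prop :=
  exists T : machine, deterministic T /\
  exists p : {poly nat},
  forall (B : black_box) (X : pb_data P (bb_group B)) (w : seq letter),
    pb_codes X w ->
    (accepts T B (bb_input B w) <-> pb_holds X) /\
    (forall c, reaches B (initial T (bb_input B w)) c ->
       space c <= (p.[(bb_b B + bb_c B + size w)%N])%R).

(* [(A, inl (B, C))] is the production A -> BC and [(A, inr a)] is A -> a. *)
Definition production (N T : Type) := (N * (N * N + T))%type.

Record cnf_grammar (T : Type) := CnfGrammar {
  cfg_nonterm : finType;
  cfg_start : cfg_nonterm;
  cfg_prods : seq (production cfg_nonterm T)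
}.

Definition rhs (N T : Type) (r : production N T) : seq (N + T) :=
  match r.2 with
  | inl (B, C) => [:: inl B; inl C]
  | inr a => [:: inr a]
  end.

Definition derives1 (T : eqType) (X : cnf_grammar T)
    (s s' : seq (cfg_nonterm X + T)) : Prop :=
  exists u v r, [/\ r \in cfg_prods X,
    s = u ++ inl r.1 :: v & s' = u ++ rhs r ++ v].

Definition derives (T : eqType) (X : cnf_grammar T) :=
  clos_refl_trans (seq (cfg_nonterm X + T)) (@derives1 T X).

Definition language (T : eqType) (X : cnf_grammar T) (w : seq T) : Prop :=
  derives (X := X) [:: inl (cfg_start X)] [seq inr a | a <- w].

Definition generates_one (gT : finGroupType) (X : cnf_grammar gT) : Prop :=
  exists2 w : seq gT, language X w & (\prod_(g <- w) g)%g = 1%g.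

(* A -> BC is coded by #0A#B#C, and A -> x by #1A#x. *)
Definition production_code (N : Type) (nt : N -> seq bool) (b : nat)
    (r : production N (word b)) : seq letter :=
  let bin (s : seq bool) : seq letter := [seq Some e | e <- s] in
  match r.2 with
  | inl (B, C) => separator :: Some false ::
      bin (nt r.1) ++ separator :: bin (nt B) ++ separator :: bin (nt C)
  | inr x => separator :: Some true :: bin (nt r.1) ++ separator :: bin x
  end.

Definition decode_production (B : black_box) (N : Type)
    (r : production N (word (bb_b B))) : option (production N (bb_group B)) :=
  match r.2 with
  | inl BC => Some (r.1, inl BC)
  | inr x => omap (fun g => (r.1, inr g)) (bb_f x)
  end.

(* The start symbol followed by the productions. Nonterminals are written as
   arbitrary distinct bit strings, and different occurrences of a group element
   may be written by different names. *)
Definition grammar_codes (B : black_box) (X : cnf_grammar (bb_group B))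
    (w : seq letter) : Prop :=
  exists (nt : cfg_nonterm X -> seq bool)
         (s : seq (production (cfg_nonterm X) (word (bb_b B)))),
  [/\ injective nt,
      [seq decode_production r | r <- s] = [seq Some r | r <- cfg_prods X] &
      w = [seq Some e | e <- nt (cfg_start X)] ++
          flatten [seq production_code nt r | r <- s]].

Definition cf_subset_membership : problem := {|
  pb_data := fun gT => cnf_grammar gT;
  pb_holds := generates_one;
  pb_codes := grammar_codes
|}.

(* Main.v *)
(** A tree deriving [g] from the nonterminal [A] is measured by its Strahler
    number. For fixed [s], the pairs [(u, v)] such that [A] derives [u A v] along
    a path whose side trees have Strahler number at most [s] form a subgroup of
    [G * G^op], and it grows with [s]. As [|G| <= 2 ^ b], such a subgroup can grow
    at most [2 b] times; once none of them grows over a long enough range, cutting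
    trees at lowest occurrences of their root symbol shows that the derivable
    pairs [(A, g)] do not change any more. Hence every derivable pair has a tree
    of polynomial Strahler number. Expanding the subtree of smaller number first
    reduces the goal "the start symbol derives 1" to no goal at all through lists
    of polynomially many goals [(A, g)]. A single reduction step is checked with
    the black box, a certificate for [id] being guessed along with the list, and
    reachability between lists is decided by Savitch's midpoint recursion. *)

From HB Require Import structures.
From mathcomp Require Import all_boot ssralg poly fingroup gproduct.
From mathcomp Require Import zify boolp.
From Stdlib Require Import Relation_Operators Operators_Properties.
Require Import Defs.

Set Implicit Arguments.
Unset Strict Implicit.
Unset Printing Implicit Defensive.

(** * Stack programs and their compilation *)

(** The group may have [2 ^ b] elements and derivation trees may be exponentially large, so neither
    a table of derivable pairs [(A, g)] nor a tree fits in polynomial space. Chains of subgroups,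
    however, have length linear in [b], and this is what keeps Strahler numbers small. The oracle
    [id] certifies equality with 1 and never inequality, so every condition on group elements is put
    as a product being 1 and occurs positively; even a name of 1 has to be guessed. All guesses are
    part of the strings over which midpoints range. The strings are padded to a common length P and
    read as numbers in base 8, so enumerating midpoints is counting, and a path without repetitions
    has at most 8^P = 2^(3P) strings; hence the recursion depth 3P. The value of P, the fifth power
    of the input length plus 8, comes from a cubic Strahler bound, goals of linear length, and one
    more factor that absorbs the constants. Since machines are raw transition tables, the search is
    written in a small language of stack programs whose space is counted in symbols. *)

Inductive sym :=
  Zero | One | Hash | Bar | Prod | Term | Start | End | Dollar.

(** The order matters: the first eight symbols are the digits of the base-8 counter of the midpoint
    search, [Zero] being 0 and [End] being 7, while [Dollar] stays free as a delimiter and a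
    mark. *)
Definition sym_nat (x : sym) : nat :=
  match x with
  | Zero => 0 | One => 1 | Hash => 2 | Bar => 3 | Prod => 4
  | Term => 5 | Start => 6 | End => 7 | Dollar => 8
  end.

Definition syms := [:: Zero; One; Hash; Bar; Prod; Term; Start; End; Dollar].

Lemma sym_natK : cancel sym_nat (nth Dollar syms).
Proof. by case. Qed.

HB.instance Definition _ := Countable.copy sym (can_type sym_natK).

Lemma syms_enum : Finite.axiom syms.
Proof. by case. Qed.

HB.instance Definition _ := isFinite.Build sym syms_enum.

Definition move_code (m : move) : option bool :=
  match m with MoveLeft => Some false | Stay => None | MoveRight => Some true end.

Definition code_move (x : option bool) : move :=
  match x with Some false => MoveLeft | None => Stay | Some true => MoveRight end.

Lemma move_codeK : cancel move_code code_move.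
Proof. by case. Qed.

HB.instance Definition _ := Countable.copy move (can_type move_codeK).

Definition bsym (e : bool) : sym := if e then One else Zero.

Definition lsym (x : letter) : sym := if x is Some e then bsym e else Hash.

Definition isbit (x : sym) : bool := (x == Zero) || (x == One).

Inductive query := QValid | QInv | QProd | QId.

Definition stacks := seq (seq sym).

Definition top_test := seq (option sym) -> bool.

(** A tape whose head stands at the end of its content is a stack, so each stack gets a tape and the
    basic operations become one or two machine steps. [Ask q i j] empties stack [i], reading it from
    the top, and pushes the reply so that its last bit ends on top. *)
Inductive prog :=
  | Skip
  | Pop of nat
  | Push of nat & sym
  | Dup of nat & nat
  | Modify of nat & (sym -> sym)
  | Ask of query & nat & nat
  | Seq of prog & prog
  | If of top_test & prog & prog
  | While of top_test & prog.

Definition get (s : stacks) (i : nat) : seq sym := nth [::] s i.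

Definition upd (s : stacks) (i : nat) (v : seq sym) : stacks :=
  set_nth [::] s i v.

Definition total (s : stacks) : nat := sumn (map size s).

Definition tops (s : stacks) : seq (option sym) := map ohead s.

(** Missing and foreign symbols count as 0, in agreement with [bits], so queries need no check of
    their length. *)
Definition read_word (m n : nat) (a : seq sym) : word n :=
  [tuple nth Zero a (m + i) == One | i < n].

Definition reply (B : black_box) (q : query) (a : seq sym) : seq bool :=
  let b := bb_b B in
  match q with
  | QValid => [:: bb_valid (read_word 0 b a)]
  | QInv => bb_inv (read_word 0 b a)
  | QProd => bb_prod (read_word 0 b a) (read_word b b a)
  | QId => [:: bb_id (read_word 0 b a) (read_word b (bb_c B) a)]
  end.

Lemma total_upd s i v : i < size s ->
  total (upd s i v) + size (get s i) = total s + size v.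
Proof.
elim: s i => [|x s IH] [|i] //=; rewrite /total /upd /get /=; first by lia.
by rewrite ltnS => /IH; rewrite /total /upd /get; lia.
Qed.

Lemma size_upd s i v : i < size s -> size (upd s i v) = size s.
Proof. by move=> h; rewrite size_set_nth; apply/maxn_idPr. Qed.

Lemma get_upd s i v j : get (upd s i v) j = if j == i then v else get s j.
Proof. by rewrite /get /upd nth_set_nth. Qed.

Lemma size_get s i : size (get s i) <= total s.
Proof.
elim: s i => [|x s IH] [|i] //=; rewrite /get /total /=; first exact: leq_addr.
by apply: leq_trans (IH i) _; apply: leq_addl.
Qed.

(** * Semantics of stack programs within a space bound *)

Section Exec.

Variables (B : black_box) (N : nat).

(* The stacks never hold more than [N] symbols altogether. *)
Inductive exec : prog -> stacks -> stacks -> Prop :=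
  | exec_skip s : exec Skip s s
  | exec_pop s i : i < size s -> exec (Pop i) s (upd s i (behead (get s i)))
  | exec_push s i a : i < size s -> total s < N ->
      exec (Push i a) s (upd s i (a :: get s i))
  | exec_dup s i j a r : i < size s -> j < size s -> i != j -> total s < N ->
      get s i = a :: r -> exec (Dup i j) s (upd s j (a :: get s j))
  | exec_modify s i f : i < size s ->
      exec (Modify i f) s (upd s i (if get s i is a :: r then f a :: r else [::]))
  | exec_ask s q i j : i < size s -> j < size s -> i != j ->
      total s + size (reply B q (get s i)) <= N ->
      exec (Ask q i j) s
        (upd (upd s i [::]) j (rev (map bsym (reply B q (get s i))) ++ get s j))
  | exec_seq p p' s s' s'' :
      exec p s s' -> exec p' s' s'' -> exec (Seq p p') s s''
  | exec_if (c : top_test) p p' s s' : exec (if c (tops s) then p else p') s s' ->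
      exec (If c p p') s s'
  | exec_while_false (c : top_test) p s : ~~ c (tops s) -> exec (While c p) s s
  | exec_while_true (c : top_test) p s s' s'' : c (tops s) -> exec p s s' ->
      exec (While c p) s' s'' -> exec (While c p) s s''.

Lemma exec_size p s s' : exec p s s' -> size s' = size s.
Proof. by elim => //= *; rewrite ?size_upd //; congruence. Qed.

Lemma exec_total p s s' : exec p s s' -> total s <= N -> total s' <= N.
Proof.
elim => {p s s'} //.
- move=> s i h; have := total_upd (behead (get s i)) h.
  by rewrite size_behead; lia.
- by move=> s i a h lt _; have := total_upd (a :: get s i) h => /=; lia.
- by move=> s i j a r hi hj _ lt _ _; have := total_upd (a :: get s j) hj => /=; lia.
- move=> s i f h.
  have := total_upd (if get s i is a :: r then f a :: r else [::]) h.
  by case: (get s i) => [|a r] /=; lia.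
- move=> s q i j hi hj ij le _; have := total_upd [::] hi.
  have hj' : j < size (upd s i [::]) by rewrite size_upd.
  have := total_upd (rev (map bsym (reply B q (get s i))) ++ get s j) hj'.
  by rewrite get_upd eq_sym (negbTE ij) size_cat size_rev size_map /=; lia.
- by move=> p p' s s' s'' _ IH1 _ IH2 /IH1/IH2.
- by move=> c p s s' s'' _ _ IH1 _ IH2 /IH1/IH2.
Qed.

End Exec.

Section Compiler.

Variable K : nat.

Definition tape_index := 'I_(K.+1.+2).
Definition stack_tape (i : nat) : tape_index := inord i.+1.
(** The query states are four fixed states and cannot record where to resume; the label to return to
    is written on this tape. *)
Definition return_tape : tape_index := inord K.+1.

Lemma stack_tape_inj i j : i < K -> j < K ->
  (stack_tape i == stack_tape j) = (i == j).
Proof. by move=> hi hj; rewrite -val_eqE /= !inordK ?eqSS //; lia. Qed.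

Lemma stack_tape_max i : i < K -> (stack_tape i == ord_max) = false.
Proof. by move=> hi; rewrite -val_eqE /= inordK; lia. Qed.

Lemma stack_tape0 i : i < K -> (stack_tape i == ord0) = false.
Proof. by move=> hi; rewrite -val_eqE /= inordK; lia. Qed.

Lemma stack_return i : i < K -> (stack_tape i == return_tape) = false.
Proof. by move=> hi; rewrite -val_eqE /= !inordK; lia. Qed.

Lemma return_max : (return_tape == ord_max) = false.
Proof. by rewrite -val_eqE /= inordK; lia. Qed.

(** * Translation of stack programs into transition tables *)

Section Code.

(* The code has [n] instructions; the labels [n] and [n.+1] are those of the
   final test and of the accepting state. *)
Variable n : nat.

Definition aux := (sym + 'I_n.+2)%type.
Definition reads := {ffun tape_index -> cell aux}.
Definition acts := tape_index -> cell aux * move.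
(* A jump either goes to a label or makes a query and returns to a label. *)
Definition jump := (nat + query * nat)%type.
Definition instr := reads -> jump * acts.

Definition enc (x : sym) : cell aux := Some (inr (inl x)).
Definition label (l : nat) : cell aux := Some (inr (inr (inord l))).

Definition dec (x : cell aux) : option sym :=
  match x with
  | Some (inl a) => Some (lsym a)
  | Some (inr (inl a)) => Some a
  | _ => None
  end.

Definition enc_bit (x : option sym) : cell aux :=
  Some (inl (Some (x == Some One))).

Definition keep (r : reads) : acts := fun i => (r i, Stay).
Definition on (t : tape_index) (v : cell aux * move) (f : acts) : acts :=
  fun i => if i == t then v else f i.

Definition do_pop i (r : reads) := on (stack_tape i) (None, MoveLeft) (keep r).
Definition do_right i (r : reads) :=
  on (stack_tape i) (r (stack_tape i), MoveRight) (keep r).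
Definition do_put i x (r : reads) := on (stack_tape i) (x, Stay) (keep r).

Definition read_tops (r : reads) : seq (option sym) :=
  [seq dec (r (stack_tape i)) | i <- iota 0 K].

Definition lift_top (f : sym -> sym) (x : cell aux) : cell aux :=
  if dec x is Some a then enc (f a) else None.

Fixpoint len (p : prog) : nat :=
  match p with
  | Skip => 0
  | Pop _ | Modify _ _ => 1
  | Push _ _ | Dup _ _ => 2
  | Ask _ _ _ => 4
  | Seq p q => len p + len q
  | If _ p q => (len p + len q).+2
  | While _ p => (len p).+2
  end.

Definition goto l : instr := fun r : reads => (inl l, keep r).

(* After a query the oracle tape is read out; the dummy query that follows
   brings its head back to the first cell. *)
Definition ask_code q i j b : seq instr :=
  [:: fun r : reads => if dec (r (stack_tape i)) is Some a
               then (inl b, on ord_max (enc_bit (Some a), MoveRight) (do_pop i r))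
               else (inr (q, b.+1), keep r);
      fun r : reads => if r ord_max == None then (inr (QValid, b.+3), keep r)
               else (inl b.+2, do_right j r);
      fun r : reads => (inl b.+1,
                on ord_max (r ord_max, MoveRight)
                   (do_put j (lift_top id (r ord_max)) r));
      fun r : reads => (inl b.+4, on ord_max (None, Stay) (keep r))].

Fixpoint comp (p : prog) (b : nat) : seq instr :=
  match p with
  | Skip => [::]
  | Pop i => [:: fun r : reads => (inl b.+1, do_pop i r)]
  | Push i a => [:: fun r : reads => (inl b.+1, do_right i r);
                    fun r : reads => (inl b.+2, do_put i (enc a) r)]
  | Dup i j => [:: fun r : reads => (inl b.+1, do_right j r);
                   fun r : reads => (inl b.+2, do_put j (r (stack_tape i)) r)]
  | Modify i f =>
      [:: fun r : reads => (inl b.+1, do_put i (lift_top f (r (stack_tape i))) r)]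
  | Ask q i j => ask_code q i j b
  | Seq p q => comp p b ++ comp q (b + len p)
  | If c p q =>
      (fun r : reads => (inl (if c (read_tops r) then b.+1 else b.+2 + len p), keep r))
      :: comp p b.+1 ++ goto (b.+2 + len p + len q) :: comp q (b.+2 + len p)
  | While c p =>
      (fun r : reads => (inl (if c (read_tops r) then b.+1 else b.+2 + len p), keep r))
      :: rcons (comp p b.+1) (goto b)
  end.

Lemma size_comp p b : size (comp p b) = len p.
Proof.
elim: p b => //=.
- by move=> p IHp q IHq b; rewrite size_cat IHp IHq.
- by move=> c p IHp q IHq b; rewrite size_cat /= IHp IHq addnS.
- by move=> c p IHp b; rewrite size_rcons IHp.
Qed.

Definition load : seq instr :=
  [:: fun r : reads => if r ord0 == None then (inl 3, keep r)
                       else (inl 1, do_right 0 r);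
      fun r : reads => (inl 2, do_put 0 (lift_top id (r ord0)) r);
      fun r : reads => (inl 0, on ord0 (r ord0, MoveRight) (keep r))].

Variables (code : seq instr) (accept : top_test).

Definition state := ('I_n.+2 + 'I_4)%type.
Definition lab (l : nat) : state := inl (inord l).
Definition qstate (q : query) : state :=
  inr (inord match q with QValid => 0 | QInv => 1 | QProd => 2 | QId => 3 end).

(** Acceptance and rejection both halt: label [n] has a transition only if the test succeeds, and
    label [n.+1] has none. This makes [runs_reach] applicable to either outcome. *)
Definition delta (q : state) (r : reads) : option (state * acts) :=
  match q with
  | inl l =>
      if l < n then
        let: (j, a) := nth (goto 0) code l r in
        match j with
        | inl l' => Some (lab l', a)
        | inr (k, l') => Some (qstate k, on return_tape (label l', Stay) a)
        end
      else if (l == n :> nat) && accept (read_tops r)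
           then Some (lab n.+1, keep r) else None
  | inr _ => if r return_tape is Some (inr (inr l)) then Some (inl l, keep r)
             else None
  end.

Definition trans (q : state) (r : reads)
    (a : state * {ffun tape_index -> cell aux * move}) : bool :=
  if delta q r is Some (q', f) then a == (q', finfun f) else false.

Lemma query_uniq :
  uniq [:: qstate QValid; qstate QInv; qstate QProd; qstate QId].
Proof.
rewrite -[X in uniq X]/(map (fun x => inr (inord x) : state) (iota 0 4)).
rewrite map_inj_in_uniq // => x y; rewrite !mem_iota /= => hx hy [] /(congr1 val).
by rewrite /= !inordK.
Qed.

Definition tm : machine := @Machine K.+1 aux state (lab 0) (lab n.+1)
  (qstate QValid) (qstate QInv) (qstate QProd) (qstate QId) query_uniq trans.

Lemma tm_deterministic : deterministic tm.
Proof.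
move=> q r a a'; rewrite /= /trans.
by case: (delta q r) => [[q' f]|//] /eqP -> /eqP ->.
Qed.

Lemma delta_accept r : delta (lab n.+1) r = None.
Proof. by rewrite /delta /lab inordK // ltnNge leqnSn /= gtn_eqF. Qed.

(** * Correctness and space of the compiled code *)

Section Simulation.

Variables (B : black_box) (S N : nat).

Notation tapes := (tapes tm).

Definition ok (c : config tm) : Prop := forall i, tape_space (c.2 i) <= S.

Inductive runs : config tm -> config tm -> Prop :=
  | runs_refl c : ok c -> runs c c
  | runs_step c c1 c2 : ok c -> step B c c1 -> runs c1 c2 -> runs c c2.

Lemma runs_trans c1 c2 c3 : runs c1 c2 -> runs c2 c3 -> runs c1 c3.
Proof.
by elim=> // {c1 c2} c c1 c2 okc cc1 _ IH /IH; apply: runs_step.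
Qed.

Lemma tm_step_eq c c1 c2 : step B c c1 -> step B c c2 -> c1 = c2 :> config tm.
Proof.
by move=> [a1 t1 ->] [a2 t2 ->]; rewrite (tm_deterministic t1 t2).
Qed.

(** By determinism every reachable configuration lies on the one halting run. This yields both the
    answer and a space bound for all reachable configurations. *)
Lemma runs_reach c c' d : runs c c' -> (forall e, ~ step B c' e) ->
  reaches B c d -> runs d c'.
Proof.
move=> cc' stop /(@clos_rt_rt1n _ _ _ _) cd.
elim: cd cc' => // {c d} c c1 d cc1 _ IH cc'; apply: IH.
case: cc' stop cc1 => [e _ /(_ c1)//|e e1 e2 _ ee1 e12 _ ec1].
by rewrite (tm_step_eq ec1 ee1).
Qed.

Lemma runs_ok c c' : runs c c' -> ok c.
Proof. by case. Qed.

Lemma runs_reaches c c' : runs c c' -> reaches B c c'.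
Proof.
elim=> [e _|e e1 e2 _ ee1 _ IH]; first exact: rt_refl.
by apply: rt_trans IH; apply: rt_step.
Qed.

(** Every step writes on every tape, so a tape left alone may still get blanks appended to its list.
    [same] ignores this; the space is unaffected, because it already counts the cell under the
    head. *)
Definition same (t t' : tape aux) : Prop :=
  [/\ t.2 = t'.2, forall k, nth None t.1 k = nth None t'.1 k
    & tape_space t = tape_space t'].

Lemma same_refl t : same t t. Proof. by []. Qed.

Lemma same_trans t1 t2 t3 : same t1 t2 -> same t2 t3 -> same t1 t3.
Proof.
move=> [a1 b1 c1] [a2 b2 c2]; split; try congruence.
Qed.

Definition hold (t : tape aux) : tape aux := write t (scan t, Stay).

Lemma same_hold t : same t (hold t).
Proof.
case: t => l p; split=> //= [k|].
  by rewrite nth_set_nth /=; case: eqP => [->|].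
by rewrite /tape_space /= size_set_nth maxnAC maxnn maxnC.
Qed.

Lemma same_scan t t' : same t t' -> scan t = scan t'.
Proof. by case=> e h _; rewrite /scan e h. Qed.

(** Cell 0 stays blank, so an empty stack shows a blank under the head, and popping it is harmless
    because the head cannot move left of cell 0. Cells beyond the head are arbitrary. *)
Definition stk (st : seq sym) (t : tape aux) : Prop :=
  t.2 = size st /\ forall k, k <= size st ->
    nth None t.1 k = nth None (None :: map enc (rev st)) k.

Lemma same_stk st t t' : same t t' -> stk st t -> stk st t'.
Proof. by move=> [e h _] [e1 h1]; split=> [|k /h1]; rewrite -?e -?h. Qed.

Lemma stk_scan st t : stk st t -> scan t = if st is x :: _ then enc x else None.
Proof.
move=> [e h]; rewrite /scan e h //; case: st {e h} => //= x st.
rewrite (nth_map Zero) ?size_rev //=.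
by rewrite rev_cons nth_rcons size_rev ltnn eqxx.
Qed.

Lemma stk_pop st t : stk st t -> stk (behead st) (write t (None, MoveLeft)).
Proof.
move=> [e h]; split=> /=; first by rewrite e size_behead.
move=> k; rewrite size_behead => hk; rewrite nth_set_nth /= e.
case: eqP => [kE|/eqP neq].
  by have -> : k = 0 by lia.
rewrite h; last by lia.
case: st neq hk {e h} => //= x st neq hk.
case: k neq hk => //= k neq hk.
by rewrite rev_cons map_rcons nth_rcons size_map size_rev; case: ltnP => //; lia.
Qed.

Lemma stk_push st t t' x : stk st t -> same (write t (scan t, MoveRight)) t' ->
  stk (x :: st) (write t' (enc x, Stay)).
Proof.
move=> [e h] [/= e' h' _]; split=> /=; first by rewrite -e' e.
move=> k hk; rewrite nth_set_nth /= -e' e -h' nth_set_nth /= e.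
case: eqP => [->|neq].
  by rewrite /= rev_cons map_rcons nth_rcons size_map size_rev ltnn eqxx.
have hk' : k <= size st by lia.
rewrite /= rev_cons map_rcons -rcons_cons nth_rcons /= size_map size_rev ltnS hk'.
by case: eqP => [->|_]; rewrite -h // /scan e.
Qed.

Lemma write_space (t : tape aux) a : tape_space (write t a) <= maxn (tape_space t) (shift a.2 t.2).+1.
Proof.
by rewrite /tape_space /= size_set_nth; lia.
Qed.

Definition oracle (w : seq (cell aux)) (p : nat) (t : tape aux) : Prop :=
  t.2 = p /\ forall k, nth None t.1 k = nth None w k.

Lemma same_oracle w p t t' : same t t' -> oracle w p t -> oracle w p t'.
Proof. by move=> [e h _] [e1 h1]; split=> [|k]; rewrite -?e -?h. Qed.

Definition rep (s : stacks) (w : seq (cell aux)) (p : nat) (f : tapes) : Prop :=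
  [/\ size s = K, total s <= N,
      forall i, i < K -> stk (get s i) (f (stack_tape i)),
      oracle w p (f ord_max) & forall i, tape_space (f i) <= S].

Lemma rep_ok s w p f q : rep s w p f -> ok (q, f).
Proof. by case. Qed.

Lemma read_topsE s w p f (r : reads) : rep s w p f -> (forall i, r i = scan (f i)) ->
  read_tops r = tops s.
Proof.
move=> [szs _ st _ _] rE; apply: (@eq_from_nth _ None).
  by rewrite !size_map size_iota.
rewrite size_map size_iota => i hi.
rewrite (nth_map 0) ?size_iota // nth_iota // add0n rE (stk_scan (st i hi)).
by rewrite (nth_map [::]) ?szs // /get; case: (nth _ s i).
Qed.

Lemma step_lab l (f : tapes) l' a : l < n ->
  nth (goto 0) code l [ffun i => scan (f i)] = (inl l', a) ->
  step B ((lab l, f) : config tm) (lab l', [ffun i => write (f i) (a i)]).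
Proof.
move=> ln nthE; exists (lab l', finfun a).
  rewrite /= /trans /delta /lab inordK; last by lia.
  by rewrite ln nthE.
congr pair; apply/ffunP=> i; rewrite !ffunE /=.
by case: eqP => // _; rewrite /answer.
Qed.

Lemma step_query l (f : tapes) k l' a : l < n ->
  nth (goto 0) code l [ffun i => scan (f i)] = (inr (k, l'), a) ->
  step B ((lab l, f) : config tm)
    (qstate k, [ffun i =>
       let t := write (f i) (if i == return_tape then (label l', Stay) else a i) in
       if i == ord_max then answer (T := tm) B (qstate k) t else t]).
Proof.
move=> ln nthE; exists (qstate k, finfun (on return_tape (label l', Stay) a)).
  rewrite /= /trans /delta /lab inordK; last by lia.
  by rewrite ln nthE.
by congr pair; apply/ffunP=> i; rewrite !ffunE.
Qed.

Lemma step_ret k l (f : tapes) : scan (f return_tape) = label l ->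
  step B ((qstate k, f) : config tm) (lab l, [ffun i => hold (f i)]).
Proof.
move=> rl; pose r : reads := [ffun i => scan (f i)].
exists (lab l, finfun (keep r)); first by rewrite /= /trans /= ffunE rl; apply/eqP.
congr pair; apply/ffunP=> i; rewrite !ffunE /= /keep ffunE.
by case: eqP => // _; rewrite /answer.
Qed.

Lemma rep_upd s w p w' p' (f g : tapes) i st : rep s w p f -> i < K ->
  stk st (g (stack_tape i)) -> tape_space (g (stack_tape i)) <= S ->
  oracle w' p' (g ord_max) -> tape_space (g ord_max) <= S ->
  (forall j, j != stack_tape i -> j != ord_max -> same (f j) (g j)) ->
  total (upd s i st) <= N -> rep (upd s i st) w' p' g.
Proof.
move=> [szs _ stf _ spf] hi sti spi orc spo eqg tot; split=> //.
- by rewrite size_upd ?szs.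
- move=> j hj; rewrite get_upd; case: eqP => [->//|/eqP ji].
  apply: (same_stk _ (stf j hj)); apply: eqg; last by rewrite stack_tape_max.
  by rewrite stack_tape_inj.
move=> j; case: (eqVneq j (stack_tape i)) => [->//|ji].
case: (eqVneq j ord_max) => [->//|jm].
by have [_ _ <-] := eqg j ji jm.
Qed.

Lemma rep_same s w p w' p' (f g : tapes) : rep s w p f ->
  oracle w' p' (g ord_max) -> tape_space (g ord_max) <= S ->
  (forall i, tape_space (g i) <= S) ->
  (forall i, i < K -> same (f (stack_tape i)) (g (stack_tape i))) ->
  rep s w' p' g.
Proof.
move=> [szs tot stf _ spf] orc spo spg eqg; split=> // i hi.
exact: same_stk (eqg i hi) (stf i hi).
Qed.

Definition located (blk : seq instr) (l : nat) : Prop :=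
  l + size blk <= n /\
  forall i, i < size blk -> nth (goto 0) code (l + i) = nth (goto 0) blk i.

Lemma located_cat b1 b2 l : located (b1 ++ b2) l ->
  located b1 l /\ located b2 (l + size b1).
Proof.
rewrite /located size_cat addnA => -[le h]; split; split.
- by apply: leq_trans le; apply: leq_addr.
- by move=> i hi; rewrite h ?nth_cat ?hi //; apply: ltn_addr.
- by [].
move=> i hi; rewrite -addnA h ?nth_cat; last by rewrite ltn_add2l.
by rewrite ltnNge leq_addr /= addKn.
Qed.

Lemma located_cons i blk l : located (i :: blk) l ->
  [/\ l < n, nth (goto 0) code l = i & located blk l.+1].
Proof.
move=> /(@located_cat [:: i]) [[le h] h2]; split; last by rewrite -addn1.
  by rewrite /= addn1 in le.
by move: (h 0 isT); rewrite addn0.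
Qed.

Hypothesis NS : N.+2 <= S.

Definition scans (f : tapes) : reads := [ffun i => scan (f i)].

Lemma scansE f i : scans f i = scan (f i). Proof. by rewrite ffunE. Qed.

Lemma runs1 c c' : ok c -> ok c' -> step B c c' -> runs c c'.
Proof. by move=> okc okc' st; apply: runs_step st (runs_refl okc'). Qed.

Lemma rep_hold s w p f : rep s w p f -> rep s w p [ffun i => hold (f i)].
Proof.
move=> rp; have [_ _ _ orc spf] := rp.
have sm i : same (f i) ([ffun i => hold (f i)] i) by rewrite ffunE; apply: same_hold.
have sp i : tape_space ([ffun i => hold (f i)] i) <= S by have [_ _ <-] := sm i.
apply: rep_same rp (same_oracle (sm ord_max) orc) (sp ord_max) sp _ => i _; exact: sm.
Qed.

Lemma sim_jump s w p (f : tapes) l l' : rep s w p f -> l < n ->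
  nth (goto 0) code l (scans f) = (inl l', keep (scans f)) ->
  exists2 g : tapes, rep s w p g & runs (lab l, f) (lab l', g).
Proof.
move=> rp ln codel; exists [ffun i => hold (f i)]; first exact: rep_hold.
have := step_lab ln codel.
rewrite (_ : [ffun i => _] = [ffun i => hold (f i)] :> tapes).
  by move=> st; apply: runs1 st; apply: rep_ok; [exact: rp | exact: rep_hold rp].
by apply/ffunP=> i; rewrite !ffunE /= /keep scansE.
Qed.

Lemma sim_write s w p (f : tapes) l l' i v st : rep s w p f -> l < n -> i < K ->
  nth (goto 0) code l (scans f) = (inl l', on (stack_tape i) v (keep (scans f))) ->
  stk st (write (f (stack_tape i)) v) ->
  tape_space (write (f (stack_tape i)) v) <= S -> total (upd s i st) <= N ->
  exists2 g : tapes, rep (upd s i st) w p g & runs (lab l, f) (lab l', g).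
Proof.
move=> rp ln hi codel stv spv tot.
have stp := step_lab ln codel; set g := finfun _ in stp.
have [szs _ stf orc spf] := rp.
have gi : g (stack_tape i) = write (f (stack_tape i)) v by rewrite ffunE /on eqxx.
have gj j : j != stack_tape i -> same (f j) (g j).
  by move=> ji; rewrite ffunE /on (negbTE ji) /keep scansE; apply: same_hold.
have gm : same (f ord_max) (g ord_max) by apply: gj; rewrite eq_sym stack_tape_max.
have rg : rep (upd s i st) w p g.
  apply: (rep_upd rp hi _ _ _ _ _ tot); rewrite ?gi //.
  - exact: same_oracle gm orc.
  - by have [_ _ <-] := gm.
  - by move=> j ji _; apply: gj.
by exists g => //; apply: runs1 stp; [apply: rep_ok rp | apply: rep_ok rg].
Qed.

(** The second instruction is specified for all reads that agree with [f] off stack [i], because the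
    cell entered by the head of that stack may hold anything. It may act on the oracle tape too,
    which serves to read out replies. The last clause keeps track of the input tape, which [rep]
    does not mention. *)
Lemma sim_push_frame s w p w' p' (f : tapes) l l1 l2 i x (a : reads -> acts) v :
  rep s w p f -> l < n -> l1 < n -> i < K -> total s < N ->
  nth (goto 0) code l (scans f) = (inl l1, do_right i (scans f)) ->
  (forall r : reads, (forall j, j != stack_tape i -> r j = scan (f j)) ->
    nth (goto 0) code l1 r = (inl l2, a r)
    /\ forall j, a r j = if j == stack_tape i then (enc x, Stay)
                      else if j == ord_max then v else (r j, Stay)) ->
  (forall t, same (f ord_max) t ->
     oracle w' p' (write t v) /\ tape_space (write t v) <= S) ->
  exists g : tapes, [/\ rep (upd s i (x :: get s i)) w' p' g,
    runs (lab l, f) (lab l2, g) &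
    forall j, j != stack_tape i -> j != ord_max -> same (f j) (g j)].
Proof.
move=> rp ln l1n hi tot codel codel1 orcv.
have stp1 := step_lab ln codel; set f1 := finfun _ in stp1.
have [szs _ stf orc spf] := rp.
have f1i : f1 (stack_tape i) =
    write (f (stack_tape i)) (scan (f (stack_tape i)), MoveRight).
  by rewrite ffunE /do_right /on eqxx ffunE.
have f1j j : j != stack_tape i -> same (f j) (f1 j).
  by move=> ji; rewrite ffunE /do_right /on (negbTE ji) /keep ffunE; apply: same_hold.
have [codel1E aE] : nth (goto 0) code l1 (scans f1) = (inl l2, a (scans f1))
    /\ forall j, a (scans f1) j = if j == stack_tape i then (enc x, Stay)
                    else if j == ord_max then v else (scans f1 j, Stay).
  by apply: codel1 => j /f1j sj; rewrite scansE -(same_scan sj).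
have stp2 := step_lab l1n codel1E; set g := finfun _ in stp2.
have mi : ord_max != stack_tape i by rewrite eq_sym stack_tape_max.
have sti : (f (stack_tape i)).2 <= N.
  have [-> _] := stf i hi; apply: leq_trans (ltnW tot); exact: size_get.
have sti1 : (f (stack_tape i)).2 < N.
  have [-> _] := stf i hi; apply: leq_ltn_trans tot; exact: size_get.
have sp1 : tape_space (f1 (stack_tape i)) <= S.
  rewrite f1i; apply: leq_trans (write_space _ _) _.
  by rewrite geq_max spf /=; apply: leq_trans NS; rewrite !ltnS.
have ok1 : ok ((lab l1, f1) : config tm).
  move=> j /=; case: (eqVneq j (stack_tape i)) => [->//|ji].
  by have [_ _ <-] := f1j j ji.
have gi : g (stack_tape i) = write (f1 (stack_tape i)) (enc x, Stay).
  by rewrite ffunE aE eqxx.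
have gm : g ord_max = write (f1 ord_max) v.
  by rewrite ffunE aE (negbTE mi) eqxx.
have [orcg spg] := orcv _ (f1j _ mi).
have gj j : j != stack_tape i -> j != ord_max -> same (f j) (g j).
  move=> ji jm; apply: same_trans (f1j j ji) _.
  by rewrite [g j]ffunE aE (negbTE ji) (negbTE jm) scansE; apply: same_hold.
have rg : rep (upd s i (x :: get s i)) w' p' g.
  apply: (rep_upd rp hi); rewrite ?gm ?gi //.
  - by apply: stk_push (stf i hi) _; rewrite f1i; apply: same_refl.
  - apply: leq_trans (write_space _ _) _; rewrite geq_max sp1 /= f1i /=.
    by apply: leq_trans NS; rewrite !ltnS.
  - by have := @total_upd s i (x :: get s i); rewrite szs => /(_ hi) /=; lia.
exists g; split=> //; apply: runs_trans (runs1 _ _ stp2); first apply: runs1 stp1.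
all: by [exact: ok1 | exact: rep_ok rp | exact: rep_ok rg].
Qed.

Lemma sim_push s w p w' p' (f : tapes) l l1 l2 i x (a : reads -> acts) v :
  rep s w p f -> l < n -> l1 < n -> i < K -> total s < N ->
  nth (goto 0) code l (scans f) = (inl l1, do_right i (scans f)) ->
  (forall r : reads, (forall j, j != stack_tape i -> r j = scan (f j)) ->
    nth (goto 0) code l1 r = (inl l2, a r)
    /\ forall j, a r j = if j == stack_tape i then (enc x, Stay)
                      else if j == ord_max then v else (r j, Stay)) ->
  (forall t, same (f ord_max) t ->
     oracle w' p' (write t v) /\ tape_space (write t v) <= S) ->
  exists2 g : tapes, rep (upd s i (x :: get s i)) w' p' g &
    runs (lab l, f) (lab l2, g).
Proof.
move=> rp ln l1n hi tot codel codel1 orcv.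
have [g [rg rung _]] := sim_push_frame rp ln l1n hi tot codel codel1 orcv.
by exists g.
Qed.

Lemma upd_id s i : i < size s -> upd s i (get s i) = s.
Proof.
move=> hi; apply: (@eq_from_nth _ [::]); rewrite size_upd // => j _.
by rewrite /upd nth_set_nth /=; case: eqP => [->|].
Qed.

Lemma upd_upd s i u v : upd (upd s i u) i v = upd s i v.
Proof. by rewrite /upd set_set_nth eqxx. Qed.

Lemma sim_query s w p (f : tapes) l q l' a : rep s w p f -> l < n ->
  nth (goto 0) code l (scans f) = (inr (q, l'), keep (scans f)) ->
  (forall k, (nth None w k == Some (inl (Some true))) = (nth Zero a k == One)) ->
  size (reply B q a) <= S ->
  exists2 g : tapes,
    rep s [seq Some (inl (Some e)) | e <- reply B q a] 0 g &
    runs (lab l, f) (lab l', g).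
Proof.
move=> rp ln codel wa rS; have stp1 := step_query ln codel.
set f1 := finfun _ in stp1; have [szs tot stf [orc2 orc1] spf] := rp.
have S1 : 1 <= S by apply: leq_trans NS.
have mr : ord_max != return_tape by rewrite eq_sym return_max.
have bitsE m k t : same (f ord_max) t -> bits m k t = read_word m k a.
  move=> [_ h _]; apply: eq_from_tnth => x; rewrite !tnth_mktuple -h orc1.
  exact: wa.
have f1m : f1 ord_max = tape_of aux [seq Some e | e <- reply B q a].
  rewrite ffunE eqxx (negbTE mr) /keep scansE.
  have hs := same_hold (f ord_max); rewrite -/(hold _).
  have := query_uniq; rewrite /= !inE !negb_or !andbT.
  move=> /and3P[/and3P[n1 n2 n3] /andP[n4 n5] n6].
  rewrite /answer /= ![qstate q == _]eq_sym !(bitsE _ _ _ hs).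
  case: q {codel rS stp1 f1} => /=; rewrite ?eqxx //.
  - by rewrite (negbTE n1).
  - by rewrite (negbTE n2) (negbTE n4).
  - by rewrite (negbTE n3) (negbTE n5) (negbTE n6).
have f1j j : j != ord_max -> j != return_tape -> same (f j) (f1 j).
  move=> jm jr; rewrite ffunE (negbTE jm) (negbTE jr) /keep scansE.
  exact: same_hold.
have ok1 : ok ((qstate q, f1) : config tm).
  move=> j /=; case: (eqVneq j ord_max) => [->|jm].
    by rewrite f1m /tape_space /= !size_map geq_max rS.
  case: (eqVneq j return_tape) => [->|jr]; last first.
    by have [_ _ <-] := f1j j jm jr.
  rewrite ffunE return_max eqxx; apply: leq_trans (write_space _ _) _.
  by rewrite geq_max spf; apply: leq_trans (spf return_tape); apply: leq_maxr.
have rep1 : rep s [seq Some (inl (Some e)) | e <- reply B q a] 0 f1.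
  apply: (rep_same rp _ (ok1 ord_max) ok1).
    by rewrite f1m; split=> //= k; rewrite -map_comp.
  by move=> i hi; apply: f1j; rewrite ?stack_tape_max ?stack_return.
have f1r : scan (f1 return_tape) = label l'.
  by rewrite ffunE return_max eqxx /scan /= nth_set_nth /= eqxx.
have stp2 := step_ret q f1r.
exists [ffun i => hold (f1 i)]; first exact: rep_hold.
apply: (runs_step _ stp1); first exact: rep_ok rp.
apply: (runs1 _ _ stp2); [exact: ok1 | exact: rep_ok (rep_hold rep1)].
Qed.

Lemma sim_ask_write q i j b a s w (f : tapes) : rep s w (size w) f ->
  located (ask_code q i j b) b -> i < K -> get s i = a ->
  size w + size a < S ->
  exists2 g : tapes,
    rep (upd s i [::]) (w ++ [seq enc_bit (Some x) | x <- a]) (size w + size a) g &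
    runs (lab b, f) (lab b, g).
Proof.
move=> rp loc hi; elim: a s w f rp => [|x a IH] s w f rp sa wS.
  have szs : size s = K by case: rp.
  exists f; last by apply: runs_refl; apply: rep_ok rp.
  by rewrite -sa upd_id ?szs // sa /= cats0 addn0.
have [ln codeb _] := located_cons loc.
have [szs tot stf orc spf] := rp.
have sc := stk_scan (stf i hi).
have /(step_lab ln) stp : nth (goto 0) code b (scans f) =
    (inl b, on ord_max (enc_bit (Some x), MoveRight) (do_pop i (scans f))).
  by rewrite codeb scansE sc sa.
set g := finfun _ in stp.
have im : stack_tape i != ord_max by rewrite stack_tape_max.
have gi : g (stack_tape i) = write (f (stack_tape i)) (None, MoveLeft).
  by rewrite ffunE /on (negbTE im) /do_pop /on eqxx.
have gm : g ord_max = write (f ord_max) (enc_bit (Some x), MoveRight).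
  by rewrite ffunE /on eqxx.
have rg : rep (upd s i a) (rcons w (enc_bit (Some x))) (size (rcons w (enc_bit (Some x)))) g.
  apply: (rep_upd rp hi).
  - by rewrite gi; have := stk_pop (stf i hi); rewrite sa.
  - rewrite gi; apply: leq_trans (write_space _ _) _; rewrite geq_max spf /=.
    apply: leq_trans (spf (stack_tape i)).
    by rewrite leq_max; apply/orP; right; rewrite ltnS leq_pred.
  - rewrite gm; have [orc2 orc1] := orc; split; first by rewrite /= orc2 size_rcons.
    move=> k; rewrite /= nth_set_nth /= orc2 nth_rcons orc1.
    case: (ltngtP k (size w)) => // lt.
    by rewrite nth_default // ltnW.
  - rewrite gm; apply: leq_trans (write_space _ _) _; rewrite geq_max spf /=.
    by have [-> _] := orc; move: wS => /=; lia.
  - move=> k ki km; rewrite ffunE /on (negbTE km) /do_pop /on (negbTE ki) /keep scansE.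
    exact: same_hold.
  - by have := @total_upd s i a; rewrite szs sa => /(_ hi) /=; lia.
have [||h rh runh] := IH _ _ _ rg.
- by rewrite get_upd eqxx.
- by rewrite size_rcons; move: wS => /=; lia.
exists h; first by move: rh; rewrite upd_upd cat_rcons size_rcons addSnnS.
by apply: (runs_step _ stp) runh; apply: rep_ok rp.
Qed.

Lemma sim_ask_read q i j b v s p (f : tapes) (w := [seq Some (inl (Some e)) | e <- v]) :
  rep s w p f -> located (ask_code q i j b) b -> j < K -> size v < S ->
  p <= size v -> total s + (size v - p) <= N ->
  exists2 g : tapes,
    rep (upd s j (rev (map bsym (drop p v)) ++ get s j)) w (size v) g &
    runs (lab b.+1, f) (lab b.+1, g).
Proof.
move=> rp loc hj vS; move e : (size v - p) => d.
elim: d s p f e rp => [|d IH] s p f e rp pv tot.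
  have pE : p = size v by lia.
  have szs : size s = K by case: rp.
  exists f; last by apply: runs_refl; apply: rep_ok rp.
  by rewrite pE drop_size /= upd_id ?szs -?pE.
have [ln _ /located_cons [ln1 code1 /located_cons[ln2 code2 _]]] := located_cons loc.
have [szs _ stf [orc2 orc1] spf] := rp.
have pv' : p < size v by lia.
pose x := nth false v p.
have sc : scan (f ord_max) = Some (inl (Some x)).
  by rewrite /scan orc2 orc1 (nth_map false).
have mj : ord_max != stack_tape j by rewrite eq_sym stack_tape_max.
have [||||g rg rung] := @sim_push s w p w p.+1 f b.+1 b.+2 b.+1 j (bsym x)
  (fun r => on ord_max (r ord_max, MoveRight) (do_put j (lift_top id (r ord_max)) r))
  (scan (f ord_max), MoveRight) rp ln1 ln2 hj.
- by lia.
- by rewrite code1 scansE sc.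
- move=> r rE; rewrite code2; split=> // k; rewrite /on /do_put /on.
  rewrite rE // sc /=; case: (eqVneq k (stack_tape j)) => [->|kj].
    by rewrite stack_tape_max.
  by [].
- move=> t [e1 e2 e3]; split.
    split; first by rewrite /= -e1 orc2.
    move=> k; rewrite /= nth_set_nth /= -e1 orc2 -e2 orc1.
    by case: eqP => // ->; rewrite sc (nth_map false).
  apply: leq_trans (write_space _ _) _; rewrite geq_max -e3 spf /= -e1 orc2.
  by lia.
have [|||h rh runh] := IH _ p.+1 g _ rg.
- by lia.
- by [].
- by have := @total_upd s j (bsym x :: get s j); rewrite szs => /(_ hj) /=; lia.
exists h; last exact: runs_trans rung runh.
move: rh; rewrite upd_upd get_upd eqxx (drop_nth false pv') /=.
by rewrite rev_cons cat_rcons.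
Qed.

Lemma sim_ask q i j b s (f : tapes) : rep s [::] 0 f ->
  located (ask_code q i j b) b -> i < K -> j < K -> i != j ->
  total s + size (reply B q (get s i)) <= N ->
  exists2 g : tapes,
    rep (upd (upd s i [::]) j (rev (map bsym (reply B q (get s i))) ++ get s j))
      [::] 0 g &
    runs (lab b, f) (lab b.+4, g).
Proof.
move=> rp loc hi hj ij tot; have sa := size_get s i.
have [szs tots _ _ _] := rp; set a := get s i in sa tot *.
have [ln codeb /located_cons [ln1 code1 /located_cons[_ _ /located_cons[ln3 code3 _]]]] :=
  located_cons loc.
have [|f1 rp1 run1] := sim_ask_write (w := [::]) rp loc hi (erefl a).
  by rewrite /= add0n; lia.
rewrite /= in rp1.
have [szs1 _ stf1 _ _] := rp1.
have sc1 := stk_scan (stf1 i hi); rewrite get_upd eqxx in sc1.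
have [|||f2 rp2 run2] := sim_query (q := q) (l' := b.+1) (a := a) rp1 ln.
- by rewrite codeb scansE sc1.
- move=> k; case: (ltnP k (size a)) => ka.
    by rewrite (nth_map Zero) // /enc_bit; case: (nth Zero a k).
  by rewrite !nth_default // size_map.
- by lia.
have totu := @total_upd s i [::]; rewrite szs in totu; move: (totu hi) => /= {}totu.
have [|||f3 rp3 run3] := sim_ask_read rp2 loc hj.
- by lia.
- by [].
- by lia.
rewrite drop0 get_upd eq_sym (negbTE ij) in rp3.
have [szs3 tot3 stf3 [orc32 orc31] spf3] := rp3.
pose a3 := [seq bsym e | e <- reply B q a].
have [|||f4 rp4 run4] := sim_query (q := QValid) (l' := b.+3) (a := a3) rp3 ln1.
- by rewrite code1 scansE /scan orc32 orc31 nth_default ?size_map.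
- move=> k; case: (ltnP k (size (reply B q a))) => ka.
    by rewrite !(nth_map false) //; case: nth.
  by rewrite !nth_default // size_map.
- by rewrite /=; lia.
have /(step_lab ln3) stp : nth (goto 0) code b.+3 (scans f4) =
    (inl b.+4, on ord_max (None, Stay) (keep (scans f4))) by rewrite code3.
set g := finfun _ in stp.
have [szs4 tot4 stf4 [orc42 orc41] spf4] := rp4.
have gm : g ord_max = write (f4 ord_max) (None, Stay) by rewrite ffunE /on eqxx.
have gj k : k != ord_max -> same (f4 k) (g k).
  by move=> km; rewrite ffunE /on (negbTE km) /keep scansE; apply: same_hold.
have spg : tape_space (g ord_max) <= S.
  rewrite gm; apply: leq_trans (write_space _ _) _; rewrite geq_max spf4 /= orc42.
  by lia.
have spa k : tape_space (g k) <= S.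
  by case: (eqVneq k ord_max) => [->//|km]; have [_ _ <-] := gj k km.
have rg : rep (upd (upd s i [::]) j (rev (map bsym (reply B q a)) ++ get s j))
      [::] 0 g.
  apply: (rep_same rp4 _ spg spa); last first.
    by move=> k hk; apply: gj; rewrite stack_tape_max.
  rewrite gm; split=> //= k; rewrite nth_set_nth /= orc42 orc41 nth_nil.
  by case: k => [|[]].
exists g => //; apply: runs_trans run1 _; apply: runs_trans run2 _.
apply: runs_trans run3 _; apply: runs_trans run4 _.
apply: (runs1 _ _ stp); [exact: rep_ok rp4 | exact: rep_ok rg].
Qed.

(** The induction is on the execution and not on the program: a loop is simulated by jumping back to
    its own label with the rest of the execution. *)
Lemma sim p s s' b (f : tapes) : exec B N p s s' -> located (comp p b) b ->
  rep s [::] 0 f ->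
  exists2 g : tapes, rep s' [::] 0 g & runs (lab b, f) (lab (b + len p), g).
Proof.
move=> ex; elim: ex b f => {p s s'}.
- move=> s b f _ rp; rewrite addn0; exists f => //.
  by apply: runs_refl; apply: rep_ok rp.
- move=> s i hi b f /located_cons[ln codeb _] rp.
  have [szs tot stf _ spf] := rp; rewrite szs in hi; rewrite addn1.
  apply: (sim_write rp ln hi) (stk_pop (stf i hi)) _ _.
  + by rewrite codeb /=.
  + apply: leq_trans (write_space _ _) _; rewrite geq_max spf /=.
    apply: leq_trans (spf (stack_tape i)).
    by rewrite leq_max; apply/orP; right; rewrite ltnS leq_pred.
  + have := @total_upd s i (behead (get s i)); rewrite szs size_behead => /(_ hi).
    by lia.
- move=> s i a hi lt b f /located_cons[ln codeb /located_cons[ln1 codeb1 _]] rp.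
  have [szs tot stf orc spf] := rp; rewrite szs in hi; rewrite addn2.
  apply: (sim_push (v := (scan (f ord_max), Stay))
    (a := do_put i (enc a)) rp ln ln1 hi lt).
  + by rewrite codeb.
  + move=> r rE; rewrite codeb1 /do_put /on; split=> // k.
    case: eqP => // _; case: eqP => // ->.
    by rewrite /keep rE // eq_sym stack_tape_max.
  + move=> t sm; have hs := same_trans sm (same_hold t).
    rewrite (same_scan sm); split; first exact: same_oracle hs orc.
    by have [_ _ <-] := hs.
- move=> s i j a r hi hj ij lt sa b f /located_cons[ln codeb /located_cons[ln1 codeb1 _]] rp.
  have [szs tot stf orc spf] := rp; rewrite szs in hi hj; rewrite addn2.
  apply: (sim_push (v := (scan (f ord_max), Stay))
    (a := fun r => do_put j (r (stack_tape i)) r) rp ln ln1 hj lt).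
  + by rewrite codeb.
  + move=> r' rE; rewrite codeb1 /do_put /on; split=> // k.
    rewrite rE; last by rewrite stack_tape_inj.
    rewrite (stk_scan (stf i hi)) sa.
    case: eqP => // _; case: eqP => // ->.
    by rewrite /keep rE // eq_sym stack_tape_max.
  + move=> t sm; have hs := same_trans sm (same_hold t).
    rewrite (same_scan sm); split; first exact: same_oracle hs orc.
    by have [_ _ <-] := hs.
- move=> s i h hi b f /located_cons[ln codeb _] rp.
  have [szs tot stf _ spf] := rp; rewrite szs in hi; rewrite addn1.
  have sti := stf i hi.
  have szh : size (if get s i is a :: r then h a :: r else [::]) = size (get s i).
    by case: (get s i).
  apply: (sim_write rp ln hi).
  + by rewrite codeb scansE (stk_scan sti).
  + have [e nthE] := sti; split; first by rewrite szh /= e.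
    move=> k; rewrite szh => hk; rewrite nth_set_nth /= e.
    case: (get s i) hk nthE {e sti szh} => [|x st] /= hk nthE.
      by case: k hk => // _; rewrite eqxx.
    rewrite nthE // !rev_cons !map_rcons -!rcons_cons !nth_rcons /= size_map size_rev.
    by case: ltngtP.
  + apply: leq_trans (write_space _ _) _; rewrite geq_max spf /=.
    by apply: leq_trans (spf (stack_tape i)); rewrite leq_maxr.
  + have := @total_upd s i (if get s i is a :: r then h a :: r else [::]).
    by rewrite szs szh => /(_ hi); lia.
- move=> s q i j hi hj ij tot b f loc rp.
  have [szs _ _ _ _] := rp; rewrite szs in hi hj; rewrite addn4.
  exact: (sim_ask rp loc).
- move=> p p' s s' s'' _ IH1 _ IH2 b f /located_cat[loc1 loc2] rp.
  have [g rg rung] := IH1 _ _ loc1 rp; rewrite size_comp in loc2.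
  have [h rh runh] := IH2 _ _ loc2 rg.
  by exists h; rewrite //= addnA; apply: runs_trans runh.
- move=> c p p' s s' _ IH b f /located_cons[ln codeb /located_cat[loc1]].
  rewrite size_comp => /located_cons[ln2 codeb2 loc2] rp.
  have codebE : nth (goto 0) code b (scans f) =
      (inl (if c (tops s) then b.+1 else b.+2 + len p), keep (scans f)).
    by rewrite codeb (read_topsE rp) // => i; apply: scansE.
  have [g rg rung] := sim_jump rp ln codebE; move: IH rung.
  case: ifP => _ IH rung; last first.
    have [|h rh runh] := IH (b.+2 + len p) g _ rg.
      by move: loc2; rewrite !addSn.
    exists h => //; apply: runs_trans rung _.
    by rewrite /= !addnS addnA -!addSn.
  have [h rh runh] := IH _ _ loc1 rg.
  have [h' rh' runh'] := sim_jump rh ln2 (congr1 (fun i => i (scans h)) codeb2).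
  exists h' => //; apply: runs_trans rung (runs_trans runh _).
  by rewrite /= !addnS addnA -!addSn.
- move=> c p s cF b f /located_cons[ln codeb _] rp.
  have codebE : nth (goto 0) code b (scans f) =
      (inl (b.+2 + len p), keep (scans f)).
    rewrite codeb (read_topsE rp) ?(negbTE cF) // => i; exact: scansE.
  have [g rg rung] := sim_jump rp ln codebE.
  by exists g => //; rewrite /= !addnS -!addSn.
- move=> c p s s' s'' cT _ IH1 _ IH2 b f loc rp.
  have /located_cons[ln codeb] := loc; rewrite -cats1 => /located_cat[loc1].
  rewrite size_comp => /located_cons[ln2 codeb2 _].
  have codebE : nth (goto 0) code b (scans f) = (inl b.+1, keep (scans f)).
    by rewrite codeb (read_topsE rp) ?cT // => i; apply: scansE.
  have [g rg rung] := sim_jump rp ln codebE.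
  have [h rh runh] := IH1 _ _ loc1 rg.
  have [h' rh' runh'] := sim_jump rh ln2 (congr1 (fun i => i (scans h)) codeb2).
  have [k rk runk] := IH2 _ _ loc rh'.
  exists k => //; apply: runs_trans rung (runs_trans runh (runs_trans runh' runk)).
Qed.

Lemma sim_load s (w : seq letter) p (f : tapes) : located load 0 -> 0 < K ->
  rep s [::] 0 f -> oracle [seq Some (inl x) | x <- w] p (f ord0) ->
  p <= size w -> total s + (size w - p) <= N -> size w < S ->
  exists2 g : tapes,
    rep (upd s 0 (rev (map lsym (drop p w)) ++ get s 0)) [::] 0 g &
    runs (lab 0, f) (lab 3, g).
Proof.
move=> loc K0; move e : (size w - p) => d.
have [ln code0 /located_cons[ln1 code1 /located_cons[ln2 code2 _]]] := located_cons loc.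
have m0 : ord0 != ord_max :> tape_index by [].
have i0 : ord0 != stack_tape 0 by rewrite eq_sym stack_tape0.
elim: d s p f e => [|d IH] s p f e rp [orc2 orc1] pw tot wS.
  have pE : p = size w by lia.
  have szs : size s = K by case: rp.
  rewrite pE drop_size -[_ ++ _]/(get s 0) upd_id ?szs //; apply: (sim_jump rp ln).
  by rewrite code0 scansE /scan orc2 orc1 pE nth_default ?size_map.
have [szs _ stf orc spf] := rp.
have pw' : p < size w by lia.
pose x := nth None w p.
have sc : scan (f ord0) = Some (inl x) by rewrite /scan orc2 orc1 (nth_map None).
have [||||g [rg rung sg]] := @sim_push_frame s [::] 0 [::] 0 f 0 1 2 0 (lsym x)
  (fun r => do_put 0 (lift_top id (r ord0)) r) (scan (f ord_max), Stay) rp ln ln1 K0.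
- by lia.
- by rewrite code0 scansE sc.
- move=> r rE; rewrite code1; split=> // k; rewrite /do_put /on rE // sc /=.
  by case: eqP => // _; case: eqP => // ->; rewrite /keep rE // eq_sym stack_tape_max.
- move=> t sm; have hs := same_trans sm (same_hold t).
  rewrite (same_scan sm); split; first exact: same_oracle hs orc.
  by have [_ _ <-] := hs.
have [h2 h1 h3] := sg _ i0 m0.
have stp := step_lab ln2 (congr1 (fun i => i (scans g)) code2).
set g1 := finfun _ in stp.
have [szs1 tot1 stf1 orcg spg] := rg.
have g10 : g1 ord0 = write (g ord0) (scan (g ord0), MoveRight).
  by rewrite ffunE /on eqxx scansE.
have g1j j : j != ord0 -> same (g j) (g1 j).
  by move=> j0; rewrite ffunE /on (negbTE j0) /keep scansE; apply: same_hold.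
have spg1 j : tape_space (g1 j) <= S.
  case: (eqVneq j ord0) => [->|j0]; last by have [_ _ <-] := g1j j j0.
  rewrite g10; apply: leq_trans (write_space _ _) _.
  by rewrite geq_max spg /= -h2 orc2; lia.
have rg1 : rep (upd s 0 (lsym x :: get s 0)) [::] 0 g1.
  apply: (rep_same rg _ (spg1 _) spg1); last first.
    by move=> i hi; apply: g1j; rewrite stack_tape0.
  by apply: same_oracle orcg; apply: g1j.
have [|||||h rh runh] := IH _ p.+1 g1 _ rg1.
- by lia.
- split; first by rewrite g10 /= -h2 orc2.
  move=> k; rewrite g10 /= nth_set_nth /= /scan -h1 -h2 orc2 -orc1.
  by case: eqP => // ->.
- by [].
- by have := @total_upd s 0 (lsym x :: get s 0); rewrite szs => /(_ K0) /=; lia.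
- by [].
exists h; last first.
  apply: runs_trans rung (runs_trans (runs1 _ _ stp) runh).
    exact: rep_ok rg.
  exact: rep_ok rg1.
move: rh; rewrite upd_upd get_upd eqxx (drop_nth None pw') /=.
by rewrite rev_cons cat_rcons.
Qed.

End Simulation.
End Code.

Section Compile.

Variables (p : prog) (accept : top_test).

Let n := 3 + len p.

Definition compile : machine := tm (load n ++ comp n p 3) accept.

Lemma compile_deterministic : deterministic compile.
Proof. exact: tm_deterministic. Qed.

Lemma compileP (B : black_box) (w : seq letter) (s : stacks) (N : nat) :
  0 < K -> size w <= N ->
  exec B N p (upd (nseq K [::]) 0 (rev (map lsym w))) s ->
  (accepts compile B w <-> accept (tops s)) /\
  (forall c, reaches B (initial compile w) c -> space c <= K.+3 * N.+2).
Proof.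
move=> K0 wN ex; pose code := load n ++ comp n p 3.
have [loc1 loc2] : located code (load n) 0 /\ located code (comp n p 3) 3.
  by apply: (@located_cat n code (load n) (comp n p 3) 0); split; rewrite // size_cat size_comp.
pose f : tapes compile := (initial compile w).2.
have f0 : f ord0 = tape_of (aux n) w by rewrite ffunE.
have fj j : j != ord0 -> f j = ([::], 0) by rewrite ffunE => /negbTE ->.
have szn : size (nseq K ([::] : seq sym)) = K by rewrite size_nseq.
have rp : @rep n code accept N.+2 N (nseq K [::]) [::] 0 f.
  split=> //.
  - by rewrite /total map_nseq sumn_nseq mul0n.
  - move=> i hi; rewrite fj ?stack_tape0 // /get nth_nseq hi.
    by split=> // -[].
  - by rewrite fj.
  - move=> i; case: (eqVneq i ord0) => [->|i0]; last by rewrite fj.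
    by rewrite f0 /tape_space /= size_map; lia.
have [||||g rg rung] := @sim_load n code accept B N.+2 N (leqnn _) _ w 0 f loc1 K0 rp.
- by rewrite f0; split=> //= k.
- by [].
- by rewrite /total map_nseq sumn_nseq mul0n; lia.
- by lia.
rewrite drop0 /get nth_nseq K0 cats0 in rg.
have [h rh runh] := @sim n code accept B N.+2 N (leqnn _) _ _ _ _ _ ex loc2 rg.
set q := lab n (3 + len p) in runh.
have qE : q = lab n n by [].
have runf := runs_trans rung runh.
have rtE : read_tops (scans h) = tops s.
  by apply: (read_topsE rh) => i; apply: scansE.
have deltaq : delta code accept q (scans h) =
    if accept (tops s) then Some (lab n n.+1, keep (scans h)) else None.
  by rewrite qE /delta /lab inordK // ltnn eqxx rtE.
pose h' : tapes compile := [ffun i => hold (h i)].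
(* The run halts in [e], one step after the final test if it succeeds and at the test otherwise. In
   both cases the state of [e] tells the outcome. *)
have [e rune [stop eacc]] : exists2 e : config compile, runs B N.+2 (initial compile w) e &
    (forall e', ~ step B e e') /\ (e.1 == lab n n.+1) = accept (tops s).
  case: (boolP (accept (tops s))) => acc.
    exists (lab n n.+1, h').
      apply: runs_trans runf _; apply: runs1.
      - exact: rep_ok rh.
      - exact: rep_ok (rep_hold rh).
      exists (lab n n.+1, finfun (keep (scans h))).
        by rewrite /= /trans -/(scans h) deltaq acc.
      congr pair; apply/ffunP=> i; rewrite !ffunE /= /keep scansE.
      by case: eqP => // _; rewrite /answer.
    split; last by rewrite eqxx.
    by move=> e' [a]; rewrite /= /trans delta_accept.
  exists (q, h); first exact: runf.
  split.
    by move=> e' [a]; rewrite /= /trans -/(scans h) deltaq (negbTE acc).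
  by rewrite qE /= (inj_eq (@inl_inj _ _)) -val_eqE /= !inordK // ltn_eqF.
split.
  split.
    move=> [c rc cacc]; have runc := runs_reach rune stop rc.
    suff ec : c = e by rewrite -eacc -ec cacc.
    case: runc cacc {rc} stop => // c1 c2 c3 _ [a ta _] _ cacc _.
    by move: ta; rewrite cacc /= /trans delta_accept.
  rewrite -eacc => /eqP ea; by exists e => //; apply: (runs_reaches rune).
move=> c /(runs_reach rune stop)/runs_ok okc.
rewrite /space; apply: leq_trans (_ : \sum_(i : 'I_K.+3) N.+2 <= _).
  by apply: leq_sum => i _; apply: okc.
by rewrite sum_nat_const card_ord.
Qed.

End Compile.
End Compiler.

(** * Moving and comparing strings *)

Definition takew (c : pred sym) (s : seq sym) : seq sym := take (find (predC c) s) s.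
Definition dropw (c : pred sym) (s : seq sym) : seq sym := drop (find (predC c) s) s.

Fixpoint lcp (c : pred sym) (s t : seq sym) : nat :=
  match s, t with
  | x :: s', y :: t' => if (x == y) && c x then (lcp c s' t').+1 else 0
  | _, _ => 0
  end.

Definition top_is (i : nat) (x : sym) : top_test :=
  fun t => nth None t i == Some x.
Definition top_in (i : nat) (c : pred sym) : top_test :=
  fun t => if nth None t i is Some x then c x else false.
Definition same_top (c : pred sym) (i j : nat) : top_test :=
  fun t => if nth None t i is Some x then (nth None t j == Some x) && c x else false.
Definition no_top (i : nat) : top_test := fun t => nth None t i == None.

(** * Space measured relative to the initial content *)

Section Run.

Variable B : black_box.

(** The number [k] is the room needed beyond the symbols present at the start. Unlike the absolute
    bound in [exec], it adds up over sequences. *)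
Definition run (k : nat) (p : prog) (s s' : stacks) : Prop :=
  forall N, total s + k <= N -> exec B N p s s'.

Lemma run_le k k' p s s' : k <= k' -> run k p s s' -> run k' p s s'.
Proof. by move=> le r N hN; apply: r; lia. Qed.

Lemma run_size k p s s' : run k p s s' -> size s' = size s.
Proof. by move=> /(_ _ (leqnn _)) /exec_size. Qed.

Lemma run_total k p s s' : run k p s s' -> total s' <= total s + k.
Proof. by move=> /(_ _ (leqnn _)) /exec_total; apply; apply: leq_addr. Qed.

Lemma run_seq k1 k2 p q s s' s'' :
  run k1 p s s' -> run k2 q s' s'' -> run (k1 + k2) (Seq p q) s s''.
Proof.
move=> r1 r2 N hN; have := run_total r1 => tot.
by apply: exec_seq (r1 N _) (r2 N _); lia.
Qed.

Lemma run_if k (c : top_test) p q s s' :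
  run k (if c (tops s) then p else q) s s' -> run k (If c p q) s s'.
Proof. by move=> r N hN; apply: exec_if; apply: r. Qed.

Lemma run_skip s : run 0 Skip s s.
Proof. by move=> N _; apply: exec_skip. Qed.

Lemma run_pop s i : i < size s -> run 0 (Pop i) s (upd s i (behead (get s i))).
Proof. by move=> h N _; apply: exec_pop. Qed.

Lemma run_push s i a : i < size s -> run 1 (Push i a) s (upd s i (a :: get s i)).
Proof. by move=> h N hN; apply: exec_push => //; lia. Qed.

Lemma run_modify s i f : i < size s ->
  run 0 (Modify i f) s (upd s i (if get s i is a :: r then f a :: r else [::])).
Proof. by move=> h N _; apply: exec_modify. Qed.

Lemma size_reply q a : size (reply B q a) <= (bb_b B).+1.
Proof. by case: q => //=; rewrite size_tuple. Qed.

Lemma run_ask s q i j : i < size s -> j < size s -> i != j ->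
  run (bb_b B).+1 (Ask q i j) s
    (upd (upd s i [::]) j (rev (map bsym (reply B q (get s i))) ++ get s j)).
Proof.
move=> hi hj ij N hN; apply: exec_ask => //.
by have := size_reply q (get s i); lia.
Qed.

Lemma nth_tops s i : nth None (tops s) i = ohead (get s i).
Proof.
rewrite /tops /get; case: (ltnP i (size s)) => h; first by rewrite (nth_map [::]).
by rewrite !nth_default ?size_map.
Qed.

Fixpoint dups (i : nat) (js : seq nat) (p : prog) : prog :=
  if js is j :: js' then Seq (Dup i j) (dups i js' p) else p.

Definition move_while (c : pred sym) (i : nat) (js : seq nat) : prog :=
  While (top_in i c) (dups i js (Pop i)).

Definition put_all (l : seq sym) (js : seq nat) (s : stacks) : stacks :=
  foldl (fun s j => upd s j (l ++ get s j)) s js.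

Lemma put_all_nil js s : all (fun j => j < size s) js -> put_all [::] js s = s.
Proof. by elim: js s => //= j js IH s /andP[hj hjs]; rewrite upd_id // IH. Qed.

Lemma size_put_all l js s : all (fun j => j < size s) js ->
  size (put_all l js s) = size s.
Proof.
elim: js s => //= j js IH s /andP[hj hjs].
rewrite IH size_upd //.
Qed.

Lemma get_put_all l js s i : i \notin js -> get (put_all l js s) i = get s i.
Proof.
elim: js s => //= j js IH s; rewrite inE negb_or => /andP[ij /IH ->].
by rewrite get_upd (negbTE ij).
Qed.

Lemma total_put_all l js s : all (fun j => j < size s) js ->
  total (put_all l js s) = total s + size js * size l.
Proof.
elim: js s => [|j js IH] s /=; first by rewrite mul0n addn0.
case/andP=> hj hjs; rewrite IH; last by rewrite size_upd.
have := total_upd (l ++ get s j) hj; rewrite size_cat mulSn; lia.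
Qed.

Lemma stacks_eq s s' : size s = size s' -> (forall i, get s i = get s' i) -> s = s'.
Proof. by move=> sz h; apply: (@eq_from_nth _ [::]) => // i _; apply: h. Qed.

Lemma get_put_all_in l js s j : uniq js -> j \in js ->
  get (put_all l js s) j = l ++ get s j.
Proof.
elim: js s => //= k js IH s /andP[kjs ujs]; rewrite inE.
case: eqP => [-> _|/eqP jk /= jjs]; first by rewrite get_put_all ?get_upd ?eqxx.
by rewrite IH // get_upd (negbTE jk).
Qed.

Lemma exec_dups N i js p s s' x r : i < size s -> all (fun j => j < size s) js ->
  i \notin js -> get s i = x :: r -> total s + size js <= N ->
  exec B N p (put_all [:: x] js s) s' -> exec B N (dups i js p) s s'.
Proof.
elim: js s => //= j js IH s hi /andP[hj hjs].
rewrite inE negb_or => /andP[ij ijs] si tot ex.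
apply: (exec_seq (exec_dup B hi hj ij _ si)); first by lia.
apply: IH => //; rewrite ?size_upd ?get_upd ?(negbTE ij) //.
by have := total_upd (x :: get s j) hj => /=; lia.
Qed.

(** A symbol is duplicated on all targets before it is popped: this takes [size js] symbols of
    transient room, and a net growth of [(size js).-1] per symbol. With no target the symbols are
    erased. *)
Lemma run_move_while c s i js : i < size s -> all (fun j => j < size s) js ->
  i \notin js -> uniq js ->
  run (size js + (size js).-1 * size (takew c (get s i))) (move_while c i js) s
    (put_all (rev (takew c (get s i))) js (upd s i (dropw c (get s i)))).
Proof.
move=> hi hjs ijs ujs N; move e : (get s i) => a.
elim: a s e hi hjs => [|x a IH] s e hi hjs tot.
  have -> : put_all (rev (takew c [::])) js (upd s i (dropw c [::])) = s.
    by rewrite /takew /dropw /= -[X in upd s i X]e upd_id // put_all_nil.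
  by apply: exec_while_false; rewrite /top_in nth_tops e.
have takeE : takew c (x :: a) = if c x then x :: takew c a else [::].
  by rewrite /takew /=; case: (c x).
have dropE : dropw c (x :: a) = if c x then dropw c a else x :: a.
  by rewrite /dropw /=; case: (c x).
move: tot; rewrite takeE dropE; case: ifP => cx tot; last first.
  rewrite -e upd_id //= put_all_nil //.
  by apply: exec_while_false; rewrite /top_in nth_tops e /= cx.
pose s1 := upd (put_all [:: x] js s) i a.
have sz1 : size s1 = size s by rewrite size_upd size_put_all.
have tot1 : (total s1).+1 = total s + size js.
  have := @total_upd (put_all [:: x] js s) i a.
  rewrite size_put_all // total_put_all // get_put_all // e -/s1 => /(_ hi) /=.
  by lia.
apply: (@exec_while_true _ _ _ _ _ s1).
- by rewrite /top_in nth_tops e.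
- apply: (exec_dups hi hjs ijs e); first by lia.
  rewrite /s1 -[X in upd _ _ X]/(behead (x :: a)) -e -(@get_put_all [:: x] js s i) //.
  by apply: exec_pop; rewrite size_put_all.
have -> : put_all (rev (x :: takew c a)) js (upd s i (dropw c a)) =
  put_all (rev (takew c a)) js (upd s1 i (dropw c a)).
  have hjs' u : size u = size s -> all (fun j => j < size u) js by move=> ->.
  apply: stacks_eq.
    by rewrite !size_put_all ?size_upd ?hjs' // ?size_upd ?size_put_all ?sz1.
  move=> k; case: (boolP (k \in js)) => kjs; last first.
    rewrite !get_put_all // /s1 !get_upd get_put_all //.
    by case: eqP.
  have ki : (k == i) = false by apply/eqP=> ki; rewrite ki (negbTE ijs) in kjs.
  rewrite !get_put_all_in // /s1 !get_upd ki get_put_all_in //.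
  by rewrite rev_cons cat_rcons.
apply: IH; rewrite ?sz1 ?get_upd ?eqxx //.
move: tot; rewrite /= mulnS; case: (size js) tot1 => [|m] /=; lia.
Qed.

Definition pop_same (i j k : nat) : prog := Seq (Dup j k) (Seq (Pop j) (Pop i)).

Definition skip_same (c : pred sym) (i j k : nat) : prog :=
  While (same_top c i j) (pop_same i j k).

Lemma run_skip_same c s i j k : uniq [:: i; j; k] ->
  all (fun i => i < size s) [:: i; j; k] ->
  let m := lcp c (get s i) (get s j) in
  run 1 (skip_same c i j k) s
   (upd (upd (upd s i (drop m (get s i))) j (drop m (get s j)))
      k (rev (take m (get s j)) ++ get s k)).
Proof.
rewrite /= !inE !negb_or !andbT => /andP[/andP[ij ik] jk] /and3P[hi hj hk] N.
move e : (get s i) => a.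
elim: a s e hi hj hk => [|x a IH] s e hi hj hk tot.
  rewrite /= drop0 take0 /= -e upd_id // upd_id // upd_id //.
  by apply: exec_while_false; rewrite /same_top nth_tops e.
case f : (get s j) => [|y b].
  rewrite /= -e upd_id // -f upd_id // upd_id //.
  by apply: exec_while_false; rewrite /same_top !nth_tops e f.
rewrite /=; case: ifP => cx; last first.
  rewrite /= -e upd_id // -f upd_id // upd_id //.
  by apply: exec_while_false; rewrite /same_top !nth_tops e f /= -[Some y == _]/(y == x) eq_sym cx.
case/andP: cx => /eqP exy cx; rewrite -{}exy in f *.
have ji : (j == i) = false by rewrite eq_sym (negbTE ij).
have ki : (k == i) = false by rewrite eq_sym (negbTE ik).
have kj : (k == j) = false by rewrite eq_sym (negbTE jk).
pose s1 := upd s k (x :: get s k).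
pose s2 := upd s1 j b.
pose s3 := upd s2 i a.
have sz1 : size s1 = size s by rewrite size_upd.
have sz2 : size s2 = size s by rewrite size_upd sz1.
have sz3 : size s3 = size s by rewrite size_upd sz2.
have t1 := total_upd (x :: get s k) hk.
have t2 := @total_upd s1 j b; rewrite sz1 /s1 get_upd (negbTE jk) f in t2.
have t3 := @total_upd s2 i a; rewrite sz2 /s2 /s1 !get_upd (negbTE ij) (negbTE ik) e in t3.
move: (t2 hj) (t3 hi) t1 => /=; rewrite -/s1 -/s2 -/s3 => {}t2 {}t3 t1.
apply: (@exec_while_true _ _ _ _ _ s3).
- by rewrite /same_top !nth_tops e f /= eqxx cx.
- apply: (exec_seq (exec_dup B hj hk jk _ f)); first by lia.
  apply: (@exec_seq _ _ _ _ _ s2).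
    have := @exec_pop B N s1 j; rewrite sz1 /s1 get_upd (negbTE jk) f; exact.
  have := @exec_pop B N s2 i.
  by rewrite sz2 /s2 /s1 !get_upd (negbTE ij) (negbTE ik) e; apply.
have := IH s3; rewrite sz3 /s3 /s2 /s1 !get_upd ?eqxx ji ki kj.
rewrite ?(negbTE ij) ?(negbTE ik) ?(negbTE jk) -/s1 -/s2 -/s3.
move=> /(_ erefl hi hj hk); set u := upd _ _ _; set v := upd _ _ _.
have -> : u = v; last by apply; lia.
apply: stacks_eq; first by rewrite !size_upd ?sz3 ?size_upd ?sz3 ?size_upd ?sz3.
move=> l; rewrite /u /v /s3 /s2 /s1 !get_upd rev_cons cat_rcons.
by case: eqP => // _; case: eqP => // _; case: eqP.
Qed.

Definition move_all (i : nat) (js : seq nat) : prog := move_while predT i js.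

Lemma takewT s : takew predT s = s.
Proof. by rewrite /takew (_ : find _ s = size s) ?take_size //; elim: s => //= x s ->. Qed.
Lemma dropwT s : dropw predT s = [::].
Proof. by rewrite /dropw (_ : find _ s = size s) ?drop_size //; elim: s => //= x s ->. Qed.

Lemma run_move_all s i js : i < size s -> all (fun j => j < size s) js ->
  i \notin js -> uniq js ->
  run (size js + (size js).-1 * size (get s i)) (move_all i js) s
    (put_all (rev (get s i)) js (upd s i [::])).
Proof.
by move=> hi hjs ijs ujs; have := @run_move_while predT s i js hi hjs ijs ujs; rewrite takewT dropwT.
Qed.

Definition clear (i : nat) : prog := move_all i [::].

Lemma run_clear s i : i < size s -> run 0 (clear i) s (upd s i [::]).
Proof. by move=> hi; apply: (@run_move_all s i [::]). Qed.

(* Stack 0 is used as a temporary store. *)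
Definition shift_to (i j : nat) : prog := Seq (move_all i [:: 0]) (move_all 0 [:: j]).
Definition copy_to (i j : nat) : prog := Seq (move_all i [:: 0]) (move_all 0 [:: i; j]).

Lemma put_all1 l j s : put_all l [:: j] s = upd s j (l ++ get s j).
Proof. by []. Qed.

Lemma put_all2 l i j s : i != j -> put_all l [:: i; j] s =
  upd (upd s i (l ++ get s i)) j (l ++ get s j).
Proof. by move=> ij; rewrite {1}/put_all [LHS]/= get_upd eq_sym (negbTE ij). Qed.

Lemma run_eq k p s s' s'' : run k p s s' -> size s'' = size s ->
  (forall i, get s' i = get s'' i) -> run k p s s''.
Proof.
move=> r sz e; rewrite -(@stacks_eq s' s'') // sz; exact: run_size r.
Qed.

Lemma run_shift_to s i j : get s 0 = [::] -> 0 < i -> 0 < j -> i != j ->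
  i < size s -> j < size s ->
  run 2 (shift_to i j) s (upd (upd s i [::]) j (get s i ++ get s j)).
Proof.
move=> s0 i0 j0 ij hi hj.
have h0 : all (fun j => j < size s) [:: 0] by rewrite /= andbT; lia.
have n0 : i \notin [:: 0] by rewrite inE -lt0n.
have := run_move_all hi h0 n0 isT; rewrite put_all1; set s1 := upd _ 0 _ => r1.
have sz1 : size s1 = size s by apply: run_size r1.
have h0' : 0 < size s1 by rewrite sz1; lia.
have hj' : all (fun j => j < size s1) [:: j] by rewrite /= andbT sz1.
have n1 : 0 \notin [:: j] by rewrite inE eq_sym -lt0n.
have := run_move_all h0' hj' n1 isT; rewrite put_all1 => r2.
apply: (run_eq (run_seq r1 r2)); first by rewrite !size_upd ?size_upd.
have ji : (j == i) = false by rewrite eq_sym (negbTE ij).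
have j00 : (j == 0) = false by lia.
have i01 : (0 == i) = false by lia.
move=> k; rewrite /s1 !get_upd eqxx s0 ji j00 i01 cats0 revK; case: eqP => // _; case: eqP => // ->.
by rewrite s0; case: eqP.
Qed.

Lemma run_copy_to s i j : get s 0 = [::] -> 0 < i -> 0 < j -> i != j ->
  i < size s -> j < size s ->
  run (3 + size (get s i)) (copy_to i j) s (upd s j (get s i ++ get s j)).
Proof.
move=> s0 i0 j0 ij hi hj.
have h0 : all (fun j => j < size s) [:: 0] by rewrite /= andbT; lia.
have n0 : i \notin [:: 0] by rewrite inE -lt0n.
have := run_move_all hi h0 n0 isT; rewrite put_all1; set s1 := upd _ 0 _ => r1.
have sz1 : size s1 = size s by apply: run_size r1.
have h0' : 0 < size s1 by rewrite sz1; lia.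
have hj' : all (fun j => j < size s1) [:: i; j] by rewrite /= andbT sz1 hi.
have n1 : 0 \notin [:: i; j] by rewrite !inE; lia.
have u1 : uniq [:: i; j] by rewrite /= inE ij.
have := run_move_all h0' hj' n1 u1; rewrite put_all2 // => r2.
have ji : (j == i) = false by rewrite eq_sym (negbTE ij).
have j00 : (j == 0) = false by lia.
have i00 : (i == 0) = false by lia.
have i01 : (0 == i) = false by lia.
apply: (run_eq (run_le _ (run_seq r1 r2))).
- by rewrite /s1 !get_upd eqxx i01 s0 cats0 size_rev /=; lia.
- by rewrite !size_upd.
move=> k; rewrite /s1 !get_upd eqxx s0 ji j00 i00 i01 eqxx !cats0 revK.
case: eqP => // _; case: (eqVneq k i) => [->//|ki].
by case: (eqVneq k 0) => // ->; rewrite s0.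
Qed.

End Run.

(** * Midpoint search *)

Definition seqs (ps : seq prog) : prog := foldr Seq Skip ps.
Arguments seqs : simpl never.

Lemma run_cons B k1 k2 p ps s s' s'' :
  run B k1 p s s' -> run B k2 (seqs ps) s' s'' -> run B (k1 + k2) (seqs (p :: ps)) s s''.
Proof. exact: run_seq. Qed.

Lemma run_nil B s : run B 0 (seqs [::]) s s.
Proof. exact: run_skip. Qed.

Definition succ_sym (x : sym) : sym := nth Dollar syms (sym_nat x).+1.

Definition digit (x : sym) : bool := x != Dollar.

(* The number written by [z] in base 8, least significant digit first. *)
Fixpoint value (z : seq sym) : nat :=
  if z is x :: z' then sym_nat x + 8 * value z' else 0.

Lemma sym_nat_digit x : digit x -> sym_nat x < 8.
Proof. by case: x. Qed.

Lemma value_lt z : all digit z -> value z < 8 ^ size z.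
Proof.
elim: z => //= x z IH /andP[/sym_nat_digit hx /IH hz]; rewrite expnS; lia.
Qed.

Lemma value_inj z z' : all digit z -> all digit z' -> size z = size z' ->
  value z = value z' -> z = z'.
Proof.
elim: z z' => [|x z IH] [|x' z'] //= /andP[/sym_nat_digit hx hz].
move=> /andP[/sym_nat_digit hx' hz'] [sz] e.
have exx : sym_nat x = sym_nat x' by lia.
by rewrite (can_inj sym_natK exx) (IH z') //; lia.
Qed.

Lemma value_nseq0 k : value (nseq k Zero) = 0.
Proof. by elim: k => //= k ->. Qed.

(** Adding one carries through the low digits [End], which are 7, and stops at [x], which is not. *)
Lemma value_succ k x r : digit x -> x != End ->
  value (nseq k Zero ++ succ_sym x :: r) = (value (nseq k End ++ x :: r)).+1.
Proof.
move=> hx ne; elim: k => [|k /= ->]; last by lia.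
by case: x hx ne.
Qed.

Lemma value_max k z : all digit z -> size z = k -> value z <= value (nseq k End).
Proof. by elim: z k => [|x z IH] [|k] //= /andP[/sym_nat_digit hx hz] [/(IH _ hz)]; lia. Qed.

(* Modes, on top of stack 8: [Hash] evaluates the goal on stacks 1 and 2,
   [Bar] tries the midpoint on stack 3, and [One] and [Zero] return. *)
Definition set_mode (x : sym) : prog := Modify 8 (fun=> x).
Definition save (i : nat) : prog := Seq (Push 4 Dollar) (copy_to i 4).
Definition restore (i : nat) : prog :=
  seqs [:: move_while digit 4 [:: 0]; Pop 4; move_all 0 [:: i]].

(** Stack 5 holds the remaining depth in unary, and stack 6 the string of [P] zeros, which is the
    first midpoint to be tried. *)
Definition call_step (leaf : prog) : prog :=
  If (no_top 5) leaf (seqs [:: Pop 5; copy_to 6 3; set_mode Bar]).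
Definition enter_step : prog :=
  seqs [:: save 1; save 2; save 3; Push 4 Zero; clear 2; shift_to 3 2; set_mode Hash].
Definition second_step : prog :=
  seqs [:: Pop 4; restore 3; restore 2; restore 1; save 1; save 2; save 3;
           Push 4 One; clear 1; shift_to 3 1; set_mode Hash].
Definition return_step : prog :=
  seqs [:: Pop 4; restore 3; restore 2; restore 1; clear 1; clear 2; clear 3; Push 5 Zero].
Definition next_step : prog :=
  seqs [:: Pop 4; restore 3; restore 2; restore 1;
    While (top_is 3 End) (seqs [:: Modify 3 (fun=> Zero); Dup 3 0; Pop 3]);
    If (no_top 3) (seqs [:: clear 0; clear 1; clear 2; Push 5 Zero])
                  (seqs [:: Modify 3 succ_sym; move_all 0 [:: 3]; set_mode Bar])].

Definition search_body (leaf : prog) : prog :=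
  If (top_is 8 Hash) (call_step leaf)
  (If (top_is 8 Bar) enter_step
  (If (fun t => top_is 8 One t && top_is 4 Zero t) second_step
  (If (top_is 8 One) return_step next_step))).

Definition searching : top_test :=
  fun t => [|| top_is 8 Hash t, top_is 8 Bar t | ~~ no_top 4 t].

Definition search (leaf : prog) : prog := While searching (search_body leaf).

(** * Correctness and space of the midpoint recursion *)

Section Search.

Variables (B : black_box) (P : nat) (W : seq sym) (leaf : prog) (kl : nat).
Variable base : seq sym -> seq sym -> bool.

(** The stacks between two rounds. Stack 4 holds the pending frames, stacks 6 and 7 the constant [P]
    and the code of the grammar, and the stacks from 9 on, empty here, are the working space of
    [leaf]. *)
Definition mk (m : sym) (X Y Z st : seq sym) (d : nat) : stacks :=
  [:: [::]; X; Y; Z; st; nseq d Zero; nseq P Zero; W; [:: m];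
      [::]; [::]; [::]; [::]; [::]; [::]; [::]; [::]; [::]; [::]].

Definition wf (z : seq sym) : bool := (size z == P) && all digit z.

Hypothesis leaf_run : forall X Y st, wf X -> wf Y ->
  run B kl leaf (mk Hash X Y [::] st 0) (mk (bsym (base X Y)) [::] [::] [::] st 0).

Fixpoint reach (d : nat) (X Y : seq sym) : Prop :=
  if d is d'.+1 then exists Z, [/\ wf Z, reach d' X Z & reach d' Z Y] else base X Y.

Definition frame (ph : sym) (X Y Z st : seq sym) : seq sym :=
  ph :: Z ++ Dollar :: Y ++ Dollar :: X ++ Dollar :: st.

Lemma takew_cat c a x r : all c a -> ~~ c x -> takew c (a ++ x :: r) = a.
Proof.
move=> ca cx; rewrite /takew find_cat has_predC ca /= cx addn0.
by rewrite take_size_cat.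
Qed.

Lemma dropw_cat c a x r : all c a -> ~~ c x -> dropw c (a ++ x :: r) = x :: r.
Proof.
move=> ca cx; rewrite /dropw find_cat has_predC ca /= cx addn0.
by rewrite drop_size_cat.
Qed.

Lemma run_save s i : get s 0 = [::] -> 0 < i -> i != 4 -> i < size s -> 4 < size s ->
  run B (size (get s i) + 4) (save i) s (upd s 4 (get s i ++ Dollar :: get s 4)).
Proof.
move=> s0 i0 i4 hi h4.
have r1 := run_push B Dollar h4.
have hi' : i < size (upd s 4 (Dollar :: get s 4)) by rewrite size_upd.
have h4' : 4 < size (upd s 4 (Dollar :: get s 4)) by rewrite size_upd.
have s0' : get (upd s 4 (Dollar :: get s 4)) 0 = [::] by rewrite get_upd s0.
have r2 := @run_copy_to B _ i 4 s0' i0 isT i4 hi' h4'.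
apply: (run_eq (run_le _ (run_seq r1 r2))).
- by rewrite get_upd (negbTE i4); lia.
- by rewrite size_upd.
by move=> k; rewrite !get_upd (negbTE i4) eqxx; case: eqP.
Qed.

Lemma run_restore s i a st : get s 0 = [::] -> get s i = [::] -> 0 < i -> i != 4 ->
  i < size s -> 4 < size s -> get s 4 = a ++ Dollar :: st -> all digit a ->
  run B 2 (restore i) s (upd (upd s 4 st) i a).
Proof.
move=> s0 si i0 i4 hi h4 s4 da.
have h0 : 0 < size s by lia.
have a0 : all (fun j => j < size s) [:: 0] by rewrite /= h0.
have := @run_move_while B digit s 4 [:: 0] h4 a0 isT isT.
rewrite put_all1 s4 takew_cat // dropw_cat // get_upd s0 cats0.
set s1 := upd _ 0 _ => r1.
have sz1 : size s1 = size s := run_size r1.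
have := @run_pop B s1 4; rewrite sz1 => /(_ h4); set s2 := upd s1 4 _ => r2.
have sz2 : size s2 = size s by rewrite (run_size r2).
have ai : all (fun j => j < size s) [:: i] by rewrite /= hi.
have ni : 0 \notin [:: i] by rewrite inE eq_sym -lt0n.
have := @run_move_all B s2 0 [:: i]; rewrite sz2 put_all1 => /(_ h0 ai ni isT) r3.
apply: (run_eq (run_le _ (run_cons r1 (run_cons r2 (run_cons r3 (@run_nil _ _)))))).
- by rewrite !mul0n.
- by rewrite !size_upd // ?size_upd.
have i00 : (i == 0) = false by lia.
have i01 : (0 == i) = false by lia.
move=> k; rewrite /s2 /s1 !get_upd /= ?i00 ?i01 (negbTE i4) si cats0 revK.
case: eqP => // _; case: (eqVneq k 0) => [->|_]; first by rewrite s0.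
by case: eqP.
Qed.

(** Symbolic execution: the stacks reached and the room used are unification variables, filled in
    instruction by instruction, and [finish] leaves the total room to be compared with the announced
    bound. *)
Ltac side := by rewrite /= ?inE ?all_nseq ?orbT.
Ltac exec1 L := eapply run_cons; [eapply L; side | rewrite /=].
Ltac finish := eapply run_le; last first.

Lemma run_enter X Y Z st d : wf X -> wf Y -> wf Z ->
  run B (3 * P + 20) enter_step (mk Bar X Y Z st d) (mk Hash X Z [::] (frame Zero X Y Z st) d).
Proof.
move=> /andP[/eqP sX dX] /andP[/eqP sY dY] /andP[/eqP sZ dZ].
finish.
  exec1 (@run_save). exec1 (@run_save). exec1 (@run_save). exec1 run_push.
  exec1 run_clear. exec1 run_shift_to. exec1 run_modify.
  rewrite cats0; exact: run_nil.
rewrite /= sX sY sZ; lia.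
Qed.

Lemma run_second X Y Z st d : wf X -> wf Y -> wf Z ->
  run B (3 * P + 30) second_step (mk One [::] [::] [::] (frame Zero X Y Z st) d)
    (mk Hash Z Y [::] (frame One X Y Z st) d).
Proof.
move=> /andP[/eqP sX dX] /andP[/eqP sY dY] /andP[/eqP sZ dZ].
finish.
  exec1 run_pop. exec1 run_restore. exec1 run_restore. exec1 run_restore.
  exec1 (@run_save). exec1 (@run_save). exec1 (@run_save). exec1 run_push.
  exec1 run_clear. exec1 run_shift_to. exec1 run_modify.
  rewrite cats0; exact: run_nil.
rewrite /= sX sY sZ; lia.
Qed.

Lemma run_return X Y Z st d : wf X -> wf Y -> wf Z ->
  run B 20 return_step (mk One [::] [::] [::] (frame One X Y Z st) d)
    (mk One [::] [::] [::] st d.+1).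
Proof.
move=> /andP[/eqP sX dX] /andP[/eqP sY dY] /andP[/eqP sZ dZ].
finish.
  exec1 run_pop. exec1 run_restore. exec1 run_restore. exec1 run_restore.
  exec1 run_clear. exec1 run_clear. exec1 run_clear. exec1 run_push.
  exact: run_nil.
by [].
Qed.

Lemma end_prefix z : exists k r, z = nseq k End ++ r /\ ohead r != Some End.
Proof.
elim: z => [|x z [k [r [-> hr]]]]; first by exists 0, [::].
case: (eqVneq x End) => [->|ne]; first by exists k.+1, r.
by exists 0, (x :: nseq k End ++ r).
Qed.

Lemma run_carry m X Y st d k r t : ohead r != Some End ->
  run B 1 (While (top_is 3 End) (seqs [:: Modify 3 (fun=> Zero); Dup 3 0; Pop 3]))
   (upd (mk m X Y (nseq k End ++ r) st d) 0 t)
   (upd (mk m X Y r st d) 0 (nseq k Zero ++ t)).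
Proof.
move=> hr; elim: k t => [|k IH] t N hN.
  by apply: exec_while_false; rewrite /= /top_is /=; case: r hr {hN}.
apply: exec_while_true => //.
  apply: exec_seq.
    by apply: exec_modify.
  apply: exec_seq.
    eapply exec_dup; try by rewrite /=.
    by move: hN; rewrite /= /total /=; lia.
  apply: exec_seq; last by apply: exec_skip.
  by apply: exec_pop.
have -> : nseq k.+1 Zero ++ t = nseq k Zero ++ Zero :: t.
  by rewrite -addn1 nseqD -catA.
apply: IH; move: hN; rewrite /total /=; lia.
Qed.

Lemma run_overflow ph X Y k st d : wf X -> wf Y ->
  run B 30 next_step (mk Zero [::] [::] [::] (frame ph X Y (nseq k End) st) d)
    (mk Zero [::] [::] [::] st d.+1).
Proof.
move=> /andP[/eqP sX dX] /andP[/eqP sY dY].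
have rc := @run_carry Zero X Y st d k [::] [::] isT; rewrite !cats0 /= in rc.
finish.
  exec1 run_pop. exec1 run_restore. exec1 run_restore. exec1 run_restore.
  eapply run_cons; first exact: rc.
  eapply run_cons; last exact: run_nil.
  apply: run_if; rewrite /=.
  exec1 run_clear. exec1 run_clear. exec1 run_clear. exec1 run_push.
  exact: run_nil.
by [].
Qed.

Lemma run_next ph X Y k x r st d : wf X -> wf Y -> all digit r -> digit x -> x != End ->
  run B 30 next_step (mk Zero [::] [::] [::] (frame ph X Y (nseq k End ++ x :: r) st) d)
    (mk Bar X Y (nseq k Zero ++ succ_sym x :: r) st d).
Proof.
move=> /andP[/eqP sX dX] /andP[/eqP sY dY] dr dx xE.
have dZ : all digit (nseq k End ++ x :: r) by rewrite all_cat all_nseq orbT /= dx.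
have rc := @run_carry Zero X Y st d k (x :: r) [::] (_ : Some x != Some End).
rewrite !cats0 /= in rc.
finish.
  exec1 run_pop. exec1 run_restore. exec1 run_restore. exec1 run_restore.
  eapply run_cons; first by apply: rc.
  eapply run_cons; last exact: run_nil.
  apply: run_if; rewrite /=.
  exec1 run_modify. eapply run_cons; first by eapply run_move_all.
  rewrite /= rev_nseq. exec1 run_modify. exact: run_nil.
by [].
Qed.

Variable L : nat.

Let kb := 3 * P + 40 + kl.
Let N := L + 4 * P + size W + 1 + kb.

Inductive iter : stacks -> stacks -> Prop :=
  | iter_refl s : iter s s
  | iter_step s s' s'' : searching (tops s) -> exec B N (search_body leaf) s s' ->
      iter s' s'' -> iter s s''.

Lemma iter_trans s s' s'' : iter s s' -> iter s' s'' -> iter s s''.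
Proof. by elim=> // {s s'} s1 s2 s3 c e _ IH /IH; apply: iter_step. Qed.

Lemma iter_run k m X Y Z st d s : k <= kb ->
  searching (tops (mk m X Y Z st d)) ->
  size X + size Y + size Z + size st + d <= L + 3 * P ->
  run B k (search_body leaf) (mk m X Y Z st d) s -> iter (mk m X Y Z st d) s.
Proof.
move=> kk sr sz r; apply: iter_step sr _ (iter_refl _); apply: r.
rewrite /total /= !size_nseq; lia.
Qed.

Lemma while_iter s s' s'' : iter s s' -> exec B N (search leaf) s' s'' ->
  exec B N (search leaf) s s''.
Proof.
by elim=> // {s s'} s1 s2 s3 c e _ IH /IH; apply: exec_while_true.
Qed.

Lemma size_frame ph X Y Z st : wf X -> wf Y -> wf Z ->
  size (frame ph X Y Z st) = 3 * P + 4 + size st.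
Proof.
by move=> /andP[/eqP sX _] /andP[/eqP sY _] /andP[/eqP sZ _];
  rewrite /frame /= !size_cat /= !size_cat /= size_cat /= sX sY sZ; lia.
Qed.

Lemma wf_size X : wf X -> size X = P. Proof. by case/andP=> /eqP. Qed.

Lemma wf_zeros : wf (nseq P Zero).
Proof. by rewrite /wf size_nseq eqxx all_nseq orbT. Qed.

(** The charge for a level of recursion covers a frame, which consists of three strings and four
    marks, and one unit of the depth counter. *)
Lemma search_goal d X Y st : wf X -> wf Y -> size st + d * (3 * P + 5) <= L ->
  exists2 r : bool, (r <-> reach d X Y) &
    iter (mk Hash X Y [::] st d) (mk (bsym r) [::] [::] [::] st d).
Proof.
elim: d X Y st => [|d IH] X Y st wX wY sz.
  exists (base X Y) => //; apply: iter_run (kl) _ _ _ _ _ _ _ _ _ _ _.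
  - by rewrite /kb; lia.
  - by [].
  - by rewrite /= ?(wf_size wX) ?(wf_size wY) ?(wf_size wZ); lia.
  by apply: run_if; apply: run_if; apply: leaf_run.
rewrite mulSn in sz; have dd : d <= d * (3 * P + 5) by apply: leq_pmulr; lia.
(* Mode [Bar] is treated for an arbitrary current midpoint [Z], by induction on the number of values
   not yet tried: it decides whether a midpoint of value at least [value Z] works. A call enters it
   at zero. *)
suff key Z : wf Z -> exists2 r : bool,
    (r <-> exists Z', [/\ wf Z', value Z <= value Z', reach d X Z' & reach d Z' Y]) &
    iter (mk Bar X Y Z st d) (mk (bsym r) [::] [::] [::] st d.+1).
  have [r rP it] := key _ wf_zeros; exists r.
    rewrite rP; split=> -[Z' h]; exists Z'; first by case: h.
    by rewrite value_nseq0; case: h.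
  apply: iter_trans it; apply: (@iter_run (P + 10)).
  - by rewrite /kb; lia.
  - by [].
  - by rewrite /= ?(wf_size wX) ?(wf_size wY) ?(wf_size wZ); lia.
  apply: run_if; apply: run_if; rewrite /=; finish.
    exec1 run_pop. exec1 run_copy_to. exec1 run_modify.
    rewrite cats0; exact: run_nil.
  by rewrite /= size_nseq; lia.
move e : (8 ^ P - value Z) => v; elim/ltn_ind: v Z e => v IHv Z vE wZ.
have vZ : value Z < 8 ^ P by case/andP: (wZ) => /eqP <- /value_lt.
have [r1 r1P it1] : exists2 r : bool, (r <-> reach d X Z) &
    iter (mk Bar X Y Z st d) (mk (bsym r) [::] [::] [::] (frame Zero X Y Z st) d).
  have [|r rP it] := IH X Z (frame Zero X Y Z st) wX wZ.
    by rewrite size_frame //; lia.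
  exists r => //; apply: iter_trans it; apply: (@iter_run (3 * P + 20)).
  - by rewrite /kb; lia.
  - by [].
  - by rewrite /= ?(wf_size wX) ?(wf_size wY) ?(wf_size wZ); lia.
  by apply: run_if; apply: run_if; apply: run_enter.
(* Both halves together: success drops the frame and restores the depth counter, whereas the failure
   of either half leaves the frame in place with mode [Zero], from where the next midpoint is
   tried. *)
have [r2 r2P [ph it2]] : exists2 r : bool, (r <-> reach d X Z /\ reach d Z Y) &
    exists ph, iter (mk Bar X Y Z st d)
     (if r then mk One [::] [::] [::] st d.+1
      else mk Zero [::] [::] [::] (frame ph X Y Z st) d).
  case: r1 r1P it1 => r1P it1; last first.
    exists false; last by exists Zero.
    by split=> // -[/r1P].
  have [|r rP it] := IH Z Y (frame One X Y Z st) wZ wY.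
    by rewrite size_frame //; lia.
  have it2 : iter (mk Bar X Y Z st d) (mk (bsym r) [::] [::] [::] (frame One X Y Z st) d).
    apply: iter_trans it1 _; apply: iter_trans it; apply: (@iter_run (3 * P + 30)).
    - by rewrite /kb; lia.
    - by [].
    - by rewrite size_frame //=; lia.
    by do 3! [apply: run_if]; apply: run_second.
  have r1T : reach d X Z by apply/r1P.
  case: r rP it it2 => rP _ it2; last first.
    exists false; last by exists One.
    by split=> // -[_ /rP].
  exists true; first by split=> // _; split=> //; apply/rP.
  exists One; apply: iter_trans it2 _; apply: (@iter_run 20).
  - by rewrite /kb; lia.
  - by [].
  - by rewrite size_frame //=; lia.
  by do 4! [apply: run_if]; apply: run_return.
case: r2 r2P it2 => r2P it2.
  have [h1 h2] : reach d X Z /\ reach d Z Y by apply/r2P.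
  by exists true => //; split=> // _; exists Z.
have dZ : all digit Z by case/andP: wZ.
have sZ : size Z = P by apply: wf_size.
(* As [Z] itself has failed and [value] is injective on well-formed strings, a midpoint that works
   has a strictly larger value. *)
have hX Z' : wf Z' -> value Z <= value Z' -> reach d X Z' -> reach d Z' Y ->
    value Z < value Z'.
  move=> wZ' le h1 h2; rewrite ltn_neqAle le andbT; apply/eqP=> vv.
  suff ZZ : Z = Z' by apply: notF; apply/r2P; rewrite ZZ.
  by apply: value_inj vv; rewrite ?sZ ?wf_size //; case/andP: wZ'.
have [k [[|x r] [ZE hr]]] := end_prefix Z.
  rewrite cats0 in ZE; exists false.
    split=> // -[Z' [wZ' le h1 h2]]; have := hX _ wZ' le h1 h2.
    rewrite ltnNge ZE (_ : _ <= _) //; apply: value_max; first by case/andP: wZ'.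
    by rewrite wf_size // -sZ ZE size_nseq.
  apply: iter_trans it2 _; rewrite ZE; apply: (@iter_run 30).
  - by rewrite /kb; lia.
  - by [].
  - by rewrite -ZE size_frame //=; lia.
  by do 4! [apply: run_if]; apply: run_overflow.
have /and3P[dk dx dr] : [&& all digit (nseq k End), digit x & all digit r].
  by move: dZ; rewrite ZE all_cat.
pose Z1 := nseq k Zero ++ succ_sym x :: r.
have vZ1 : value Z1 = (value Z).+1 by rewrite ZE; apply: value_succ.
have wZ1 : wf Z1.
  rewrite /wf /Z1 -sZ ZE !size_cat !size_nseq eqxx all_cat all_nseq orbT /= dr andbT.
  by case: (x) hr dx.
have [|r3 r3P it3] := IHv (8 ^ P - value Z1) _ Z1 erefl wZ1.
  by rewrite -vE; lia.
exists r3.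
  rewrite r3P; split=> -[Z' [wZ' le h1 h2]]; exists Z'; split=> //.
    by rewrite vZ1 in le; apply: ltnW.
  by rewrite vZ1; apply: hX.
apply: iter_trans it2 (iter_trans _ it3); rewrite ZE; apply: (@iter_run 30).
- by rewrite /kb; lia.
- by [].
- by rewrite -ZE size_frame //=; lia.
by do 4! [apply: run_if]; apply: run_next.
Qed.

Lemma exec_search d X Y : wf X -> wf Y -> d * (3 * P + 5) <= L ->
  exists2 r : bool, (r <-> reach d X Y) &
    exec B N (search leaf) (mk Hash X Y [::] [::] d) (mk (bsym r) [::] [::] [::] [::] d).
Proof.
move=> wX wY sz; have [r rP it] := @search_goal d X Y [::] wX wY sz.
exists r => //; apply: while_iter it _; apply: exec_while_false.
by case: r {rP}.
Qed.

End Search.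

(** * Checking a reduction step *)

(** A failed test leaves a mark on stack 16 and the program goes on. All outcomes thus share one
    course and one clean-up, and the verdict is whether stack 16 is empty. *)
Definition check (c : top_test) : prog := If c Skip (Push 16 Dollar).

Definition field (i : nat) (js : seq nat) : prog :=
  seqs [:: move_while isbit i js; check (top_is i Hash); Pop i].

(** Words are kept with their last bit on top. Passing through stack 0 puts the query into reading
    order, and the reply arrives in the order in which words are kept. *)
Definition ask (q : query) (i j : nat) : prog := seqs [:: move_all i [:: 0]; Ask q 0 j].

(** With [h] on stack 12 and [k] on stack 13 this leaves [k^-1 h^-1] on stack 11, and multiplying it
    by [g] on the right gives 1 exactly if [g = h k]. *)
Definition invert_both : prog :=
  seqs [:: ask QInv 13 11; ask QInv 12 11; ask QProd 11 11].

Definition term_case : prog :=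
  seqs [:: Pop 2; Push 10 Term; field 1 [:: 10]; field 1 [:: 14; 15]; Push 10 Hash].

(** No name of 1 is given, so one is guessed in this step. Copying the guessed name to stacks 12, 13
    and 14 turns the common test into [g^-1 g^-1 g = 1], that is, [g = 1]. *)
Definition start_case : prog :=
  seqs [:: Pop 2; check (top_is 1 Start); Pop 1; Push 10 Start; field 2 [:: 10];
           field 2 [:: 12; 13; 14; 15]; Push 10 End; invert_both].

Definition pair_case (b1 h1 b2 h2 : nat) : prog :=
  seqs [:: Pop 2; field 2 [:: b1]; field 2 [:: h1]; field 2 [:: b2]; field 2 [:: h2]].

Definition prod_case : prog :=
  seqs [:: If (top_is 2 Zero) (pair_case 17 12 18 13) (pair_case 18 13 17 12);
           Push 10 Prod; field 1 [:: 10]; field 1 [:: 14; 15];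
           Push 10 Hash; shift_to 17 10; Push 10 Hash; shift_to 18 10; Push 10 End;
           invert_both].

Definition both_bar : top_test := fun t => top_is 1 Bar t && top_is 2 Bar t.

(** A rule is located without a pointer: the certificate repeats the part of stack 7 above the rule,
    and skipping the common prefix leads to it. What is skipped goes to stack 9 and back. The name
    on stack 15 was merely guessed, hence the query to [valid]. *)
Definition finish_check : prog :=
  seqs [:: skip_same (predC1 Bar) 2 1 0; clear 0; check both_bar; Pop 2;
    If (top_is 10 Hash) (seqs [:: field 2 [:: 10; 12]; Push 10 End; ask QInv 12 11]) Skip;
    shift_to 14 11; ask QProd 11 11; field 2 [:: 11]; ask QId 11 11;
    check (top_is 11 One); clear 11; ask QValid 15 15; check (top_is 15 One); clear 15;
    skip_same predT 2 7 9; skip_same predT 10 7 9; check (no_top 10);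
    clear 10; clear 1; clear 2; move_all 9 [:: 7];
    If (no_top 16) (set_mode One) (set_mode Zero); clear 16].

(* A configuration string is a kind, a list of items [A # g #] and, after [Bar],
   a certificate for the step that leads to it, followed by junk. The kind tells
   which rule is used: [Term] for A -> a, [Start] for the goal "the start symbol
   derives 1", and [Zero] or [One] for A -> BC with the two new items in this or
   in the reverse order. The certificate consists of the terminal (for [Term]
   only), the witness for [id], and the codes to be skipped on stack 7 to reach
   the rule. *)
Definition leaf : prog :=
  seqs [:: Pop 1;
    If (top_is 1 Bar) (seqs [:: clear 1; clear 2; set_mode One])
      (seqs [:: If (top_is 2 Term) term_case
                  (If (top_is 2 Start) start_case prod_case);
                finish_check])].

Definition pre (s : seq sym) : seq sym := takew isbit s.
Definition nxt (s : seq sym) : seq sym := behead (dropw isbit s).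
Definition is_field (s : seq sym) : bool := ohead (dropw isbit s) == Some Hash.

Lemma size_pre s : size (pre s) <= size s.
Proof. by rewrite /pre /takew size_take_min geq_minr. Qed.

Lemma size_nxt s : size (nxt s) <= size s.
Proof. by rewrite /nxt /dropw size_behead size_drop; lia. Qed.

(** * The verdict on a reduction step as a boolean function *)

Section Leaf.

Variables (B : black_box) (P : nat) (W : seq sym).

Definition sreply q a : seq sym := map bsym (reply B q a).
Arguments sreply : simpl never.

(** The verdict of [finish_check] in terms of the stacks it starts from. The conjuncts follow the
    order of the marks on stack 16, the last test coming first. *)
Definition tail_ok (is_term : bool) (X Y T Q G V F : seq sym) : bool :=
  let m := lcp (predC1 Bar) Y X in
  let Y2 := behead (drop m Y) in
  let x := pre Y2 in
  let Y3 := if is_term then nxt Y2 else Y2 in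
  let T' := if is_term then End :: rev x ++ T else T in
  let Q' := if is_term then rev (sreply QInv x) else Q in
  let r := sreply QProd (rev Q' ++ rev G) in
  let W1 := drop (lcp predT (nxt Y3) W) W in
  [&& drop (lcp predT T' W1) T' == [::], ohead (sreply QValid (rev V)) == Some One,
      ohead (sreply QId (r ++ pre Y3)) == Some One, is_field Y3,
      is_term ==> is_field Y2,
      (ohead (drop m X) == Some Bar) && (ohead (drop m Y) == Some Bar) & F == [::]].

Definition leaf_state (m : sym) (X Y st T Q H G V F : seq sym) : stacks :=
  [:: [::]; X; Y; [::]; st; [::]; nseq P Zero; W; [:: m];
      [::]; T; Q; H; [::]; G; V; F; [::]; [::]].

Definition flag (c : bool) : seq sym := nseq (~~ c) Dollar.

Lemma run_check s (c : top_test) : 16 < size s ->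
  run B 1 (check c) s (upd s 16 (flag (c (tops s)) ++ get s 16)).
Proof.
move=> h; apply: run_if; rewrite /flag; case: (c (tops s)); last exact: run_push.
by rewrite -[nseq _ _ ++ _]/(get s 16) upd_id //; apply: (@run_le B 0 1 _ _ _ isT (@run_skip B s)).
Qed.

Lemma run_field s i js : i < size s -> 16 < size s -> all (fun j => j < size s) js ->
  i \notin js -> uniq js -> 16 \notin i :: js ->
  run B (1 + size js + (size js).-1 * size (pre (get s i))) (field i js) s
    (upd (upd (put_all (rev (pre (get s i))) js (upd s i (nxt (get s i))))
       16 (flag (is_field (get s i)) ++ get s 16)) i (nxt (get s i))).
Proof.
move=> hi h16 hjs ijs ujs; rewrite inE negb_or => /andP[i16 js16].
have r1 := @run_move_while B isbit s i js hi hjs ijs ujs.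
set s1 := put_all _ _ _ in r1; have sz1 := run_size r1.
have r2 := @run_check s1 (top_is i Hash); rewrite sz1 in r2; move: (r2 h16) => {}r2.
set s2 := upd s1 _ _ in r2; have sz2 := run_size r2.
have r3 := @run_pop B s2 i; rewrite sz2 sz1 in r3; move: (r3 hi) => {}r3.
apply: (run_eq (run_le _ (run_cons r1 (run_cons r2 (run_cons r3 (@run_nil _ _)))))).
- by rewrite -/(pre _); lia.
- by rewrite !size_upd ?size_put_all ?size_upd.
have g1 : get s1 i = dropw isbit (get s i) by rewrite /s1 get_put_all // get_upd eqxx.
have g116 : get s1 16 = get s 16.
  by rewrite /s1 get_put_all // get_upd (negbTE i16).
have -> : s2 = upd s1 16 (flag (is_field (get s i)) ++ get s 16).
  by rewrite /s2 /top_is nth_tops g1 g116.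
move=> k; rewrite !get_upd (_ : i == 16 = false) ?g1; last by rewrite eq_sym (negbTE i16).
case: eqP => // ki; case: eqP => // _; rewrite /s1.
case: (boolP (k \in js)) => kjs; last first.
  by rewrite !get_put_all // !get_upd; case: eqP ki.
by rewrite !get_put_all_in // !get_upd; case: eqP ki.
Qed.

Lemma run_ask0 s q i j : get s 0 = [::] -> i < size s -> j < size s -> 0 < i -> 0 < j ->
  run B (bb_b B + 2) (ask q i j) s
    (upd (upd s i [::]) j (rev (sreply q (rev (get s i))) ++ (if j == i then [::] else get s j))).
Proof.
move=> s0 hi hj i0 j0.
have h0 : 0 < size s by lia.
have a0 : all (fun j => j < size s) [:: 0] by rewrite /= h0.
have n0 : i \notin [:: 0] by rewrite inE -lt0n.
have := run_move_all B hi a0 n0 isT; rewrite put_all1; set s1 := upd _ 0 _ => r1.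
have sz1 := run_size r1.
have j0n : 0 != j by rewrite eq_sym -lt0n.
have r2 := @run_ask B s1 q 0 j; rewrite sz1 in r2; move: (r2 h0 hj j0n) => {}r2.
apply: (run_eq (run_le _ (run_cons r1 (run_cons r2 (@run_nil _ _))))).
- by rewrite /=; lia.
- by rewrite !size_upd ?size_upd.
have i00 : (0 == i) = false by lia.
have j00 : (j == 0) = false by lia.
move=> k; rewrite /s1 !get_upd eqxx i00 j00 s0 cats0.
case: eqP => // _; case: (eqVneq k 0) => [->|_ //]; rewrite s0; by case: eqP.
Qed.

Lemma run_check_top s i x : 16 < size s ->
  run B 1 (check (top_is i x)) s (upd s 16 (flag (ohead (get s i) == Some x) ++ get s 16)).
Proof. by move=> h; rewrite -nth_tops; apply: run_check. Qed.

Lemma run_check_none s i : 16 < size s ->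
  run B 1 (check (no_top i)) s (upd s 16 (flag (ohead (get s i) == None) ++ get s 16)).
Proof. by move=> h; rewrite -nth_tops; apply: run_check. Qed.

Lemma run_check_bars s : 16 < size s ->
  run B 1 (check both_bar) s
    (upd s 16 (flag ((ohead (get s 1) == Some Bar) && (ohead (get s 2) == Some Bar))
               ++ get s 16)).
Proof. by move=> h; rewrite -!nth_tops; apply: run_check. Qed.

Lemma ohead_none (s : seq sym) : (ohead s == None) = (s == [::]).
Proof. by case: s. Qed.

Lemma run_verdict s m : 8 < size s -> get s 8 = [:: m] ->
  run B 0 (If (no_top 16) (set_mode One) (set_mode Zero)) s
    (upd s 8 [:: bsym (get s 16 == [::])]).
Proof.
move=> h e; apply: run_if; rewrite /no_top nth_tops ohead_none.
have := run_modify B (fun=> bsym (get s 16 == [::])) h; rewrite e.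
by case: eqP.
Qed.

Ltac side := by rewrite /= ?inE ?all_nseq ?orbT.
Ltac exec1 L := eapply run_cons; [eapply L; side | rewrite /=].
Ltac finish := eapply run_le; last first.

Lemma flag_nil c F : (flag c ++ F == [::]) = c && (F == [::]).
Proof. by case: c. Qed.

Lemma run_tail X Y st T Q G V F : size Y <= P -> size G <= P ->
  (ohead T == Some Hash -> Q = [::]) ->
  run B (3 * P + 8 * bb_b B + 100) finish_check
    (leaf_state Hash X Y st T Q [::] G V F)
    (leaf_state (bsym (tail_ok (ohead T == Some Hash) X Y T Q G V F))
       [::] [::] st [::] [::] [::] [::] [::] [::]).
Proof.
move=> sY sG QT; rewrite /tail_ok.
set m := lcp _ Y X; set Y2 := behead (drop m Y).
have sY2 : size Y2 <= P by rewrite size_behead size_drop; lia.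
set is_t := ohead T == Some Hash; set x := pre Y2.
set Y3 := if is_t then nxt Y2 else Y2; set T' := if is_t then End :: _ else T.
set Q' := if is_t then _ else Q; set F1 := flag (is_t ==> is_field Y2).
have sx : size x <= P by apply: leq_trans (size_pre _) sY2.
finish.
  exec1 run_skip_same. exec1 run_clear. exec1 run_check_bars. exec1 run_pop.
  (* Both branches of the conditional are brought to one common state, so that the remaining
     instructions are executed symbolically only once. *)
  eapply (@run_cons _ (P + bb_b B + 20) _ _ _ _
    (leaf_state Hash (drop m X) Y3 st T' Q' [::] G V
      (F1 ++ flag ((ohead (drop m X) == Some Bar) && (ohead (drop m Y) == Some Bar)) ++ F))).
    apply: run_if; rewrite /no_top /top_is /=.
    rewrite /F1 /Y3 /T' /Q' -/m -/Y2 -/is_t; case: (boolP is_t) => /= it; last first.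
      exact: (run_le _ (@run_skip _ _)).
    finish.
      exec1 run_field. exec1 run_push. exec1 run_ask0.
      rewrite cats0 revK QT // cats0; exact: run_nil.
    by rewrite /= -/x; lia.
  rewrite /leaf_state.
  exec1 run_shift_to. exec1 run_ask0. exec1 run_field. exec1 run_ask0.
  exec1 run_check_top. exec1 run_clear. exec1 run_ask0. exec1 run_check_top. exec1 run_clear.
  exec1 run_skip_same. exec1 run_skip_same. exec1 run_check_none. exec1 run_clear.
  exec1 run_clear. exec1 run_clear. exec1 run_move_all. exec1 run_verdict. exec1 run_clear.
  rewrite ohead_none !flag_nil !cats0 !rev_cat !revK -catA !cat_take_drop.
  exact: run_nil.
by rewrite /=; lia.
Qed.

Definition term_ok (X Y : seq sym) : bool :=
  let X2 := nxt X in
  tail_ok true (nxt X2) Y (Hash :: rev (pre X) ++ [:: Term]) [::]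
    (rev (pre X2)) (rev (pre X2)) (flag (is_field X2) ++ flag (is_field X)).

Definition start_ok (X Y : seq sym) : bool :=
  let Y2 := nxt Y in
  let i := sreply QInv (pre Y2) in
  tail_ok false (behead X) (nxt Y2) (End :: rev (pre Y) ++ [:: Start])
    (rev (sreply QProd (i ++ i))) (rev (pre Y2)) (rev (pre Y2))
    (flag (is_field Y2) ++ flag (is_field Y) ++ flag (ohead X == Some Start)).

Definition prod_ok (X Y : seq sym) (swap : bool) : bool :=
  let X2 := nxt X in
  let Y2 := nxt Y in
  let Y3 := nxt Y2 in
  let Y4 := nxt Y3 in
  let: (b, h, c, k) := if swap then (pre Y3, pre Y4, pre Y, pre Y2)
                       else (pre Y, pre Y2, pre Y3, pre Y4) in
  tail_ok false (nxt X2) (nxt Y4)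
    (End :: rev c ++ Hash :: rev b ++ Hash :: rev (pre X) ++ [:: Prod])
    (rev (sreply QProd (sreply QInv k ++ sreply QInv h)))
    (rev (pre X2)) (rev (pre X2))
    (flag (is_field X2) ++ flag (is_field X) ++ flag (is_field Y4) ++
     flag (is_field Y3) ++ flag (is_field Y2) ++ flag (is_field Y)).

(** A string without goals is related to every string, in particular to itself; this is what allows
    a path to be stretched to the exact length [2 ^ d]. *)
Definition leaf_ok (X Y : seq sym) : bool :=
  let X1 := behead X in
  let Y1 := behead Y in
  [|| ohead X1 == Some Bar |
      if ohead Y == Some Term then term_ok X1 Y1
      else if ohead Y == Some Start then start_ok X1 Y1
      else prod_ok X1 Y1 (ohead Y != Some Zero)].

Lemma run_term X Y st : size X <= P ->
  run B (3 * P + 50) term_case (mk P W Hash X (Term :: Y) [::] st 0)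
    (leaf_state Hash (nxt (nxt X)) Y st (Hash :: rev (pre X) ++ [:: Term]) [::] [::]
      (rev (pre (nxt X))) (rev (pre (nxt X)))
      (flag (is_field (nxt X)) ++ flag (is_field X))).
Proof.
move=> sX; have := size_nxt X; have := size_pre (nxt X) => h1 h2.
finish.
  exec1 run_pop. exec1 run_push. exec1 run_field. exec1 run_field. exec1 run_push.
  rewrite !cats0; exact: run_nil.
rewrite /=; lia.
Qed.

Lemma run_start X Y st : size Y <= P ->
  run B (4 * P + 3 * bb_b B + 50) start_case (mk P W Hash X (Start :: Y) [::] st 0)
    (leaf_state Hash (behead X) (nxt (nxt Y)) st (End :: rev (pre Y) ++ [:: Start])
      (rev (sreply QProd (sreply QInv (pre (nxt Y)) ++ sreply QInv (pre (nxt Y))))) [::]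
      (rev (pre (nxt Y))) (rev (pre (nxt Y)))
      (flag (is_field (nxt Y)) ++ flag (is_field Y) ++ flag (ohead X == Some Start))).
Proof.
move=> sY; have := size_nxt Y; have := size_pre (nxt Y) => h1 h2.
finish.
  exec1 run_pop. exec1 run_check_top. exec1 run_pop. exec1 run_push.
  exec1 run_field. exec1 run_field. exec1 run_push.
  eapply run_cons; last exact: run_nil.
  exec1 run_ask0. exec1 run_ask0. exec1 run_ask0.
  rewrite !cats0 rev_cat !revK; exact: run_nil.
rewrite /=; lia.
Qed.

Lemma run_pair X Y x st (z := x == Zero) : size X <= P -> size Y <= P ->
  run B (4 * P + 3 * bb_b B + 50) (If (top_is 2 Zero) (pair_case 17 12 18 13) (pair_case 18 13 17 12))
    (mk P W Hash X (x :: Y) [::] st 0)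
    [:: [::]; X; nxt (nxt (nxt (nxt Y))); [::]; st; [::]; nseq P Zero; W; [:: Hash];
      [::]; [::]; [::];
      if z then rev (pre (nxt Y)) else rev (pre (nxt (nxt (nxt Y))));
      if z then rev (pre (nxt (nxt (nxt Y)))) else rev (pre (nxt Y));
      [::]; [::];
      flag (is_field (nxt (nxt (nxt Y)))) ++ flag (is_field (nxt (nxt Y))) ++
      flag (is_field (nxt Y)) ++ flag (is_field Y);
      if z then rev (pre Y) else rev (pre (nxt (nxt Y)));
      if z then rev (pre (nxt (nxt Y))) else rev (pre Y)].
Proof.
move=> sX sY; apply: run_if; rewrite /top_is /=.
rewrite -[Some x == Some Zero]/z; case: z.
  finish.
    exec1 run_pop. exec1 run_field. exec1 run_field. exec1 run_field. exec1 run_field.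
    rewrite !cats0; exact: run_nil.
  rewrite /=; lia.
finish.
  exec1 run_pop. exec1 run_field. exec1 run_field. exec1 run_field. exec1 run_field.
  rewrite !cats0; exact: run_nil.
rewrite /=; lia.
Qed.

Lemma run_prod X Y x st : size X <= P -> size Y <= P ->
  exists T Q G V F,
  run B (8 * P + 6 * bb_b B + 150) prod_case (mk P W Hash X (x :: Y) [::] st 0)
    (leaf_state Hash (nxt (nxt X)) (nxt (nxt (nxt (nxt Y)))) st T Q [::] G V F) /\
  [/\ ohead T = Some End, size G <= P &
   tail_ok false (nxt (nxt X)) (nxt (nxt (nxt (nxt Y)))) T Q G V F =
   prod_ok X Y (x != Zero)].
Proof.
move=> sX sY; have h1 := size_nxt X; have h2 := size_pre (nxt X).
have r1 := @run_pair X Y x st sX sY; rewrite /= in r1.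
rewrite /prod_ok; case: (x == Zero) r1 => /= r1.
all: do 5! eexists; split.
all: try by finish;
  [ apply: (run_cons r1); rewrite /=;
    exec1 run_push; exec1 run_field; exec1 run_field; exec1 run_push;
    exec1 run_shift_to; exec1 run_push; exec1 run_shift_to; exec1 run_push;
    eapply run_cons; last exact: run_nil;
    exec1 run_ask0; exec1 run_ask0; exec1 run_ask0; exact: run_nil
  | rewrite /=; lia].
all: rewrite !cats0 ?rev_cat ?revK; split=> //; rewrite size_rev; lia.
Qed.

Lemma run_leaf X Y st : 0 < P -> size X = P -> size Y = P ->
  run B (20 * P + 20 * bb_b B + 400) leaf (mk P W Hash X Y [::] st 0)
    (mk P W (bsym (leaf_ok X Y)) [::] [::] [::] st 0).
Proof.
move=> P0 sX sY; rewrite /leaf_ok; set X1 := behead X; set Y1 := behead Y.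
have sX1 : size X1 <= P by rewrite size_behead; lia.
have sY1 : size Y1 <= P by rewrite size_behead; lia.
have pop : run B 0 (Pop 1) (mk P W Hash X Y [::] st 0) (mk P W Hash X1 Y [::] st 0).
  exact: run_pop.
suff main : run B (19 * P + 19 * bb_b B + 300)
   (If (top_is 1 Bar) (seqs [:: clear 1; clear 2; set_mode One])
      (seqs [:: If (top_is 2 Term) term_case
                  (If (top_is 2 Start) start_case prod_case);
                finish_check]))
   (mk P W Hash X1 Y [::] st 0) (mk P W (bsym (leaf_ok X Y)) [::] [::] [::] st 0).
  by apply: (run_le _ (run_cons pop (run_cons main (@run_nil _ _)))); lia.
apply: run_if; rewrite /leaf_ok -/X1 -/Y1 /top_is /=; case: ifP => xb /=.
  finish.
    exec1 run_clear. exec1 run_clear. exec1 run_modify. exact: run_nil.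
  by [].
have YE x : ohead Y = Some x -> Y = x :: Y1 by rewrite /Y1; case: (Y) => //= ? ? [->].
suff [k [X' [Y' [T [Q [G [V [F [[rk kk] [sY' sG QT ok]]]]]]]]]] : exists k X' Y' T Q G V F,
  (run B k (If (top_is 2 Term) term_case (If (top_is 2 Start) start_case prod_case))
     (mk P W Hash X1 Y [::] st 0) (leaf_state Hash X' Y' st T Q [::] G V F) /\
   k <= 8 * P + 6 * bb_b B + 150) /\
  [/\ size Y' <= P, size G <= P, ohead T == Some Hash -> Q = [::] &
    tail_ok (ohead T == Some Hash) X' Y' T Q G V F =
    if ohead Y == Some Term then term_ok X1 Y1
      else if ohead Y == Some Start then start_ok X1 Y1
      else prod_ok X1 Y1 (ohead Y != Some Zero)].
  have r2 := @run_tail X' Y' st T Q G V F sY' sG QT; rewrite ok in r2.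
  by apply: (run_le _ (run_cons rk (run_cons r2 (@run_nil _ _)))); lia.
have sn := size_nxt; have sp := size_pre.
have topE x : top_is 2 x (tops (mk P W Hash X1 Y [::] st 0)) = (ohead Y == Some x) by [].
case: (eqVneq (ohead Y) (Some Term)) => [e|nT].
  have r := @run_term X1 Y1 st sX1; rewrite -(YE _ e) in r.
  do 8! eexists; split; first split.
  - by apply: run_if; rewrite topE e; exact: r.
  - by lia.
  - by split=> //; rewrite size_rev; have := sn X1; have := sp (nxt X1); lia.
case: (eqVneq (ohead Y) (Some Start)) => [e|nS].
  have r := @run_start X1 Y1 st sY1; rewrite -(YE _ e) in r.
  do 8! eexists; split; first split.
  - by apply: run_if; rewrite topE e; apply: run_if; rewrite topE e; exact: r.
  - by lia.
  - by split=> //; rewrite ?size_rev; have := sn Y1; have := sp (nxt Y1); have := sn (nxt Y1); lia.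
have [x e] : exists x, ohead Y = Some x by case: (Y) sY P0 => [<-//|x ? _ _]; exists x.
move: nT nS; rewrite e => nT nS.
have [T [Q [G [V [F [r [TE sG ok]]]]]]] := @run_prod X1 Y1 x st sX1 sY1.
rewrite -(YE _ e) in r.
do 8! eexists; split; first split.
- by apply: run_if; rewrite topE e (negbTE nT); apply: run_if; rewrite topE e (negbTE nS);
    exact: r.
- by [].
rewrite TE; split=> //.
by have := sn Y1; have := sn (nxt Y1); have := sn (nxt (nxt Y1)); have := sn (nxt (nxt (nxt Y1))); lia.
Qed.
End Leaf.

(** * Preparing the search *)

Definition nonempty (i : nat) : top_test := top_in i predT.

Definition multiply : prog :=
  seqs [:: While (nonempty 6) (seqs [:: Pop 6; copy_to 12 11]); shift_to 11 6].

Definition bits_to (i j : nat) : prog := move_while isbit i [:: j].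

Definition read_rule : prog :=
  If (top_is 1 Zero)
    (seqs [:: Pop 1; Push 7 Prod; bits_to 1 7; Pop 1; Push 7 Hash; bits_to 1 7;
              Pop 1; Push 7 Hash; bits_to 1 7; Push 7 End])
    (seqs [:: Pop 1; Push 7 Term; bits_to 1 7; Pop 1; Push 7 Hash; bits_to 1 7;
              Push 7 End]).

(** From [n], the input length plus 8, four unary multiplications produce [P = n ^ 5] zeros on stack
    6. Stack 5 receives three times as many, because the number of strings of [P] digits is [8 ^ P],
    which is 2 to the power [3 * P]. *)
Definition set_sizes : prog :=
  seqs [:: move_all 0 [:: 1; 3];
    While (nonempty 3) (seqs [:: Pop 3; Push 12 Zero]);
    Push 12 Zero; Push 12 Zero; Push 12 Zero; Push 12 Zero;
    Push 12 Zero; Push 12 Zero; Push 12 Zero; Push 12 Zero;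
    copy_to 12 6; multiply; multiply; multiply; multiply; clear 12;
    copy_to 6 5; copy_to 6 5; copy_to 6 5].

Definition read_grammar : prog :=
  seqs [:: bits_to 1 9; Pop 1; bits_to 1 9; Pop 1; clear 9;
    Push 7 Start; bits_to 1 7; Push 7 End;
    While (top_is 1 Hash) (seqs [:: Pop 1; read_rule])].

Definition set_goal : prog :=
  seqs [:: copy_to 6 2; Pop 2; Pop 2; Push 2 Bar; Push 2 Zero;
    copy_to 6 1; Pop 1; Pop 1; Pop 1; Push 1 Bar; Push 1 Start; Push 1 Zero;
    Push 8 Hash].

Definition decide : prog :=
  seqs [:: set_sizes; read_grammar; set_goal; search leaf].

Definition sbits (s : seq bool) : seq sym := map bsym s.

Lemma all_sbits s : all isbit (sbits s).
Proof. by elim: s => //= -[]. Qed.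

(** * From the input to the initial goal *)

Section Setup.

Variable B : black_box.

(** Only the growth [t] of the indexed states counts. Adding up the rounds with [run_seq] would give
    a bound that depends on their number [m]. *)
Lemma run_while (c : top_test) p k t (st : nat -> stacks) m :
  (forall i, i < m -> c (tops (st i))) -> ~~ c (tops (st m)) ->
  (forall i, i < m -> run B k p (st i) (st i.+1)) ->
  (forall i, i <= m -> total (st i) <= total (st 0) + t) ->
  run B (t + k) (While c p) (st 0) (st m).
Proof.
move=> cT cF step tot N hN.
suff h d : d <= m -> exec B N (While c p) (st (m - d)) (st m).
  by have := h m (leqnn _); rewrite subnn.
elim: d => [|d IH] dm; first by rewrite subn0; apply: exec_while_false.
have lt : m - d.+1 < m by lia.
apply: (exec_while_true (cT _ lt) (step _ lt N _)).
  by have := tot _ (ltnW lt); lia.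
by rewrite subnSK //; apply: IH; apply: ltnW.
Qed.

Ltac side := by rewrite /= ?inE ?all_nseq ?orbT.
Ltac exec1 L := eapply run_cons; [eapply L; side | rewrite /=].
Ltac finish := eapply run_le; last first.

Definition setup_state (X Y Z D PZ W Q H : seq sym) : stacks :=
  [:: [::]; X; Y; Z; [::]; D; PZ; W; [::];
      [::]; [::]; Q; H; [::]; [::]; [::]; [::]; [::]; [::]].

Lemma run_multiply X a n : run B (a * n + n + 20) multiply
  (setup_state X [::] [::] [::] (nseq a Zero) [::] [::] (nseq n Zero))
  (setup_state X [::] [::] [::] (nseq (a * n) Zero) [::] [::] (nseq n Zero)).
Proof.
pose st i := setup_state X [::] [::] [::] (nseq (a - i) Zero) [::] (nseq (i * n) Zero) (nseq n Zero).
have r : run B (a * n + (n + 3)) (While (nonempty 6) (seqs [:: Pop 6; copy_to 12 11])) (st 0) (st a).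
  apply: run_while.
  - by move=> i ia; rewrite /st (_ : a - i = (a - i.+1).+1) //; lia.
  - by rewrite /st subnn.
  - move=> i ia; rewrite /st; have -> : a - i = (a - i.+1).+1 by lia.
    finish.
      exec1 run_pop. exec1 run_copy_to. rewrite -nseqD -mulSn; exact: run_nil.
    by rewrite /= size_nseq; lia.
  - by move=> i ia; rewrite /total /= !size_nseq; have := leq_mul2r n i a; rewrite ia orbT; lia.
rewrite /st subn0 mul0n subnn in r.
finish.
  eapply run_cons; first exact: r.
  exec1 run_shift_to. rewrite cats0; exact: run_nil.
by lia.
Qed.

Lemma run_set_sizes (inp : seq sym) (n := size inp + 8) (P := n ^ 5) :
  run B (20 * P) set_sizes (upd (nseq 19 [::]) 0 (rev inp))
    (setup_state inp [::] [::] (nseq (3 * P) Zero) (nseq P Zero) [::] [::] [::]).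
Proof.
pose st i := setup_state inp [::] (drop i inp) [::] [::] [::] [::] (nseq i Zero).
have r : run B (0 + 1) (While (nonempty 3) (seqs [:: Pop 3; Push 12 Zero])) (st 0) (st (size inp)).
  apply: run_while.
  - by move=> i hi; rewrite /st (drop_nth Zero hi).
  - by rewrite /st drop_size.
  - move=> i hi; rewrite /st (drop_nth Zero hi); finish.
      exec1 run_pop. exec1 run_push. exact: run_nil.
    by [].
  - by move=> i hi; rewrite /total /= !size_nseq !size_drop; lia.
rewrite /st drop0 drop_size in r.
have n8 : 8 <= n by rewrite /n leq_addl.
finish.
  eapply run_cons; first by eapply run_move_all; side.
  rewrite /= revK !cats0.
  eapply run_cons; first exact: r.
  rewrite /setup_state.
  do 8 exec1 run_push.
  exec1 run_copy_to.
  rewrite !cats0 -[[:: Zero, Zero & _]]/(nseq (8 + size inp) Zero) addnC -/n.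
  eapply run_cons; first exact: (@run_multiply inp n n).
  eapply run_cons; first exact: (@run_multiply inp (n * n) n).
  eapply run_cons; first exact: (@run_multiply inp (n * n * n) n).
  eapply run_cons; first exact: (@run_multiply inp (n * n * n * n) n).
  rewrite /setup_state.
  exec1 run_clear. exec1 run_copy_to. exec1 run_copy_to. exec1 run_copy_to.
  have -> : n * n * n * n * n = P by rewrite /P !expnS expn0; lia.
  rewrite cats0 -!nseqD; have -> : P + (P + P) = 3 * P by lia.
  exact: run_nil.
rewrite /= ?size_rev ?size_nseq.
have -> : n * n * n * n * n = P by rewrite /P !expnS expn0; lia.
have h1 : size inp <= n by rewrite leq_addr.
have h2 : n * n <= P by rewrite /P -[n * n]/(n ^ 2) leq_pexp2l //; lia.
have h3 : n * n * n <= P by rewrite /P -[_ * _ * _]mulnA -[n * _]/(n ^ 3) leq_pexp2l //; lia.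
have h4 : n * n * n * n <= P by rewrite /P -!mulnA -[n * _]/(n ^ 4) leq_pexp2l //; lia.
have h5 : 100 * n <= P.
  apply: leq_trans (_ : n * n * n * n <= P) => //.
  rewrite mulnC -!mulnA leq_mul2l; apply/orP; right.
  by apply: leq_trans (_ : 8 * (8 * 8) <= _); rewrite ?leq_mul.
clearbody P n; lia.
Qed.

Lemma takew_end c (a : seq sym) : all c a -> takew c a = a.
Proof.
by move=> ca; rewrite /takew (_ : find _ a = size a) ?take_size //; apply: hasNfind; rewrite has_predC ca.
Qed.

Lemma dropw_end c (a : seq sym) : all c a -> dropw c a = [::].
Proof.
by move=> ca; rewrite /dropw (_ : find _ a = size a) ?drop_size //; apply: hasNfind; rewrite has_predC ca.
Qed.

Definition stops (r : seq sym) : bool := if r is x :: _ then ~~ isbit x else true.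

Lemma run_bits_to s i j a r : i < size s -> j < size s -> i != j ->
  get s i = a ++ r -> all isbit a -> stops r ->
  run B 1 (bits_to i j) s (upd (upd s i r) j (rev a ++ get s j)).
Proof.
move=> hi hj ij e ha hr.
have hj' : all (fun j => j < size s) [:: j] by rewrite /= hj.
have ij' : i \notin [:: j] by rewrite inE.
have := @run_move_while B isbit s i [:: j] hi hj' ij' isT.
rewrite put_all1 get_upd eq_sym (negbTE ij) e.
have [-> ->] : takew isbit (a ++ r) = a /\ dropw isbit (a ++ r) = r.
  case: r hr {e} => [|x r] hr; first by rewrite cats0 takew_end ?dropw_end.
  by rewrite takew_cat ?dropw_cat.
by apply: run_le; rewrite mul0n.
Qed.

Variables (N : Type) (nt : N -> seq bool).

(** A rule is enclosed between its kind and [End], which do not occur inside, so that a string of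
    this shape found anywhere in the code of the grammar is one of its rules. *)
Definition rule_code (r : production N (word (bb_b B))) : seq sym :=
  match r.2 with
  | inl (C, D) => Prod :: sbits (nt r.1) ++ Hash :: sbits (nt C) ++ Hash ::
                  sbits (nt D) ++ [:: End]
  | inr x => Term :: sbits (nt r.1) ++ Hash :: sbits x ++ [:: End]
  end.

Definition grammar_code (start : N) (s : seq (production N (word (bb_b B)))) : seq sym :=
  (Start :: sbits (nt start) ++ [:: End]) ++ flatten [seq rule_code r | r <- s].

Notation letters s := (map lsym s).

Lemma letters_bits (s : seq bool) : letters [seq Some e | e <- s] = sbits s.
Proof. by rewrite -map_comp. Qed.

Lemma stops_codes s : stops (letters (flatten [seq production_code (b := bb_b B) nt r | r <- s])).
Proof. by case: s => //= -[A [[C D]|x]] s. Qed.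

Lemma run_read_rule D PZ W r u : stops u ->
  run B 20 (seqs [:: Pop 1; read_rule])
    (setup_state (letters (production_code (b := bb_b B) nt r) ++ u) [::] [::] D PZ W [::] [::])
    (setup_state u [::] [::] D PZ (rev (rule_code r) ++ W) [::] [::]).
Proof.
case: r => A [[C E]|x] hu; rewrite /production_code /rule_code /=;
  rewrite !(map_cat, map_cons, letters_bits) /=; finish.
- exec1 run_pop. eapply run_cons; last exact: run_nil.
  apply: run_if; rewrite /=.
  exec1 run_pop. exec1 run_push.
  rewrite -!catA !cat_cons -!catA.
  eapply run_cons; first by eapply run_bits_to; rewrite //= ?all_sbits.
  rewrite /=. exec1 run_pop. exec1 run_push.
  eapply run_cons; first by eapply run_bits_to; rewrite //= ?all_sbits.
  rewrite /=. exec1 run_pop. exec1 run_push.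
  eapply run_cons; first by eapply run_bits_to; rewrite //= ?all_sbits.
  rewrite /=. exec1 run_push.
  rewrite !(rev_cat, rev_cons, cats1, cat_rcons, rev_rcons) -?catA /=; exact: run_nil.
- by [].
- exec1 run_pop. eapply run_cons; last exact: run_nil.
  apply: run_if; rewrite /=.
  exec1 run_pop. exec1 run_push.
  rewrite -!catA !cat_cons -?catA.
  eapply run_cons; first by eapply run_bits_to; rewrite //= ?all_sbits.
  rewrite /=. exec1 run_pop. exec1 run_push.
  eapply run_cons; first by eapply run_bits_to; rewrite //= ?all_sbits.
  rewrite /=. exec1 run_push.
  rewrite !(rev_cat, rev_cons, cats1, cat_rcons, rev_rcons) -?catA /=; exact: run_nil.
- by [].
Qed.

Lemma size_rule_code r : size (rule_code r) = size (production_code (b := bb_b B) nt r).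
Proof.
by case: r => A [[C E]|x];
  rewrite /rule_code /production_code /= !(size_cat, size_map, size_tuple) /= ?(size_cat, size_map, size_tuple) /= ?(size_cat, size_map) /=; lia.
Qed.

Lemma size_flatten_rules s :
  size (flatten [seq rule_code r | r <- s]) =
  size (flatten [seq production_code (b := bb_b B) nt r | r <- s]).
Proof. by elim: s => //= r s IH; rewrite !size_cat IH size_rule_code. Qed.

Lemma run_read_grammar D PZ start s
    (w := [seq Some e | e <- nt start] ++
          flatten [seq production_code (b := bb_b B) nt r | r <- s]) :
  run B 60 read_grammar
    (setup_state (letters (bb_input B w)) [::] [::] D PZ [::] [::] [::])
    (setup_state [::] [::] [::] D PZ (rev (grammar_code start s)) [::] [::]).
Proof.
pose W0 := rev (Start :: sbits (nt start) ++ [:: End]).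
pose st i := setup_state
  (letters (flatten [seq production_code (b := bb_b B) nt r | r <- drop i s])) [::] [::] D PZ
  (rev (flatten [seq rule_code r | r <- take i s]) ++ W0) [::] [::].
have r : run B (0 + 20) (While (top_is 1 Hash) (seqs [:: Pop 1; read_rule])) (st 0) (st (size s)).
  apply: run_while.
  - move=> i hi; rewrite /st; case e : (drop i s) => [|r s'] /=.
      by move: (size_drop i s); rewrite e /=; lia.
    by case: r {e} => A [[C E]|x].
  - by rewrite /st drop_size.
  - move=> i hi; rewrite /st.
    case e : (drop i s) => [|r s'].
      by move: (size_drop i s); rewrite e /=; lia.
    have e1 : drop i.+1 s = s' by rewrite -[i.+1]add1n -drop_drop e /= drop0.
    have e2 : take i.+1 s = rcons (take i s) r.
      by rewrite (take_nth r hi); congr rcons; rewrite -[i]addn0 -nth_drop e.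
    rewrite e1 e2 /= map_rcons flatten_rcons rev_cat -catA map_cat.
    exact: (@run_read_rule D PZ _ r _ (stops_codes s')).
  - move=> i hi; have : size (flatten [seq production_code (b := bb_b B) nt r | r <- s]) =
      size (flatten [seq production_code (b := bb_b B) nt r | r <- take i s]) +
      size (flatten [seq production_code (b := bb_b B) nt r | r <- drop i s]).
      by rewrite -size_cat -flatten_cat -map_cat cat_take_drop.
    rewrite /total /= !size_cat !size_rev !size_map !size_flatten_rules take0 drop0 /=; lia.
rewrite /st drop0 take0 drop_size take_size cat0s in r.
have sc : stops (letters (flatten [seq production_code (b := bb_b B) nt r | r <- s])) :=
  stops_codes s.
rewrite /bb_input /w !(map_cat, map_cons, letters_bits, map_nseq) /=.
finish.
  eapply run_cons; first by eapply run_bits_to; rewrite //= ?all_nseq ?orbT.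
  rewrite /=. exec1 run_pop.
  eapply run_cons; first by eapply run_bits_to; rewrite //= ?all_nseq ?orbT.
  rewrite /=. exec1 run_pop. exec1 run_clear. exec1 run_push.
  eapply run_cons; first by eapply run_bits_to; [by [] | by [] | by [] | reflexivity | exact: all_sbits | exact: sc].
  rewrite /=. exec1 run_push.
  have -> : End :: rev (sbits (nt start)) ++ [:: Start] = W0.
    by rewrite /W0 rev_cons rev_cat -cats1.
  eapply run_cons; first exact: r.
  rewrite /grammar_code rev_cat; exact: run_nil.
by [].
Qed.

Definition start_string P : seq sym := Zero :: Start :: Bar :: nseq (P - 3) Zero.
Definition end_string P : seq sym := Zero :: Bar :: nseq (P - 2) Zero.

Lemma run_set_goal P d W : 3 <= P ->
  run B (2 * P + 30) set_goal
    (setup_state [::] [::] [::] (nseq d Zero) (nseq P Zero) W [::] [::])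
    (mk P W Hash (start_string P) (end_string P) [::] [::] d).
Proof.
case: P => [|[|[|P]]] // _; finish.
  exec1 run_copy_to. exec1 run_pop. exec1 run_pop. exec1 run_push. exec1 run_push.
  exec1 run_copy_to. exec1 run_pop. exec1 run_pop. exec1 run_pop.
  exec1 run_push. exec1 run_push. exec1 run_push. exec1 run_push.
  by rewrite !cats0 /mk /start_string /end_string !subSS !subn0; apply: run_nil.
by rewrite /= !size_nseq; lia.
Qed.

Lemma exec_weaken N1 N2 p s s' : N1 <= N2 -> exec B N1 p s s' -> exec B N2 p s s'.
Proof.
move=> le; elim=> {p s s'}.
- by move=> s; apply: exec_skip.
- by move=> s i h; apply: exec_pop.
- by move=> s i a h lt; apply: exec_push => //; lia.
- by move=> s i j a r hi hj ij lt e; apply: exec_dup e; rewrite //; lia.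
- by move=> s i f h; apply: exec_modify.
- by move=> s q i j hi hj ij lt; apply: exec_ask => //; lia.
- by move=> p p' s s' s'' _ h1 _ h2; apply: exec_seq h1 h2.
- by move=> c p p' s s' _ h; apply: exec_if.
- by move=> c p s h; apply: exec_while_false.
- by move=> c p s s' s'' h _ h1 _ h2; apply: exec_while_true h h1 h2.
Qed.

Lemma size_grammar_code start s :
  size (grammar_code start s) =
  (size ([seq Some e | e <- nt start] ++
          flatten [seq production_code (b := bb_b B) nt r | r <- s])).+2.
Proof.
rewrite /grammar_code /= !size_cat /= !size_map.
by rewrite size_flatten_rules addn1 addSn.
Qed.

Lemma wf_start P : 3 <= P -> wf P (start_string P).
Proof. by move=> P3; rewrite /wf /= size_nseq all_nseq /= orbT andbT; lia. Qed.

Lemma wf_end P : 3 <= P -> wf P (end_string P).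
Proof. by move=> P3; rewrite /wf /= size_nseq all_nseq /= orbT andbT; lia. Qed.

(** The room is quadratic in [P] because the recursion keeps up to [3 * P] frames of about [3 * P]
    symbols each; the factor 1000 is generous. *)
Lemma exec_decide start s
    (w := [seq Some e | e <- nt start] ++
          flatten [seq production_code (b := bb_b B) nt r | r <- s])
    (P := (size (bb_input B w) + 8) ^ 5) (W := rev (grammar_code start s)) :
  exists2 r : bool,
    (r <-> reach P (leaf_ok B W) (3 * P) (start_string P) (end_string P)) &
    exists2 s, exec B (1000 * P ^ 2) decide
        (upd (nseq 19 [::]) 0 (rev (map lsym (bb_input B w)))) s &
      top_is 8 One (tops s) = r.
Proof.
set n := size (bb_input B w).
have nP : n + 8 <= P by rewrite /P -/n -{1}[n + 8]expn1 leq_pexp2l //; lia.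
have P3 : 3 <= P by lia.
have [nw nE sW] : exists2 k, n = bb_b B + bb_c B + k + 2 & size W = k.+2.
  exists (size w); last by rewrite /W size_rev size_grammar_code.
  by rewrite /n /bb_input size_cat /= size_cat /= !size_nseq addn2 !addnS addnA.
have leafr X Y st : wf P X -> wf P Y -> run B (20 * P + 20 * bb_b B + 400) leaf
    (mk P W Hash X Y [::] st 0) (mk P W (bsym (leaf_ok B W X Y)) [::] [::] [::] st 0).
  by move=> /wf_size sX /wf_size sY; apply: run_leaf => //; lia.
have [r rP ex] := @exec_search B P W leaf _ _ leafr _ (3 * P) _ _ (wf_start P3) (wf_end P3) (leqnn _).
exists r => //; exists (mk P W (bsym r) [::] [::] [::] [::] (3 * P)); last by case: (r).
have r1 : run B (20 * P) set_sizes (upd (nseq 19 [::]) 0 (rev (map lsym (bb_input B w))))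
    (setup_state (map lsym (bb_input B w)) [::] [::] (nseq (3 * P) Zero) (nseq P Zero)
       [::] [::] [::]).
  by have := @run_set_sizes (map lsym (bb_input B w)); rewrite size_map.
have r2 := @run_read_grammar (nseq (3 * P) Zero) (nseq P Zero) start s.
have r3 := @run_set_goal P (3 * P) W P3.
have PP : P <= P * P by apply: leq_pmulr; lia.
have t0 : total (upd (nseq 19 [::]) 0 (rev (map lsym (bb_input B w)))) = n.
  by rewrite /total /= size_rev size_map; lia.
have PE : P ^ 2 = P * P by [].
have t1 := run_total r1; have t2 := run_total r2; have t3 := run_total r3.
rewrite t0 in t1.
apply: exec_seq (r1 _ _) (exec_seq (r2 _ _) (exec_seq (r3 _ _) (exec_seq _ (exec_skip _ _ _)))).
- by rewrite t0 PE; clearbody P n; lia.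
- by apply: (leq_trans (leq_add t1 (leqnn _))); rewrite PE; clearbody P n; lia.
- apply: (leq_trans (leq_add (leq_trans t2 (leq_add t1 (leqnn _))) (leqnn _))).
  by rewrite PE; clearbody P n; lia.
apply: exec_weaken ex; rewrite sW PE; clearbody P n W; lia.
Qed.
End Setup.

(** * Strahler numbers *)

(** Otherwise [f] increases strictly from each multiple of [r] to the next, so that [f (k * r)] is
    at least [k], which fails for [k = M.+1]. *)
Lemma stationary (f : nat -> nat) M r : {homo f : i j / i <= j} -> (forall i, f i <= M) ->
  exists2 j, j <= M & f (j * r) = f (j.+1 * r).
Proof.
move=> hf fM; suff h k : (exists2 j, j < k & f (j * r) = f (j.+1 * r)) \/ k <= f (k * r).
  have [[j jM e]|] := h M.+1; first by exists j.
  by have := fM (M.+1 * r); lia.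
elim: k => [|k [[j jk e]|IH]]; [by right | by left; exists j => //; apply: ltnW | ].
have le : f (k * r) <= f (k.+1 * r) by apply: hf; rewrite leq_mul2r leqnSn orbT.
case: (eqVneq (f (k * r)) (f (k.+1 * r))) => [e|ne]; first by left; exists k.
by right; lia.
Qed.

Section Strahler.

Variables (gT : finGroupType) (N : finType) (prods : seq (production N gT)).

Local Open Scope group_scope.

Implicit Types (V : {set N}) (A C D E : N) (s : nat) (g h u v : gT).

(* [yields V s A g]: some derivation tree from [A], of Strahler number at most
   [s] and with all its nonterminals in [V], evaluates to [g]. *)
Inductive yields (V : {set N}) : nat -> N -> gT -> Prop :=
  | yields_term s A g : A \in V -> (A, inr g) \in prods -> yields V s A g
  | yields_left s A C D g h : A \in V -> (A, inl (C, D)) \in prods ->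
      yields V s.+1 C g -> yields V s D h -> yields V s.+1 A (g * h)
  | yields_right s A C D g h : A \in V -> (A, inl (C, D)) \in prods ->
      yields V s C g -> yields V s.+1 D h -> yields V s.+1 A (g * h).

Lemma yields_in V s A g : yields V s A g -> A \in V.
Proof. by case. Qed.

Lemma yields_mono (V V' : {set N}) s s' A g : V \subset V' -> s <= s' ->
  yields V s A g -> yields V' s' A g.
Proof.
move=> /subsetP VV' le y; elim: y s' le => {s A g}.
- by move=> s A g AV r s' _; apply: yields_term r; apply: VV'.
- move=> s A C D g h AV r _ IH1 _ IH2 [//|s'] le.
  by apply: yields_left r (IH1 _ le) (IH2 _ _) => //; apply: VV'.
move=> s A C D g h AV r _ IH1 _ IH2 [//|s'] le.
by apply: yields_right r (IH1 _ _) (IH2 _ le) => //; apply: VV'.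
Qed.

Lemma yields_pair V s A C D g h : A \in V -> (A, inl (C, D)) \in prods ->
  yields V s C g -> yields V s D h -> yields V s.+1 A (g * h).
Proof.
move=> AV r yC yD; apply: yields_left r _ yD => //.
exact: yields_mono yC.
Qed.

(* [context V s A A' u v]: there is a derivation of [u A' v] from [A] along a
   path whose side trees have Strahler number at most [s]. *)
Inductive context (V : {set N}) (s : nat) : N -> N -> gT -> gT -> Prop :=
  | context_nil A : context V s A A 1 1
  | context_left A C D A' u v h : A \in V -> (A, inl (C, D)) \in prods ->
      context V s C A' u v -> yields V s D h -> context V s A A' u (v * h)
  | context_right A C D A' u v h : A \in V -> (A, inl (C, D)) \in prods ->
      yields V s C h -> context V s D A' u v -> context V s A A' (h * u) v.

Lemma context_trans V s A1 A2 A3 u v u' v' : context V s A1 A2 u v ->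
  context V s A2 A3 u' v' -> context V s A1 A3 (u * u') (v' * v).
Proof.
move=> c c'; elim: c c' => {A1 A2 u v} [A|A C D A' u v h AV r _ IH yD|A C D A' u v h AV r yC _ IH] c'.
- by rewrite mul1g mulg1.
- by rewrite mulgA; apply: context_left r (IH c') yD.
by rewrite -mulgA; apply: context_right r yC (IH c').
Qed.

Lemma context_mono (V V' : {set N}) s s' A A' u v : V \subset V' -> s <= s' ->
  context V s A A' u v -> context V' s' A A' u v.
Proof.
move=> VV' le; elim=> {A A' u v} [A|A C D A' u v h AV r _ IH yD|A C D A' u v h AV r yC _ IH].
- exact: context_nil.
- exact: (context_left (subsetP VV' _ AV) r IH (yields_mono VV' le yD)).
exact: (context_right (subsetP VV' _ AV) r (yields_mono VV' le yC) IH).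
Qed.

(** Each node on the path has one child on the path and one of number below [s'], so the number does
    not grow on the way up. *)
Lemma context_fill V s s' A A' u v g : s < s' -> context V s A A' u v ->
  yields V s' A' g -> yields V s' A (u * g * v).
Proof.
case: s' => // s' lt; elim=> {A A' u v} [A|A C D A' u v h AV r _ IH yD|A C D A' u v h AV r yC _ IH] yA.
- by rewrite mul1g mulg1.
- by rewrite mulgA; apply: yields_left r (IH yA) _ => //; apply: yields_mono yD.
have -> : h * u * g * v = h * (u * g * v) by rewrite !mulgA.
by apply: yields_right r _ (IH yA) => //; apply: yields_mono yC.
Qed.

(** The tree below a lowest occurrence of [A]: the symbol labels the root and no other node. Both
    subtrees get the same bound [s], so rejoining them may cost one. *)
Definition root_yields (V : {set N}) (s : nat) (A : N) (g : gT) : Prop :=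
  (A, inr g) \in prods \/
  exists C D g1 g2, [/\ (A, inl (C, D)) \in prods, yields (V :\ A) s C g1,
    yields (V :\ A) s D g2 & g = g1 * g2].

Lemma root_mono V s s' A g : s <= s' -> root_yields V s A g -> root_yields V s' A g.
Proof.
move=> le [r|[C [D [g1 [g2 [r y1 y2 ->]]]]]]; [by left | right].
by exists C, D, g1, g2; split=> //; [apply: yields_mono y1 | apply: yields_mono y2].
Qed.

Lemma context_root (V : {set N}) s A g : root_yields V s A g ->
  exists u v h, [/\ context V s A A u v, root_yields V s A h & g = u * h * v].
Proof.
move=> r; exists 1, 1, g; split; rewrite ?mul1g ?mulg1 //.
exact: context_nil.
Qed.

(* Cuts a derivation tree at a lowest occurrence of [A]. *)
Lemma yields_split V s A C g : yields V s C g ->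
  yields (V :\ A) s C g \/
  exists u v h, [/\ context V s C A u v, root_yields V s A h & g = u * h * v].
Proof.
elim=> {s C g}.
- move=> s C g CV r; case: (eqVneq C A) => [e|CA].
    by right; rewrite e; apply: context_root; left; rewrite -e.
  by left; apply: yields_term r; rewrite !inE CA.
- move=> s C D E g h CV r yD IH1 yE IH2.
  have yE' : yields V s.+1 E h by apply: yields_mono yE.
  case: IH1 => [fD|[u [v [k [c rk ->]]]]]; last first.
    right; exists u, (v * h), k; split=> //; last by rewrite mulgA.
    exact: context_left r c yE'.
  case: IH2 => [fE|[u [v [k [c rk ->]]]]]; last first.
    right; exists (g * u), v, k; split; last by rewrite !mulgA.
      by apply: context_right r yD _ => //; apply: context_mono c.
    exact: root_mono rk.
  case: (eqVneq C A) => [e|CA]; last first.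
    by left; apply: yields_left r fD fE; rewrite !inE CA.
  right; rewrite e; apply: context_root; right; exists D, E, g, h; split=> //.
    by rewrite -e.
  exact: yields_mono fE.
move=> s C D E g h CV r yD IH1 yE IH2.
have yD' : yields V s.+1 D g by apply: yields_mono yD.
case: IH1 => [fD|[u [v [k [c rk ->]]]]]; last first.
  right; exists u, (v * h), k; split; last by rewrite mulgA.
    by apply: context_left r _ yE => //; apply: context_mono c.
  exact: root_mono rk.
case: IH2 => [fE|[u [v [k [c rk ->]]]]]; last first.
  right; exists (g * u), v, k; split=> //; last by rewrite !mulgA.
  exact: context_right r yD' c.
case: (eqVneq C A) => [e|CA]; last first.
  by left; apply: yields_right r fD fE; rewrite !inE CA.
right; rewrite e; apply: context_root; right; exists D, E, g, h; split=> //.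
  by rewrite -e.
exact: yields_mono fD.
Qed.

Lemma yields_root V s A g : yields V s A g ->
  exists u v h, [/\ context V s A A u v, root_yields V s A h & g = u * h * v].
Proof.
move=> y; case: (yields_split A y) => // /yields_in.
by rewrite !inE eqxx.
Qed.

(** * Cycle groups and the bound on Strahler numbers *)

Variable V : {set N}.

(** Right parts compose in reverse order; storing the inverse of [v] gives a subgroup of the
    ordinary product group. By finiteness, closure under products is enough for that. *)
Definition cycles (s : nat) (A : N) : {set gT * gT} :=
  [set p : gT * gT | `[< context V s A A p.1 p.2^-1 >]].

Lemma cycles_group_set s A : group_set (cycles s A).
Proof.
apply/group_setP; split=> [|[u v] [u' v']].
  by rewrite inE /= invg1; apply/asboolP; apply: context_nil.
rewrite !inE => /asboolP c /asboolP c'; apply/asboolP.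
by rewrite /= invMg; apply: context_trans c c'.
Qed.

Definition cycle_group s A : {group gT * gT} := Group (cycles_group_set s A).

Lemma cycles_mono s s' A : s <= s' -> cycles s A \subset cycles s' A.
Proof.
move=> le; apply/subsetP=> p; rewrite !inE => /asboolP c; apply/asboolP.
exact: context_mono c.
Qed.

(** Summing over all nonterminals finds one range of numbers on which all the cycle groups are
    constant at once. *)
Definition potential (s : nat) : nat := \sum_(A in V) trunc_log 2 #|cycles s A|.

(** By Lagrange a proper inclusion at least doubles the order, so the logarithm grows. The equality
    case is what [potential_eq] extracts from equal sums. *)
Lemma trunc_log_cycles s s' A : s <= s' ->
  trunc_log 2 #|cycles s A| <= trunc_log 2 #|cycles s' A|
    ?= iff (cycles s A == cycles s' A).
Proof.
move=> le; have sub := cycles_mono A le.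
have c0 := cardG_gt0 (cycle_group s A).
case: eqP => [->|ne]; first exact/leqif_refl.
suff lt : trunc_log 2 #|cycles s A| < trunc_log 2 #|cycles s' A|.
  by apply/leqifP; rewrite lt.
have prp : cycles s A \proper cycles s' A by rewrite properEneq sub andbT; apply/eqP.
have i1 : 1 < #|cycle_group s' A : cycle_group s A| by rewrite indexg_gt1; case/andP: prp.
have lag := Lagrange (sub : cycle_group s A \subset cycle_group s' A).
rewrite -trunc_logMp //; apply: leq_trunc_log.
by rewrite -lag mulnC leq_mul.
Qed.

Lemma potential_mono s s' : s <= s' -> potential s <= potential s'.
Proof. by move=> le; apply: leq_sum => A _; apply: trunc_log_cycles. Qed.

Lemma potential_eq s s' : s <= s' -> potential s = potential s' ->
  forall A, A \in V -> cycles s A = cycles s' A.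
Proof.
move=> le e A AV.
have := leqif_sum (fun A (_ : A \in V) => trunc_log_cycles A le).
move=> [_]; rewrite -/(potential s) -/(potential s') e eqxx => /esym/forall_inP/(_ A AV).
by move/eqP.
Qed.

Lemma potential_le s b : #|gT| <= 2 ^ b -> potential s <= #|V| * (2 * b).
Proof.
move=> gb; rewrite -sum_nat_const; apply: leq_sum => A _.
rewrite -(trunc_expnK (2 * b) (ltnSn 1)); apply: leq_trunc_log.
apply: leq_trans (max_card _) _.
by rewrite card_prod mulSn mul1n expnD leq_mul.
Qed.

(** Induction on the size of [U]. The context above a lowest occurrence of the root symbol [A] is a
    cycle, hence can be rebuilt with side trees of number at most [s]. The trees below avoid [A], so
    by induction they have number at most [s + #|U| - 1], and joining them costs one. *)
Lemma yields_stable s s' : s <= s' ->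
  (forall A, A \in V -> cycles s A = cycles s' A) ->
  forall (U : {set N}) A g, U \subset V -> yields U s' A g -> yields V (s + #|U|) A g.
Proof.
move=> le e U; move eU : #|U| => n; elim: n U eU => [|n IH] U eU A g UV y.
  by have := yields_in y; rewrite (cards0_eq eU) inE.
have AU := yields_in y; have AV := subsetP UV _ AU.
have [u [v [h [c r ->]]]] := yields_root y.
have cV : context V s A A u v.
  have : (u, v^-1) \in cycles s A.
    rewrite e // inE /= invgK; apply/asboolP.
    exact: context_mono c.
  by rewrite inE /= invgK => /asboolP.
apply: context_fill cV _; first by rewrite addnS ltnS leq_addr.
have cU : #|U :\ A| = n by move: (cardsD1 A U); rewrite AU eU; case.
have UAV : U :\ A \subset V by apply: subset_trans UV; apply: subD1set.
case: r => [r|[C [D [g1 [g2 [r y1 y2 ->]]]]]]; first exact: yields_term r.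
rewrite addnS; apply: yields_pair r _ _ => //.
  exact: IH UAV y1.
exact: IH UAV y2.
Qed.

(** The potential is sampled at the multiples of [#|V|.+1] and can increase at most [#|V| * (2 * b)]
    times; the last summand is the loss in [yields_stable]. *)
Definition strahler_bound (b : nat) : nat :=
  (#|V| * (2 * b)) * #|V|.+1 + #|V|.

Lemma yields_bound b s A g : #|gT| <= 2 ^ b -> yields V s A g ->
  yields V (strahler_bound b) A g.
Proof.
move=> gb; have [j jM e] := @stationary (potential : nat -> nat) (#|V| * (2 * b)) #|V|.+1
  potential_mono (fun s => potential_le s gb).
have le : j * #|V|.+1 <= j.+1 * #|V|.+1 by rewrite leq_mul2r leqnSn orbT.
have st := yields_stable le (potential_eq le e) (subxx V).
move: st; set t := (j * _)%N; have -> : (j.+1 * #|V|.+1 = (t + #|V|).+1)%N.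
  by rewrite mulSn /t; lia.
move=> st y; suff y' : yields V (t + #|V|) A g.
  by apply: yields_mono y' => //; rewrite /strahler_bound leq_add2r leq_mul2r jM orbT.
(* The window starting at [t] ends at [t + #|V| + 1], exactly the number reached by joining two
   trees of number [t + #|V|]; stability then brings the result back to [t + #|V|]. *)
elim: y => {s A g} [s A g AV r|s A C D g h AV r _ y1 _ y2|s A C D g h AV r _ y1 _ y2].
- exact: yields_term r.
- by apply: st; apply: yields_pair r y1 y2.
- by apply: st; apply: yields_pair r y1 y2.
Qed.

End Strahler.

(** * Strings as lists of goals *)

Lemma is_fieldE l : is_field l -> l = pre l ++ Hash :: nxt l /\ all isbit (pre l).
Proof.
move=> /eqP h; split; last first.
  by rewrite /pre /takew; elim: (l) => //= x l' IH; case: ifP => //= /negbFE ->.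
rewrite -{1}[l](cat_take_drop (find (predC isbit) l)) -/(takew _ _) -/(dropw _ _).
by rewrite /nxt; case: (dropw isbit l) h => //= x l' [->].
Qed.

Lemma pre_cat a x r : all isbit a -> ~~ isbit x -> pre (a ++ x :: r) = a.
Proof. exact: takew_cat. Qed.

Lemma nxt_cat a x r : all isbit a -> ~~ isbit x -> nxt (a ++ x :: r) = r.
Proof. by move=> ha hx; rewrite /nxt dropw_cat. Qed.

Lemma is_field_cat a r : all isbit a -> is_field (a ++ Hash :: r).
Proof. by move=> ha; rewrite /is_field dropw_cat. Qed.

Lemma lcp_split c s t : exists p,
  [/\ all c p, s = p ++ drop (lcp c s t) s & t = p ++ drop (lcp c s t) t].
Proof.
elim: s t => [|x s IH] [|y t] /=; try by exists [::]; rewrite ?drop0.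
case: ifP => [/andP[/eqP -> cy]|_]; last by exists [::].
by have [p [cp es et]] := IH t; exists (y :: p); rewrite /= cy -es -et.
Qed.

Lemma lcp_cat c p s t x y : all c p -> (x != y) || ~~ c x ->
  lcp c (p ++ x :: s) (p ++ y :: t) = size p.
Proof.
move=> + h; elim: p => [_|z p IH /andP[cz cp]] /=.
  by rewrite -negb_and -[_ == _]/(x == y) in h *; rewrite (negbTE h).
by rewrite eqxx cz IH.
Qed.

Lemma lcp_prefix s t : lcp predT s (s ++ t) = size s.
Proof. by elim: s => [|x s IH] /=; [case: t | rewrite eqxx IH]. Qed.

Lemma cat_sep (c : pred sym) a a' x x' r r' : all c a -> all c a' -> ~~ c x -> ~~ c x' ->
  a ++ x :: r = a' ++ x' :: r' -> [/\ a = a', x = x' & r = r'].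
Proof.
move=> + + nx nx'; elim: a a' => [|y a IH] [|y' a'] /=.
- by move=> _ _ [-> ->].
- by move=> _ /andP[cy _] [e _]; rewrite e cy in nx.
- by move=> /andP[cy _] _ [e _]; rewrite -e cy in nx'.
by move=> /andP[cy ca] /andP[_ ca'] [<- /(IH _ ca ca') [-> -> ->]].
Qed.

Lemma bsym_inj : injective bsym.
Proof. by do 2! case. Qed.

Lemma sbits_inj : injective sbits.
Proof. exact: inj_map bsym_inj. Qed.

Definition kind (x : sym) : bool := x \in [:: Prod; Term; Start].
Definition plain (x : sym) : bool := [|| isbit x | x == Hash].

Lemma plain_bits a : all isbit a -> all plain a.
Proof. by apply: sub_all => x; rewrite /plain => ->. Qed.

Definition record_shape (r : seq sym) : Prop :=
  exists k body, [/\ r = k :: body ++ [:: End], kind k & all plain body].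

(** A kind occurs only as the first symbol of a record and [End] only as the last. Hence an
    occurrence cannot begin inside a record, and one that begins with a record also ends with it. *)
Lemma infix_record (rs : seq (seq sym)) k body u v :
  (forall r, r \in rs -> record_shape r) -> kind k -> all plain body ->
  flatten rs = u ++ k :: body ++ End :: v -> k :: body ++ [:: End] \in rs.
Proof.
move=> + kk pb; have nk x : plain x -> ~~ kind x by case: x.
elim: rs u => [|r rs IH] u sh; first by case: u.
have [k0 [body0 [re kk0 pb0]]] := sh r (mem_head _ _).
have sh' r' : r' \in rs -> record_shape r'.
  by move=> h; apply: sh; rewrite inE h orbT.
rewrite /= {1}re; case: u => [|x u] /=.
  rewrite -catA /= => -[<- e].
  have [<- _ _] := @cat_sep plain _ _ End End _ _ pb0 pb isT isT e.
  by rewrite -re mem_head.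
rewrite -catA /= => -[_ e].
suff [u' e'] : exists u', flatten rs = u' ++ k :: body ++ End :: v.
  by rewrite inE (IH u' sh' e') orbT.
elim: body0 u pb0 e {re} => [|y body0 IHb] [|z u] /=.
- by move=> _ [e _]; rewrite -e in kk.
- by move=> _ [_ e]; exists u.
- by move=> /andP[py _] [e _]; rewrite -e in kk; have := nk _ py; rewrite kk.
by move=> /andP[_ pb0] [_ e]; apply: IHb pb0 e.
Qed.

(** * Codes of rules and names of group elements *)

Section Strings.

Variables (B : black_box) (X : cnf_grammar (bb_group B)).
Variables (nt : cfg_nonterm X -> seq bool).
Variable s : seq (production (cfg_nonterm X) (word (bb_b B))).
Hypothesis nt_inj : injective nt.
Hypothesis sP : [seq decode_production r | r <- s] = [seq Some r | r <- cfg_prods X].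

Let b := bb_b B.
Let gT := bb_group B.
Let W := rev (grammar_code nt (cfg_start X) s).

Definition records : seq (seq sym) :=
  (Start :: sbits (nt (cfg_start X)) ++ [:: End]) :: [seq rule_code nt r | r <- s].

Lemma W_records : W = rev (flatten records).
Proof. by []. Qed.

Lemma records_shape r : r \in records -> record_shape r.
Proof.
rewrite inE => /orP[/eqP ->|/mapP[[A [[C D]|x]] _ ->]].
- by exists Start, (sbits (nt (cfg_start X))); split=> //; apply: plain_bits; apply: all_sbits.
- exists Prod, (sbits (nt A) ++ Hash :: sbits (nt C) ++ Hash :: sbits (nt D)); split=> //.
    by rewrite /rule_code /= -!catA /= -!catA.
  by rewrite !all_cat /= ?all_cat /= !plain_bits ?all_sbits.
exists Term, (sbits (nt A) ++ Hash :: sbits x); split=> //.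
  by rewrite /rule_code /= -!catA.
by rewrite !all_cat /= ?all_cat /= !plain_bits ?all_sbits.
Qed.

(* The oracle pads or truncates a name of the wrong length, as may be guessed. *)
Definition element (a : seq sym) : option gT := bb_f (read_word 0 b a).

Lemma read_word_sbits n (x : word n) r : read_word 0 n (sbits x ++ r) = x.
Proof.
apply: eq_from_tnth => i; rewrite tnth_mktuple nth_cat size_map size_tuple ltn_ord.
rewrite add0n (nth_map false) ?size_tuple ?ltn_ord // (tnth_nth false).
by case: nth.
Qed.

Lemma read_word_skip n k (x : word n) r : read_word n k (sbits x ++ r) = read_word 0 k r.
Proof.
apply: eq_from_tnth => i; rewrite !tnth_mktuple nth_cat size_map size_tuple.
by rewrite ltnNge leq_addr /= addKn.
Qed.

Lemma element_sbits (x : word b) : element (sbits x) = bb_f x.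
Proof. by rewrite /element -[sbits x]cats0 read_word_sbits. Qed.

(** Stronger than [element]: the length is exactly [b], as for the replies to [QInv] and [QProd].
    The first factor of a product query needs this for the second to be read at the right place; the
    second may be a guessed string of any length. *)
Definition names (q : seq sym) (g : gT) : Prop := exists2 x : word b, q = sbits x & bb_f x = Some g.

Lemma names_inv a g : element a = Some g -> names (sreply B QInv a) (g^-1)%g.
Proof. by move=> h; exists (bb_inv (read_word 0 b a)) => //; apply: bb_invP. Qed.

Lemma names_prod q a g h : names q g -> element a = Some h ->
  names (sreply B QProd (q ++ a)) (g * h)%g.
Proof.
move=> [x -> fx] fa; exists (bb_prod x (read_word 0 b a)).
  by rewrite /sreply /= -/b read_word_sbits read_word_skip.
exact: bb_prodP.
Qed.

Lemma names_element q g : names q g -> element q = Some g.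
Proof. by move=> [x -> fx]; rewrite element_sbits. Qed.

Lemma id_sound q g y : names q g ->
  ohead (sreply B QId (q ++ y)) = Some One -> g = 1%g.
Proof.
move=> [x -> fx]; rewrite /sreply /= -/b read_word_sbits read_word_skip.
move=> h; apply/(bb_idP fx); exists (read_word 0 (bb_c B) y).
by move: h; case: bb_id.
Qed.

Lemma id_complete q : names q 1%g ->
  exists y : word (bb_c B), forall r, ohead (sreply B QId (q ++ sbits y ++ r)) = Some One.
Proof.
move=> [x -> fx]; have [y hy] := (bb_idP fx).1 erefl; exists y => r.
by rewrite /sreply /= -/b read_word_sbits read_word_skip read_word_sbits hy.
Qed.

Lemma valid_element a : (ohead (sreply B QValid a) == Some One) = isSome (element a).
Proof. by rewrite /sreply /= bb_validP /element; case: bb_f. Qed.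

Lemma rule_prod r : r \in s -> exists2 r', decode_production r = Some r' & r' \in cfg_prods X.
Proof.
move=> rs; have : decode_production r \in [seq Some r | r <- cfg_prods X].
  by rewrite -sP map_f.
by move=> /mapP[r' hr' e]; exists r'.
Qed.

Lemma prod_rule r' : r' \in cfg_prods X -> exists2 r, r \in s & decode_production r = Some r'.
Proof.
move=> hr; have : Some r' \in [seq decode_production r | r <- s].
  by rewrite sP map_f.
by move=> /mapP[r rs e]; exists r.
Qed.

Lemma term_record A x : all isbit A -> all isbit x ->
  Term :: A ++ Hash :: x ++ [:: End] \in records ->
  exists a g, [/\ A = sbits (nt a), element x = Some g & (a, inr g) \in cfg_prods X].
Proof.
move=> hA hx; rewrite inE => /orP[//|/mapP[[a [[c d]|w]] rs] //].
rewrite /rule_code /= => -[e].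
have [-> _ {}e] := @cat_sep isbit _ _ Hash Hash _ _ hA (all_sbits _) isT isT e.
have [-> _ _] := @cat_sep isbit _ _ End End _ _ hx (all_sbits _) isT isT e.
have [[a' r']] := rule_prod rs; rewrite /decode_production /=.
case fw : (bb_f w) => [g|] //= [<- <-] hp.
by exists a, g; rewrite element_sbits.
Qed.

Lemma prod_record A C D : all isbit A -> all isbit C -> all isbit D ->
  Prod :: A ++ Hash :: C ++ Hash :: D ++ [:: End] \in records ->
  exists a c d, [/\ A = sbits (nt a), C = sbits (nt c), D = sbits (nt d) &
    (a, inl (c, d)) \in cfg_prods X].
Proof.
move=> hA hC hD; rewrite inE => /orP[//|/mapP[[a [[c d]|w]] rs] //].
rewrite /rule_code /= => -[e].
have [-> _ {}e] := @cat_sep isbit _ _ Hash Hash _ _ hA (all_sbits _) isT isT e.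
have [-> _ {}e] := @cat_sep isbit _ _ Hash Hash _ _ hC (all_sbits _) isT isT e.
have [-> _ _] := @cat_sep isbit _ _ End End _ _ hD (all_sbits _) isT isT e.
have [[a' r']] := rule_prod rs; rewrite /decode_production /= => -[<- <-] hp.
by exists a, c, d.
Qed.

Lemma start_record A : all isbit A ->
  Start :: A ++ [:: End] \in records -> A = sbits (nt (cfg_start X)).
Proof.
move=> hA; rewrite inE => /orP[/eqP[e]|/mapP[[a [[c d]|w]] rs] //].
by have [-> _ _] := @cat_sep isbit _ _ End End _ _ hA (all_sbits _) isT isT e.
Qed.

(** * Soundness of reduction steps *)

Notation derives := (fun A g => exists n, yields (cfg_prods X) setT n A g).

(** Nothing is asked of the part after [Bar], and an element may be written by any bit string that
    the oracle reads as one of its names, since guessed strings satisfy no more than that. *)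
Inductive good : seq sym -> Prop :=
  | good_nil c : good (Bar :: c)
  | good_start l : derives (cfg_start X) 1%g -> good l -> good (Start :: l)
  | good_item a (h : seq sym) g l : all isbit h -> element h = Some g -> derives a g ->
      good l -> good (sbits (nt a) ++ Hash :: h ++ Hash :: l).

Lemma good_field l : good l -> is_field l -> exists a g,
  [/\ pre l = sbits (nt a), element (pre (nxt l)) = Some g, derives a g & good (nxt (nxt l))].
Proof.
case=> // a h g l' hh eh da gl _; exists a, g.
by rewrite pre_cat ?all_sbits // nxt_cat ?all_sbits // pre_cat // nxt_cat.
Qed.

Lemma cat_bar q l p c : Bar \notin q -> q ++ l = p ++ Bar :: c ->
  exists2 p', p = q ++ p' & l = p' ++ Bar :: c.
Proof.
elim: q p => [|x q IH] [|y p] /=; try by move=> _ ->; exists [::].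
- by move=> _ ->; exists (y :: p).
- by rewrite inE => /norP[/eqP nx _] [e _]; rewrite e in nx.
by rewrite inE => /norP[_ nq] [<- /(IH _ nq) [p' -> ->]]; exists p'.
Qed.

Lemma bar_bits a : all isbit a -> Bar \notin a.
Proof. by move=> ha; apply/negP=> /(allP ha). Qed.

Lemma good_swap p c c' : good (p ++ Bar :: c) -> good (p ++ Bar :: c').
Proof.
move: {-2}(p ++ Bar :: c) (erefl (p ++ Bar :: c)) => l e gl.
elim: gl p e => {l} [c1|l d gl IH|a h g l hh eh da gl IH] p e.
- by case: p e => [_|x p [<- _]]; apply: good_nil.
- by case: p e => [|x p] [// <- e]; apply: good_start => //; apply: IH.
have [||p' -> e'] := @cat_bar (sbits (nt a) ++ Hash :: h ++ [:: Hash]) l p c.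
- by rewrite !(mem_cat, inE) !(negbTE (bar_bits _)) ?all_sbits.
- by rewrite -catA /= -catA.
by rewrite -!catA /= -!catA /=; apply: good_item eh da _ => //; apply: IH.
Qed.

Lemma tail_sound is_t X' Y' T Q G V F : tail_ok B W is_t X' Y' T Q G V F ->
  exists p cX cY y, [/\ X' = p ++ Bar :: cX, Y' = p ++ Bar :: cY,
    F = [::], (is_t -> is_field cY) &
    let x := pre cY in
    let T' := if is_t then End :: rev x ++ T else T in
    let Q' := if is_t then rev (sreply B QInv x) else Q in
    [/\ exists u v, W = u ++ T' ++ v, element (rev V) &
        ohead (sreply B QId (sreply B QProd (rev Q' ++ rev G) ++ y)) = Some One]].
Proof.
rewrite /tail_ok; set m := lcp _ Y' X'; set Y2 := behead (drop m Y').
set Y3 := if is_t then nxt Y2 else Y2; set T' := if is_t then End :: _ else T.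
set W1 := drop _ W.
case/and5P=> hT; rewrite valid_element => hV /eqP hI _ /and3P[hF /andP[hX hY] /eqP ->].
have [p [_ eY eX]] := lcp_split (predC1 Bar) Y' X'; rewrite -/m in eX eY.
have headE l : ohead l == Some Bar -> l = Bar :: behead l by case: l => //= x l /eqP[->].
exists p, (behead (drop m X')), Y2, (pre Y3); split=> //.
- by rewrite {1}eX {1}(headE _ hX).
- by rewrite {1}eY {1}(headE _ hY).
- by case: (is_t) hF.
split=> //; have [u [_ e1 e2]] := lcp_split predT (nxt Y3) W.
have [t [_ f1 f2]] := lcp_split predT T' W1.
rewrite (eqP hT) cats0 in f1; exists u, (drop (lcp predT T' W1) W1).
by rewrite {1}e2 -/W1 {1}f2 -f1.
Qed.

Lemma W_infix u k body v : kind k -> all plain body ->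
  W = u ++ (End :: rev body ++ [:: k]) ++ v -> k :: body ++ [:: End] \in records.
Proof.
move=> kk pb e; apply: (@infix_record records k body (rev v) (rev u)) => //.
  exact: records_shape.
rewrite -[LHS]revK -W_records e !rev_cat rev_cons rev_cat revK /=.
by rewrite -catA /= cat_rcons.
Qed.

(** Soundness runs backwards from the end string. The names in the goals of [Y'] are then already
    known to denote elements, so for an item removed from [X'] it suffices to test its own name with
    [valid]; its value is fixed by the product that [id] certifies to be 1. *)
Lemma leaf_sound X' Y' : leaf_ok B W X' Y' -> good (behead Y') -> good (behead X').
Proof.
rewrite /leaf_ok; set X1 := behead X'; set Y1 := behead Y'.
case: eqP => [e _ _|_ /=]; first by case: (X1) e => //= x l [->]; apply: good_nil.
case: ifP => _.
  rewrite /term_ok; cbv zeta => /tail_sound ok gY.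
  have [p [cX [cY [y [eX eY]]]]] := ok.
  move=> /eqP; rewrite flag_nil -[flag _]cats0 flag_nil andbT.
  move=> /andP[/is_fieldE[X2E hg] /is_fieldE[X1E hA]] /(_ isT)/is_fieldE[_ hx] [[u [v eW]] hV hI].
  have /(term_record hA hx) [a [g [Aa xg hp]]] :
      Term :: pre X1 ++ Hash :: pre cY ++ [:: End] \in records.
    have := @W_infix u Term (pre X1 ++ Hash :: pre cY) v isT.
    rewrite -catA; apply; first by rewrite all_cat /= !plain_bits.
    by rewrite eW rev_cat rev_cons -!cats1 /= -!catA /= -!catA.
  rewrite X1E X2E Aa; move: hV hI; rewrite !revK.
  case eg : (element _) => [g'|] // _ hI.
  have /(id_sound) /(_ hI) ge := names_prod (names_inv xg) eg.
  apply: good_item eg _ _ => //.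
    exists 0; apply: yields_term; rewrite ?inE //.
    by have -> : g' = g by rewrite -[g]mulg1 -ge mulKVg.
  by rewrite eX; apply: (@good_swap p cY); rewrite -eY.
case: ifP => _.
  rewrite /start_ok; cbv zeta => /tail_sound ok gY.
  have [p [cX [cY [y [eX eY]]]]] := ok.
  move=> /eqP; rewrite !flag_nil -[flag _]cats0 flag_nil andbT.
  move=> /and3P[Y2f Y1f /eqP X1s] _ [[u [v eW]] hV hI].
  have [a [g [Aa hg da gY3]]] := good_field gY Y1f.
  have hA : all isbit (pre Y1) by rewrite Aa all_sbits.
  have /(start_record hA) e : Start :: pre Y1 ++ [:: End] \in records.
    by apply: (@W_infix u Start (pre Y1) v isT) => //; apply: plain_bits.
  have aS : a = cfg_start X by apply: nt_inj; apply: sbits_inj; rewrite -Aa.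
  have ni := names_inv hg; have nii := names_prod ni (names_element ni).
  move: hI; rewrite !revK => /(id_sound (names_prod nii hg)).
  rewrite -mulgA mulVg mulg1 => /(congr1 invg); rewrite invgK invg1 => g1.
  have -> : X1 = Start :: behead X1 by case: (X1) X1s => //= x l [->].
  apply: good_start; first by rewrite -aS -g1.
  by rewrite eX; apply: (@good_swap p cY); rewrite -eY.
rewrite /prod_ok; set sw := _ != _; cbv zeta.
case: sw => /tail_sound ok gY.
all: have [p [cX [cY [y [eX eY]]]]] := ok.
all: move=> /eqP; rewrite !flag_nil -[flag _]cats0 flag_nil andbT.
all: move=> /and5P[/is_fieldE[X2E hg] /is_fieldE[X1E hA] Y4f Y3f /andP[Y2f Y1f]].
all: move=> _ [[u [v eW]] hV hI].
all: have [a1 [g1 [C1 e1 d1 gY1]]] := good_field gY Y1f.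
all: have [a2 [g2 [C2 e2 d2 gY2]]] := good_field gY1 Y3f.
all: move: hV hI; rewrite !revK.
all: case eg : (element _) => [g|] // _ hI.
- have /(prod_record hA) : Prod :: pre X1 ++ Hash :: pre (nxt (nxt Y1)) ++ Hash :: pre Y1 ++ [:: End] \in records.
    have := @W_infix u Prod (pre X1 ++ Hash :: pre (nxt (nxt Y1)) ++ Hash :: pre Y1) v isT.
    rewrite -!catA /= -!catA; apply.
      by rewrite !all_cat /= !all_cat /= !plain_bits // ?C1 ?C2 all_sbits.
    by rewrite eW !(rev_cat, rev_cons) -!cats1 /= -?catA /= -?catA /= -?catA.
  rewrite C1 C2 => /(_ (all_sbits _) (all_sbits _)) [a [c [d [Aa /sbits_inj/nt_inj <- /sbits_inj/nt_inj <- hp]]]].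
  have /id_sound /(_ hI) ge := names_prod (names_prod (names_inv e1) (names_element (names_inv e2))) eg.
  rewrite X1E X2E Aa; apply: good_item eg _ _ => //.
    have -> : g = (g2 * g1)%g by rewrite -[RHS]mulg1 -ge -invMg mulKVg.
    have [n1 y1] := d1; have [n2 y2] := d2; exists (maxn n1 n2).+1.
    by apply: yields_pair hp _ _; rewrite ?inE //; [apply: yields_mono y2 | apply: yields_mono y1];
      rewrite ?leq_maxl ?leq_maxr.
  by rewrite eX; apply: (@good_swap p cY); rewrite -eY.
have /(prod_record hA) : Prod :: pre X1 ++ Hash :: pre Y1 ++ Hash :: pre (nxt (nxt Y1)) ++ [:: End] \in records.
  have := @W_infix u Prod (pre X1 ++ Hash :: pre Y1 ++ Hash :: pre (nxt (nxt Y1))) v isT.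
  rewrite -!catA /= -!catA; apply.
    by rewrite !all_cat /= !all_cat /= !plain_bits // ?C1 ?C2 all_sbits.
  by rewrite eW !(rev_cat, rev_cons) -!cats1 /= -?catA /= -?catA /= -?catA.
rewrite C1 C2 => /(_ (all_sbits _) (all_sbits _)) [a [c [d [Aa /sbits_inj/nt_inj <- /sbits_inj/nt_inj <- hp]]]].
have /id_sound /(_ hI) ge := names_prod (names_prod (names_inv e2) (names_element (names_inv e1))) eg.
rewrite X1E X2E Aa; apply: good_item eg _ _ => //.
  have -> : g = (g1 * g2)%g by rewrite -[RHS]mulg1 -ge -invMg mulKVg.
  have [n1 y1] := d1; have [n2 y2] := d2; exists (maxn n1 n2).+1.
  by apply: yields_pair hp _ _; rewrite ?inE //; [apply: yields_mono y1 | apply: yields_mono y2];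
    rewrite ?leq_maxl ?leq_maxr.
by rewrite eX; apply: (@good_swap p cY); rewrite -eY.
Qed.

Lemma reach_sound P d X' Y' : reach P (leaf_ok B W) d X' Y' ->
  good (behead Y') -> good (behead X').
Proof.
elim: d X' Y' => [|d IH] X' Y' /=; first exact: leaf_sound.
by move=> [Z [_ /IH h1 /IH h2]] /h2/h1.
Qed.

(** * Completeness of reduction steps *)

Definition name (g : gT) : word b := sval (cid (bb_f_onto g)).

Lemma nameE g : bb_f (name g) = Some g.
Proof. by rewrite /name; case: cid. Qed.

Definition item (p : cfg_nonterm X * gT) : seq sym :=
  sbits (nt p.1) ++ Hash :: sbits (name p.2) ++ [:: Hash].

Definition items (v : seq (cfg_nonterm X * gT)) : seq sym := flatten (map item v).

Lemma items_bar v : Bar \notin items v.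
Proof.
elim: v => //= p v IH; rewrite mem_cat negb_or IH andbT.
by rewrite /item !(mem_cat, inE) !(negbTE (bar_bits _)) ?all_sbits.
Qed.

(** After [U] the code continues with [End], the head of [T'], where the certificate has [Bar]. This
    mismatch makes the common prefix exactly [U]. *)
Lemma tail_complete is_t p cX x y U j T Q G V T'' v :
  Bar \notin p -> all isbit x -> all isbit y ->
  let T' := if is_t then End :: rev x ++ T else T in
  let Q' := if is_t then rev (sreply B QInv x) else Q in
  T' = End :: T'' -> W = U ++ T' ++ v -> element (rev V) ->
  ohead (sreply B QId (sreply B QProd (rev Q' ++ rev G) ++ y)) = Some One ->
  tail_ok B W is_t (p ++ Bar :: cX)
    (p ++ Bar :: (if is_t then x ++ [:: Hash] else [::]) ++ y ++ Hash :: U ++ Bar :: j)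
    T Q G V [::].
Proof.
move=> np hx hy T' Q' eT eW hV hI; rewrite /tail_ok.
have cp : all (predC1 Bar) p.
  by apply/allP=> z zp /=; apply/eqP=> zB; rewrite -zB zp in np.
rewrite lcp_cat // ?orbT // !drop_size_cat // [behead _]/=.
set rest := y ++ Hash :: _.
have -> : (if is_t then nxt ((if is_t then x ++ [:: Hash] else [::]) ++ rest)
           else (if is_t then x ++ [:: Hash] else [::]) ++ rest) = rest.
  by case: (is_t) => //; rewrite -catA /= nxt_cat.
have -> : is_t ==> is_field ((if is_t then x ++ [:: Hash] else [::]) ++ rest).
  by case: (is_t) => //; rewrite -catA /= is_field_cat.
have pE : is_t -> pre ((if is_t then x ++ [:: Hash] else [::]) ++ rest) = x.
  by case: (is_t) => // _; rewrite -catA /= pre_cat.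
have -> : (if is_t then End :: rev (pre ((if is_t then x ++ [:: Hash] else [::]) ++ rest)) ++ T
           else T) = T' by rewrite /T'; case: (is_t) pE => // ->.
have -> : (if is_t then rev (sreply B QInv (pre ((if is_t then x ++ [:: Hash] else [::]) ++ rest)))
           else Q) = Q' by rewrite /Q'; case: (is_t) pE => // ->.
rewrite /rest pre_cat // nxt_cat // is_field_cat // hI !eqxx valid_element hV !andbT.
rewrite eW {2}eT lcp_cat //; last exact: all_predT.
by rewrite drop_size_cat // lcp_prefix drop_size.
Qed.

Variable P : nat.

Notation wf := (wf P).
Notation ok := (leaf_ok B W).

Definition encodes (Z : seq sym) (v : seq (cfg_nonterm X * gT)) : Prop :=
  wf Z /\ exists x c, Z = x :: items v ++ Bar :: c.

(** Room for the goals, a terminal, a witness for [id], the skipped code, and five marks: the kind,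
    two [Bar] and two [Hash]. *)
Definition fits (v : seq (cfg_nonterm X * gT)) : Prop :=
  size (items v) + b + bb_c B + size W + 5 <= P.

Lemma digit_bits a : all isbit a -> all digit a.
Proof. by apply: sub_all; case. Qed.

Lemma digit_items v : all digit (items v).
Proof.
elim: v => //= p v IH; rewrite all_cat IH andbT /item !all_cat /= all_cat /=.
by rewrite !digit_bits ?all_sbits.
Qed.

Lemma digit_W : all digit W.
Proof.
apply/allP=> z; rewrite W_records mem_rev => /flattenP[r rr zr].
have [k [body [e kk pb]]] := records_shape rr; move: zr; rewrite e inE mem_cat inE.
case/or3P=> [/eqP ->|/(allP pb)|/eqP -> //]; first by case: (k) kk.
by case: (z).
Qed.

Lemma encodes_pad k v t : digit k -> all digit t -> size (items v) + size t + 2 <= P ->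
  exists j, encodes (k :: items v ++ Bar :: t ++ j) v.
Proof.
move=> dk dt le; exists (nseq (P - (size (items v) + size t + 2)) Zero); split; last first.
  by exists k, (t ++ nseq (P - (size (items v) + size t + 2)) Zero).
rewrite /wf /= size_cat /= size_cat size_nseq dk all_cat digit_items /= all_cat dt.
by rewrite all_nseq orbT !andbT /=; lia.
Qed.

Lemma record_W k body : k :: body ++ [:: End] \in records ->
  exists U v, W = U ++ (End :: rev body ++ [:: k]) ++ v.
Proof.
move=> h; have [r1 [r2 e]] : exists r1 r2, records = r1 ++ (k :: body ++ [:: End]) :: r2.
  by case/splitPr: h => r1 r2; exists r1, r2.
exists (rev (flatten r2)), (rev (flatten r1)).
rewrite W_records e flatten_cat /= !(rev_cat, rev_cons) /= -!cats1.
by rewrite -!catA /= -?catA.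
Qed.

Lemma encodes_cons Z A g v : encodes Z ((A, g) :: v) -> exists x c,
  Z = x :: sbits (nt A) ++ Hash :: sbits (name g) ++ Hash :: items v ++ Bar :: c.
Proof.
move=> [_ [x [c ->]]]; exists x, c.
by rewrite /items /= /item -!catA /= -!catA.
Qed.

Lemma ok_unfold X' Y' : ok X' Y' = [|| ohead (behead X') == Some Bar |
      if ohead Y' == Some Term then term_ok B W (behead X') (behead Y')
      else if ohead Y' == Some Start then start_ok B W (behead X') (behead Y')
      else prod_ok B W (behead X') (behead Y') (ohead Y' != Some Zero)].
Proof. by []. Qed.

Lemma field_sbits x r :
  (pre (sbits x ++ Hash :: r) = sbits x) * (nxt (sbits x ++ Hash :: r) = r) *
  (is_field (sbits x ++ Hash :: r) = true).
Proof. by rewrite pre_cat ?nxt_cat ?is_field_cat ?all_sbits. Qed.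

Lemma step_term Z A g v : (A, inr g) \in cfg_prods X -> encodes Z ((A, g) :: v) ->
  fits v -> exists2 Z', encodes Z' v & ok Z Z'.
Proof.
move=> hp eZ le; have [[a [//|x]] rs] := prod_rule hp.
rewrite /decode_production /=; case fx : (bb_f x) => [g'|] //= [eA eg]; rewrite {}eA {}eg {a g'} in rs fx.
have ni : names (sreply B QInv (sbits x)) (g^-1)%g by apply: names_inv; rewrite element_sbits.
have eg : element (sbits (name g)) = Some g by rewrite element_sbits nameE.
have := names_prod ni eg; rewrite mulVg => /id_complete[y hy].
have [U [w eW]] : exists U v, W = U ++ (End :: rev (sbits (nt A) ++ Hash :: sbits x) ++ [:: Term]) ++ v.
  by apply: record_W; rewrite inE -catA; apply/orP; right; apply/mapP; exists (A, inr x).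
have sU : size U <= size W by rewrite eW size_cat leq_addr.
have dU : all digit U by move: digit_W; rewrite eW all_cat => /andP[].
pose t := (sbits x ++ [:: Hash]) ++ sbits y ++ Hash :: U ++ [:: Bar].
have [||j [wZ' eZ']] := @encodes_pad Term v t isT.
- by rewrite /t !all_cat /= !all_cat /= dU !digit_bits ?all_sbits.
- by move: le; rewrite /fits /t !size_cat /= !size_cat /= !size_map !size_tuple -/b; lia.
exists (Term :: items v ++ Bar :: t ++ j); first by split.
have [x0 [c ->]] := encodes_cons eZ.
rewrite ok_unfold /=; apply/orP; right.
rewrite /term_ok !field_sbits.
rewrite /t -!catA /= -!catA /=.
have := @tail_complete true (items v) c (sbits x) (sbits y) U j
  (Hash :: rev (sbits (nt A)) ++ [:: Term]) [::] (rev (sbits (name g))) (rev (sbits (name g)))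
  (rev (sbits x) ++ Hash :: rev (sbits (nt A)) ++ [:: Term]) w (items_bar v)
  (all_sbits x) (all_sbits y) erefl.
rewrite -catA /= !revK eg => h; apply: h => //.
- by rewrite eW rev_cat rev_cons -cats1 -!catA /= -?catA /= -?catA.
- by have := hy [::]; rewrite cats0 /=.
Qed.

Lemma element_name g : element (sbits (name g)) = Some g.
Proof. by rewrite element_sbits nameE. Qed.

Lemma names_name_inv g : names (sreply B QInv (sbits (name g))) (g^-1)%g.
Proof. by apply: names_inv; rewrite element_name. Qed.

Lemma certificate k v body (y : word (bb_c B)) :
  k :: body ++ [:: End] \in records -> fits v ->
  exists U w, W = U ++ (End :: rev body ++ [:: k]) ++ w /\
   forall z, digit z -> exists j,
     encodes (z :: items v ++ Bar :: (sbits y ++ Hash :: U ++ Bar :: j)) v.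
Proof.
move=> /record_W [U [w eW]] le; exists U, w; split=> // z dz.
have sU : size U <= size W by rewrite eW size_cat leq_addr.
have dU : all digit U by move: digit_W; rewrite eW all_cat => /andP[].
have [||j ej] := @encodes_pad z v (sbits y ++ Hash :: U ++ [:: Bar]) dz.
- by rewrite !all_cat /= all_cat dU digit_bits ?all_sbits.
- by move: le; rewrite /fits !size_cat /= size_cat size_map size_tuple /=; lia.
by exists j; move: ej; rewrite -catA /= -catA.
Qed.

Lemma step_prod Z A C D g h v (sw : bool)
    (v' := if sw then [:: (D, h), (C, g) & v] else [:: (C, g), (D, h) & v]) :
  (A, inl (C, D)) \in cfg_prods X ->
  encodes Z ((A, (g * h)%g) :: v) -> fits v' -> exists2 Z', encodes Z' v' & ok Z Z'.
Proof.
move=> hp eZ le; have [[a [[c d]|//]] rs] := prod_rule hp; rewrite /decode_production /=;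
  last by case: bb_f.
move=> [eA eC eD]; rewrite {}eA {}eC {}eD {a c d} in rs.
have nr := names_prod (names_prod (names_name_inv h) (names_element (names_name_inv g)))
  (element_name (g * h)%g).
rewrite -invMg mulVg in nr; have [y hy] := id_complete nr.
have hr : Prod :: (sbits (nt A) ++ Hash :: sbits (nt C) ++ Hash :: sbits (nt D)) ++ [:: End]
    \in records.
  rewrite inE -catA /= -catA; apply/mapP.
  by exists (A, inl (C, D)).
have [U [w [eW hj]]] := certificate y hr le.
have [|j eZ'] := hj (if sw then One else Zero); first by case: (sw).
exists ((if sw then One else Zero) :: items v' ++ Bar :: sbits y ++ Hash :: U ++ Bar :: j) => //.
have [x0 [c ->]] := encodes_cons eZ; rewrite ok_unfold; apply/orP; right.
have := @tail_complete false (items v) c [::] (sbits y) U j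
  (End :: rev (sbits (nt D)) ++ Hash :: rev (sbits (nt C)) ++ Hash :: rev (sbits (nt A)) ++ [:: Prod])
  (rev (sreply B QProd (sreply B QInv (sbits (name h)) ++ sreply B QInv (sbits (name g)))))
  (rev (sbits (name (g * h)%g))) (rev (sbits (name (g * h)%g)))
  (rev (sbits (nt D)) ++ Hash :: rev (sbits (nt C)) ++ Hash :: rev (sbits (nt A)) ++ [:: Prod])
  w (items_bar v) isT (all_sbits y) erefl.
rewrite /= !revK element_name => hc.
have {}hc := hc _ isT.
have eW' : W = U ++ End :: (rev (sbits (nt D)) ++ Hash :: rev (sbits (nt C)) ++ Hash ::
    rev (sbits (nt A)) ++ [:: Prod]) ++ w.
  by rewrite eW !(rev_cat, rev_cons) -!cats1 /= -?catA /= -?catA /= -?catA.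
move: (hc eW') => {}hc; have := hy [::]; rewrite cats0 => /= hy'.
rewrite /v'; case: (sw) => /=; rewrite /prod_ok /items /= /item /= -?catA /= -?catA /= -?catA /=.
  rewrite !field_sbits; exact: hc.
rewrite !field_sbits; exact: hc.
Qed.

Lemma step_start : 3 <= P -> fits [:: (cfg_start X, 1%g)] ->
  exists2 Z', encodes Z' [:: (cfg_start X, 1%g)] & ok (start_string P) Z'.
Proof.
move=> P3 le.
have ni := names_name_inv 1%g.
have nr := names_prod (names_prod ni (names_element ni)) (element_name 1%g).
rewrite !invg1 !mulg1 in nr; have [y hy] := id_complete nr.
have hr : Start :: sbits (nt (cfg_start X)) ++ [:: End] \in records by apply: mem_head.
have [U [w [eW hj]]] := certificate y hr le.
have [j eZ'] := hj Start isT.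
exists (Start :: items [:: (cfg_start X, 1%g)] ++ Bar :: sbits y ++ Hash :: U ++ Bar :: j) => //.
rewrite ok_unfold; apply/orP; right.
have := @tail_complete false [::] (nseq (P - 3) Zero) [::] (sbits y) U j
  (End :: rev (sbits (nt (cfg_start X))) ++ [:: Start])
  (rev (sreply B QProd (sreply B QInv (sbits (name 1%g)) ++ sreply B QInv (sbits (name 1%g)))))
  (rev (sbits (name 1%g))) (rev (sbits (name 1%g)))
  (rev (sbits (nt (cfg_start X))) ++ [:: Start]) w isT isT (all_sbits y) erefl.
rewrite /= !revK element_name => /(_ eW isT) hc.
have := hy [::]; rewrite cats0 => /= hy'.
rewrite /start_ok /start_string /items /= /item /= -?catA /= -?catA /=.
rewrite !field_sbits; exact: hc.
Qed.

(** * Paths between strings of goals *)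

Definition arrow (Z Z' : seq sym) : bool := [&& wf Z, wf Z' & ok Z Z'].

Definition leads (Z Z' : seq sym) : Prop := exists2 p, path arrow Z p & last Z p = Z'.

Lemma leads_trans Z1 Z2 Z3 : leads Z1 Z2 -> leads Z2 Z3 -> leads Z1 Z3.
Proof.
move=> [p h1 e1] [q h2 e2]; exists (p ++ q); first by rewrite cat_path h1 e1.
by rewrite last_cat e1.
Qed.

Lemma leads_step Z Z' : wf Z -> wf Z' -> ok Z Z' -> leads Z Z'.
Proof. by move=> h h' o; exists [:: Z'] => //=; rewrite /arrow h h' o. Qed.

Section Chain.

Variables (V : {set cfg_nonterm X}) (m n : nat).
Hypothesis ntV : forall A, A \in V -> size (nt A) <= n.
Hypothesis fitP : m * (n + b + 2) + b + bb_c B + size W + 5 <= P.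

Lemma fits_size (v : seq (cfg_nonterm X * gT)) : all (fun p => p.1 \in V) v ->
  size v <= m -> fits v.
Proof.
move=> vV vm; apply: leq_trans fitP; rewrite !leq_add2r.
apply: leq_trans (_ : size v * (n + b + 2) <= _); last by rewrite leq_mul2r vm orbT.
elim: v vV {vm} => //= p v IH /andP[/ntV pn /IH]; rewrite size_cat mulSn => h.
by rewrite leq_add // /item size_cat /= size_cat /= !size_map size_tuple -/b; lia.
Qed.

(** The invariant bounds the number of waiting goals plus the Strahler number of the current one.
    While the subtree of smaller number is expanded the other goal waits, so one term grows by one
    as the other drops by one. *)
Lemma yields_leads k A g : yields (cfg_prods X) V k A g -> forall v Z,
  all (fun p => p.1 \in V) v -> size v + k < m -> encodes Z ((A, g) :: v) ->
  exists2 Z', encodes Z' v & leads Z Z'.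
Proof.
elim=> {k A g} [k A g AV r|k A C D g h AV r yC IHC yD IHD|k A C D g h AV r yC IHC yD IHD] v Z vV vm eZ.
- have [|Z' eZ' o] := step_term r eZ; first by apply: fits_size => //; apply: leq_trans (ltnW vm); apply: leq_addr.
  by exists Z' => //; apply: leads_step o; [case: eZ | case: eZ'].
- have CV := yields_in yC; have DV := yields_in yD.
  have [|Z1 e1 o1] := @step_prod Z A C D g h v true r eZ.
    by apply: fits_size; rewrite /= ?CV ?DV //; apply: leq_trans vm; rewrite -addn2 -addnS leq_add2l.
  have [||Z2 e2 l2] := IHD ((C, g) :: v) Z1 _ _ e1.
  + by rewrite /= CV.
  + by rewrite /= addSn; apply: leq_trans vm; rewrite addnS.
  have [Z3 e3 l3] := IHC v Z2 vV vm e2.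
  exists Z3 => //; apply: leads_trans (leads_trans l2 l3).
  by apply: leads_step o1; [case: eZ | case: e1].
have CV := yields_in yC; have DV := yields_in yD.
have [|Z1 e1 o1] := @step_prod Z A C D g h v false r eZ.
  by apply: fits_size; rewrite /= ?CV ?DV //; apply: leq_trans vm; rewrite -addn2 -addnS leq_add2l.
have [||Z2 e2 l2] := IHC ((D, h) :: v) Z1 _ _ e1.
- by rewrite /= DV.
- by rewrite /= addSn; apply: leq_trans vm; rewrite addnS.
have [Z3 e3 l3] := IHD v Z2 vV vm e2.
exists Z3 => //; apply: leads_trans (leads_trans l2 l3).
by apply: leads_step o1; [case: eZ | case: e1].
Qed.

Lemma goal_leads k : 3 <= P -> yields (cfg_prods X) V k (cfg_start X) 1%g -> k < m ->
  leads (start_string P) (end_string P).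
Proof.
move=> P3 y km; have SV := yields_in y.
have [|Z1 e1 o1] := step_start P3.
  by apply: fits_size; rewrite /= ?SV //; apply: leq_trans km.
have [//|Z2 e2 l2] := yields_leads y (v := [::]) isT _ e1.
have w2 : wf Z2 by case: e2.
apply: leads_trans (leads_trans (leads_step (wf_start P3) _ o1) l2) _; first by case: e1.
apply: leads_step w2 (wf_end P3) _.
by have [_ [x [c ->]]] := e2; rewrite ok_unfold.
Qed.

End Chain.

Lemma reach_path d Z p : path arrow Z p -> size p = 2 ^ d -> reach P ok d Z (last Z p).
Proof.
elim: d Z p => [|d IH] Z p pth sz.
  by case: p sz pth => [|Z' [|]] //= _ /andP[/and3P[]].
have h : 2 ^ d + 2 ^ d = size p by rewrite sz expnS mul2n addnn.
move: pth; rewrite -{1}(cat_take_drop (2 ^ d) p) cat_path => /andP[p1 p2].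
exists (last Z (take (2 ^ d) p)); split.
- case e : (take _ p) p1 => [|Z1 q] p1.
    have le : 2 ^ d <= size p by rewrite -h leq_addr.
    by have := size_takel le; rewrite e => /esym/eqP; rewrite expn_eq0.
  have : wf (last Z (Z1 :: q)); last by [].
  by elim: q Z Z1 p1 {e p2} => [|Z2 q IHq] Z Z1 /=; [case/andP=> /and3P[] | case/andP=> _ /IHq].
- by apply: IH p1 _; rewrite size_takel // -h leq_addr.
rewrite -{2}(cat_take_drop (2 ^ d) p) last_cat; apply: IH p2 _.
by rewrite size_drop -h addnK.
Qed.

Lemma uniq_wf (l : seq (seq sym)) : uniq l -> all wf l -> size l <= 8 ^ P.
Proof.
move=> ul wl; rewrite -(size_map value) -(size_iota 0 (8 ^ P)).
apply: uniq_leq_size.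
  rewrite map_inj_in_uniq // => x y xl yl.
  have /andP[/eqP sx dx] := allP wl _ xl; have /andP[/eqP sy dy] := allP wl _ yl.
  by apply: value_inj; rewrite // sx sy.
move=> k /mapP[x xl ->]; rewrite mem_iota /= add0n.
by have /andP[/eqP <- dx] := allP wl _ xl; apply: value_lt.
Qed.

(** A path without repetitions visits at most [8 ^ P] strings. As [reach] asks for an exact number
    of steps, the path is prolonged by repeating the end string. *)
Lemma leads_reach : 3 <= P -> leads (start_string P) (end_string P) ->
  reach P ok (3 * P) (start_string P) (end_string P).
Proof.
move=> P3 [p pth lst].
have [q [pq uq lq]] : exists q, [/\ path arrow (start_string P) q, uniq (start_string P :: q) &
    last (start_string P) q = end_string P].
  have := shortenP pth; move eL : (last _ p) => L sh; have {eL} : L = end_string P by rewrite -eL.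
  by case: sh => q pq uq _ lq; exists q.
have wq : all wf (start_string P :: q).
  rewrite /= (wf_start P3) /=; elim: q (start_string P) pq {uq lq} => //= Z q IH Z0.
  by move=> /andP[/and3P[_ -> _] /IH].
have sq : size q <= 2 ^ (3 * P).
  by have := uniq_wf uq wq; rewrite expnM /=; apply: ltnW.
pose r := nseq (2 ^ (3 * P) - size q) (end_string P).
have lr : last (start_string P) (q ++ r) = end_string P.
  by rewrite last_cat lq /r; elim: (_ - _).
rewrite -{1}lr; apply: reach_path; last by rewrite size_cat size_nseq subnKC.
rewrite cat_path pq lq /r; elim: (_ - _) => //= k ->.
by rewrite /arrow (wf_end P3) andbT.
Qed.

End Strings.

(** * The decision procedure *)

Section Language.

Variables (gT : finGroupType) (X : cnf_grammar gT).

Notation prods := (cfg_prods X).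

(** A sentential form is read as a product in which each nonterminal takes any value it yields. This
    invariant is pulled back along derivation steps, from the word to the start symbol, so no parse
    tree has to be extracted. *)
Fixpoint value_of (l : seq (cfg_nonterm X + gT)) (g : gT) : Prop :=
  match l with
  | [::] => g = 1%g
  | inr a :: l' => exists2 h, value_of l' h & g = (a * h)%g
  | inl A :: l' => exists h1 h2,
      [/\ exists k, yields prods setT k A h1, value_of l' h2 & g = (h1 * h2)%g]
  end.

Lemma value_cat u v g h : value_of u g -> value_of v h -> value_of (u ++ v) (g * h)%g.
Proof.
move=> + vh; elim: u g => [|[A|a] u IH] g /=; first by move=> ->; rewrite mul1g.
  by move=> [h1 [h2 [y /IH vu ->]]]; exists h1, (h2 * h)%g; rewrite mulgA.
by move=> [h1 /IH vu ->]; exists (h1 * h)%g; rewrite ?mulgA.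
Qed.

Lemma value_split u v e : value_of (u ++ v) e ->
  exists g h, [/\ value_of u g, value_of v h & e = (g * h)%g].
Proof.
elim: u e => [|[A|a] u IH] e /=; first by exists 1%g, e; rewrite mul1g.
  move=> [h1 [h2 [y /IH[g1 [g2 [vu vv ->]]] ->]]]; exists (h1 * g1)%g, g2.
  by rewrite mulgA; split=> //; exists h1, g1.
move=> [h1 /IH[g1 [g2 [vu vv ->]]] ->]; exists (a * g1)%g, g2.
by rewrite mulgA; split=> //; exists g1.
Qed.

Lemma value_rhs r g : r \in prods -> value_of (rhs r) g ->
  exists k, yields prods setT k r.1 g.
Proof.
case: r => A [[C D]|a] hp; rewrite /rhs /=.
  move=> [h1 [h2 [[k1 y1] [h3 [h4 [[k2 y2] -> ->]]] ->]]].
  exists (maxn k1 k2).+1; rewrite mulg1; apply: yields_pair hp _ _; rewrite ?inE //.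
    by apply: yields_mono y1; rewrite ?leq_maxl.
  by apply: yields_mono y2; rewrite ?leq_maxr.
by move=> [h -> ->]; rewrite mulg1; exists 0; apply: yields_term hp; rewrite inE.
Qed.

Lemma derives_value l l' g : derives (X := X) l l' -> value_of l' g -> value_of l g.
Proof.
move=> d; elim: d g => {l l'} [l l' [u [v [r [hr -> ->]]]]|l|l1 l2 l3 _ IH1 _ IH2] g //.
  move=> /value_split[g1 [h1 [vu /value_split[g2 [h2 [vr vv ->]]] ->]]].
  apply: value_cat => //; have [k y] := value_rhs hr vr.
  by exists g2, h2; split=> //; exists k.
by move=> /IH2/IH1.
Qed.

Lemma derives_context u v l l' : derives (X := X) l l' ->
  derives (X := X) (u ++ l ++ v) (u ++ l' ++ v).
Proof.
elim=> {l l'} [l l' [u' [v' [r [hr -> ->]]]]|l|l1 l2 l3 _ IH1 _ IH2].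
- apply: rt_step; exists (u ++ u'), (v' ++ v), r.
  by split=> //; rewrite -!catA.
- exact: rt_refl.
exact: rt_trans IH1 IH2.
Qed.

Lemma yields_word k A g : yields prods setT k A g ->
  exists2 w : seq gT, derives (X := X) [:: inl A] [seq inr a | a <- w] &
    (\prod_(a <- w) a)%g = g.
Proof.
have pair A1 C D g1 h1 : (A1, inl (C, D)) \in prods ->
    (exists2 w : seq gT, derives (X := X) [:: inl C] [seq inr a | a <- w] &
      (\prod_(a <- w) a)%g = g1) ->
    (exists2 w : seq gT, derives (X := X) [:: inl D] [seq inr a | a <- w] &
      (\prod_(a <- w) a)%g = h1) ->
    exists2 w : seq gT, derives (X := X) [:: inl A1] [seq inr a | a <- w] &
      (\prod_(a <- w) a)%g = (g1 * h1)%g.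
  move=> hp [w1 d1 <-] [w2 d2 <-]; exists (w1 ++ w2); last by rewrite big_cat.
  apply: (@rt_trans _ _ _ [:: inl C; inl D]).
    by apply: rt_step; exists [::], [::], (A1, inl (C, D)).
  have := derives_context [::] [:: inl D] d1; rewrite /= => e1.
  have := derives_context [seq inr a | a <- w1] [::] d2; rewrite !cats0 => e2.
  by rewrite map_cat; apply: rt_trans e1 e2.
elim=> {k A g} [k A g _ hp|k A C D g h _ hp _ IH1 _ IH2|k A C D g h _ hp _ IH1 _ IH2].
- exists [:: g]; last by rewrite big_seq1.
  by apply: rt_step; exists [::], [::], (A, inr g).
- exact: pair hp IH1 IH2.
exact: pair hp IH1 IH2.
Qed.

Lemma generates_oneP :
  generates_one X <-> exists k, yields prods setT k (cfg_start X) 1%g.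
Proof.
split=> [[w dw pw]|[k /yields_word[w dw pw]]]; last by exists w.
have vw : value_of [seq inr a | a <- w] (\prod_(a <- w) a)%g.
  elim: (w) => [|a w' IH]; first by rewrite big_nil.
  by rewrite big_cons /=; exists (\prod_(a <- w') a)%g.
have := derives_value dw vw; rewrite pw => -[h1 [h2 [y -> e]]].
by rewrite e mulg1.
Qed.

(** The type of nonterminals may contain symbols without productions, which the input need not
    mention and whose number its length does not bound. Left-hand sides are at most as many as
    productions, and all nonterminals of a derivation tree are among them. *)
Definition lhs : {set cfg_nonterm X} := [set A in [seq r.1 | r <- prods]].

Lemma yields_lhs k A g : yields prods setT k A g -> yields prods lhs k A g.
Proof.
have inl r : r \in prods -> r.1 \in lhs by move=> h; rewrite inE map_f.
elim=> {k A g} [k A g _ hp|k A C D g h _ hp _ y1 _ y2|k A C D g h _ hp _ y1 _ y2].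
- exact: yields_term (inl _ hp) hp.
- exact: yields_left (inl _ hp) hp y1 y2.
exact: yields_right (inl _ hp) hp y1 y2.
Qed.

Lemma card_lhs : #|lhs| <= size prods.
Proof.
by rewrite cardsE (leq_trans (card_size _)) // size_map.
Qed.

End Language.

Lemma card_group B : #|bb_group B| <= 2 ^ bb_b B.
Proof.
have inj : injective (@name B).
  by move=> g h e; have := nameE g; rewrite e nameE => -[].
by have := leq_card _ inj; rewrite card_tuple card_bool.
Qed.

(** This is the requirement of [goal_leads] with [m] one above the Strahler bound. That bound is
    cubic and an item has linear length, so the left side is at most [8 * N ^ 4]; the summand 8 in
    [N] makes this at most [N ^ 5]. *)
Lemma size_bound v n b c : v <= n ->
  (v * (2 * b) * v.+1 + v).+1 * (n + b + 2) + b + c + n.+2 + 5 <= (b + c + n + 2 + 8) ^ 5.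
Proof.
move=> vn; set N := b + c + n + 2 + 8.
have N8 : 8 <= N by rewrite leq_addl.
have h1 : v * (2 * b) * v.+1 <= N * (2 * N) * N by rewrite !leq_mul //; rewrite /N; lia.
have h2 : N <= N * N * N.
  by rewrite -{1}[N]mul1n leq_mul2r; apply/orP; right; rewrite muln_gt0; lia.
have h3 : (v * (2 * b) * v.+1 + v).+1 * (n + b + 2) <= 3 * (N * N * N) * N.
  apply: leq_mul; last by rewrite /N; lia.
  have v1 : v.+1 <= N by rewrite /N; lia.
  have e1 : N * (2 * N) * N = 2 * (N * N * N) by lia.
  by move: h1; rewrite e1; lia.
have h4 : b + c + n.+2 + 5 <= N by rewrite /N; lia.
have h5 : N <= N * N * N * N by apply: leq_trans h2 _; apply: leq_pmulr; lia.
have -> : N ^ 5 = N * N * N * N * N by rewrite !expnS expn0; lia.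
have h6 : 8 * (N * N * N * N) <= N * N * N * N * N by rewrite mulnC leq_mul2l N8 orbT.
lia.
Qed.

(** The factor 22 counts the tapes, 19 stacks and three others; [N ^ 5] is at least 100000 and
    absorbs it together with the 1000. *)
Lemma space_bound N : 10 <= N -> 22 * (1000 * (N ^ 5) ^ 2).+2 <= N ^ 15.
Proof.
move=> N10; have -> : N ^ 15 = N ^ 5 * (N ^ 5) ^ 2 by rewrite -expnM -expnD.
have NN : 100 * 1000 <= N ^ 5.
  have N2 : 100 <= N * N by apply: (@leq_mul 10 10).
  have N3 : 1000 <= N * N * N by apply: (@leq_mul 100 10).
  have -> : N ^ 5 = (N * N) * (N * N * N) by rewrite !expnS expn0; lia.
  exact: leq_mul.
have p1 : 1 <= (N ^ 5) ^ 2 by rewrite !expn_gt0; lia.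
have h : 100 * 1000 * (N ^ 5) ^ 2 <= N ^ 5 * (N ^ 5) ^ 2 by rewrite leq_mul2r NN orbT.
apply: leq_trans h; move: ((N ^ 5) ^ 2) p1 => k; lia.
Qed.

Lemma size_code_flatten b (N : eqType) (nt : N -> seq bool)
    (s : seq (production N (word b))) (r : production N (word b)) :
  r \in s -> size (production_code nt r) <=
    size (flatten [seq production_code nt r | r <- s]).
Proof.
elim: s => //= r' s IH; rewrite inE => /orP[/eqP -> |/IH h]; rewrite size_cat.
  exact: leq_addr.
exact: leq_trans h (leq_addl _ _).
Qed.

Lemma size_flatten_code b N (nt : N -> seq bool) (s : seq (production N (word b))) :
  size s <= size (flatten [seq production_code nt r | r <- s]).
Proof.
elim: s => //= r s IH; rewrite size_cat -add1n leq_add //.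
by case: r => a [[]|].
Qed.

Lemma decide_correct B (X : cnf_grammar (bb_group B)) (nt : cfg_nonterm X -> seq bool)
    (s : seq (production (cfg_nonterm X) (word (bb_b B))))
    (w := [seq Some e | e <- nt (cfg_start X)] ++
          flatten [seq production_code (b := bb_b B) nt r | r <- s])
    (P := (size (bb_input B w) + 8) ^ 5) :
  injective nt ->
  [seq decode_production r | r <- s] = [seq Some r | r <- cfg_prods X] ->
  reach P (leaf_ok B (rev (grammar_code nt (cfg_start X) s))) (3 * P)
    (start_string P) (end_string P) <-> generates_one X.
Proof.
move=> nt_inj sP; rewrite generates_oneP; split.
  move=> /(reach_sound nt_inj sP) h.
  have : good nt (Start :: Bar :: nseq (P - 3) Zero) := h (good_nil nt _).
  (* Only [good_start] can apply: an item begins with a bit or, if its nonterminal is written by the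
     empty string, with [Hash]. *)
  move e : (Start :: _) => l gl; case: gl e => [c|l' d _|a h' g l' _ _ _ _] //.
  by case: (nt a) => [|[]].
move=> [k /yields_lhs y].
have gb := card_group B.
have [nw [nE sW wE]] : exists n, [/\ size (bb_input B w) = bb_b B + bb_c B + n + 2,
    size (rev (grammar_code nt (cfg_start X) s)) = n.+2 &
    size (flatten [seq production_code (b := bb_b B) nt r | r <- s]) <= n].
  exists (size w); split.
  - by rewrite /bb_input size_cat /= size_cat /= !size_nseq addn2 !addnS addnA.
  - by rewrite size_rev size_grammar_code.
  - by rewrite size_cat leq_addl.
have P3 : 3 <= P by apply: (@leq_trans (3 ^ 5)) => //; rewrite /P leq_exp2r //; lia.
apply: (leads_reach P3).
have ntV A : A \in lhs X -> size (nt A) <= nw.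
  rewrite inE => /mapP[r' /(prod_rule sP) [r rs e] ->].
  apply: leq_trans wE; apply: leq_trans (size_code_flatten nt rs).
  have -> : r'.1 = r.1.
    case: r e {rs} => a [[c d]|x]; rewrite /decode_production /=; first by case=> <-.
    by case: bb_f => //= g [<-].
  by case: (r) => a [[c d]|x]; rewrite /production_code /= size_cat size_map; lia.
have cV : #|lhs X| <= nw.
  apply: leq_trans wE; apply: leq_trans (size_flatten_code nt s).
  by apply: leq_trans (card_lhs X) _; rewrite -(size_map Some) -sP size_map.
apply: (goal_leads sP ntV _ P3 (yields_bound gb y) (ltnSn _)).
rewrite sW /strahler_bound /P nE.
exact: size_bound.
Qed.

Theorem theorem4p1 : in_PSPACE cf_subset_membership.
Proof.
exists (compile 19 decide (top_is 8 One)); split; first exact: compile_deterministic.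
(* The 10 consists of the two separators of the input and the 8 added in [P]; the space is quadratic
   in [P], of degree 10, and five more degrees absorb the constants. *)
exists (('X + 10%:P) ^+ 15)%R => B X w [nt [s [nt_inj sP ->]]].
set w' := _ ++ _.
have [r rP [t ex tr]] := exec_decide nt (cfg_start X) s.
set n := size (bb_input B w') in ex rP *.
have nE : n = bb_b B + bb_c B + size w' + 2.
  by rewrite /n /bb_input size_cat /= size_cat /= !size_nseq addn2 !addnS addnA.
have N10 : 10 <= n + 8 by rewrite nE; lia.
have [|acc spc] := @compileP 19 decide (top_is 8 One) B (bb_input B w') t _ isT _ ex.
  apply: (@leq_trans ((n + 8) ^ 10)).
    by apply: (@leq_trans (n + 8)); rewrite ?leq_addr // -{1}[n + 8]expn1 leq_pexp2l //; lia.
  by rewrite -expnM; apply: leq_pmull.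
split; first by rewrite acc tr rP decide_correct.
move=> c /spc le; apply: leq_trans le _.
rewrite horner_exp hornerD hornerX hornerC natrXE natrDE.
have -> : bb_b B + bb_c B + size w' + 10 = n + 8 by rewrite nE -[_ + 2 + 8]addnA.
exact: space_bound.
Qed.
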